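(* Let $M$ be a connected complete Riemannian manifold of nonpositive sectional curvature with finite volume $\operatorname{vol}(M)$. Let $K$ be its universal covering space and $p : K \to M$ the covering map. Then for every $t > 0$ there exist a point $x \in K$ and a point $q = p(x) \in M$ such that $$P_q(t) \geq \frac{\operatorname{vol}\left(B_{t/2}(x)\right)}{\operatorname{vol}(M)} - 2 .$$
   Context: The universal covering $K$ carries the Riemannian metric pulled back from $M$. $\operatorname{vol}$ denotes Riemannian volume, and $B_r(x) \subset K$ is the ball of radius $r$ with center $x$ in $K$. A geodesic loop $\delta \subset M$ with base point $q$ is a geodesic arc in $M$ starting and ending at $q$ (not required to be smooth at $q$); it defines a homotopy class $[\delta] \in \pi_1(M,q)$. The length of $[\delta]$ is the length of the shortest geodesic loop in the homotopy class, $$l([\delta]) = \min_{\delta' \in [\delta]} l(\delta').$$ Since the curvature of $M$ is nonpositive, there is a unique shortest loop in each homotopy class. For $q \in M$ and $t > 0$, $$P_q(t) = \#\{\delta \subset M \mid \delta \text{ geodesic loop with base point } q \text{ such that } l([\delta]) \leq t\}.$$ *)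

(* Defs.v *)
From HB Require Import structures.
From mathcomp Require Import all_boot all_order all_algebra.
From mathcomp Require Import all_classical all_reals all_analysis.

Set Implicit Arguments.
Unset Strict Implicit.
Unset Printing Implicit Defensive.

Import Order.TTheory GRing.Theory Num.Theory.
Import numFieldNormedType.Exports.

Local Open Scope classical_set_scope.
Local Open Scope ring_scope.

(* Tangent vectors are row vectors: a bilinear form is u *m G *m v^T, and the
   differential of f at x is v |-> v *m 'J f x. *)

Section Calculus.
Context {R : realType}.

Fixpoint Ck_on n (W : normedModType R) (k : nat) (U : set 'rV[R]_n)
    (f : 'rV[R]_n -> W) : Prop :=
  {in U, continuous f} /\
  if k is k'.+1 then
    forall v, {in U, forall x, derivable f x v} /\ Ck_on k' U ('D_v f)
  else True.

Definition smooth_on n (W : normedModType R) (U : set 'rV[R]_n)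
    (f : 'rV[R]_n -> W) : Prop := forall k, Ck_on k U f.

Definition partial n (i : 'I_n) (f : 'rV[R]_n -> R) (x : 'rV[R]_n) : R :=
  'D_(delta_mx 0 i) f x.

(* Integral against n-dimensional Lebesgue measure, as an iterated integral;
   by Tonelli this is the right notion for nonnegative Borel integrands, the
   only ones it is applied to. *)
Fixpoint rV_integral (n : nat) : ('rV[R]_n -> \bar R) -> \bar R :=
  match n return ('rV[R]_n -> \bar R) -> \bar R with
  | 0%N => fun f => f 0
  | m.+1 => fun f =>
      (\int[lebesgue_measure]_(x in [set: R])
          rV_integral (fun v : 'rV[R]_m => f (row_mx (x%:M : 'rV[R]_1) v)))%E
  end.

Definition inner n (G : 'M[R]_n) (u v : 'rV[R]_n) : R := (u *m G *m v^T) 0 0.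

End Calculus.

Section RiemannianManifolds.
Context {R : realType}.

Record chart (n : nat) (T : topologicalType) := Chart {
  cdom : set T;
  cmap :> T -> 'rV[R]_n;
  cinv : 'rV[R]_n -> T;
  cdom_open : open cdom;
  crange_open : open (cmap @` cdom);
  cmapK : {in cdom, cancel cmap cinv};
  cmap_continuous : {in cdom, continuous cmap};
  cinv_continuous : {in cmap @` cdom, continuous cinv} }.

(* [metric phi] is the Gram matrix of the metric in the chart [phi], as a
   function of the coordinates; it is only meaningful on the range of a chart
   of the atlas. The base point of [ptopologicalType] only says that the
   manifold is nonempty. *)
Record riemannianManifold (n : nat) := RiemannianManifold {
  carrier :> ptopologicalType;
  manifold_hausdorff : hausdorff_space carrier;
  manifold_second_countable : @second_countable carrier;
  atlas : set (chart n carrier);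
  atlas_cover : forall x, exists2 phi, atlas phi & cdom phi x;
  atlas_smooth : forall phi psi, atlas phi -> atlas psi ->
    smooth_on (phi @` (cdom phi `&` cdom psi)) (psi \o cinv phi);
  metric : chart n carrier -> 'rV[R]_n -> 'M[R]_n;
  metric_smooth : forall phi, atlas phi ->
    smooth_on (phi @` cdom phi) (metric phi);
  metric_symmetric : forall phi x, atlas phi -> cdom phi x ->
    (metric phi (phi x))^T = metric phi (phi x);
  metric_pos : forall phi x v, atlas phi -> cdom phi x -> v != 0 ->
    0 < inner (metric phi (phi x)) v v;
  metric_change : forall phi psi x, atlas phi -> atlas psi ->
    cdom phi x -> cdom psi x ->
    let J := 'J (psi \o cinv phi) (phi x) in
    metric phi (phi x) = J *m metric psi (psi x) *m J^T }.

Section Curvature.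
Context {n : nat}.

(* Gamma^k_{ij} of the metric g in coordinates. *)
Definition christoffel (g : 'rV[R]_n -> 'M[R]_n) (k i j : 'I_n)
    (x : 'rV[R]_n) : R :=
  2^-1 * \sum_(l < n) invmx (g x) k l *
    (partial i (fun y => g y j l) x + partial j (fun y => g y i l) x
     - partial l (fun y => g y i j) x).

(* The l-th component of R(d_i, d_j) d_k, for the convention
   R(X, Y) Z = D_X D_Y Z - D_Y D_X Z - D_[X, Y] Z. *)
Definition riemann_coef (g : 'rV[R]_n -> 'M[R]_n) (l i j k : 'I_n)
    (x : 'rV[R]_n) : R :=
  partial i (christoffel g l j k) x - partial j (christoffel g l i k) x
  + \sum_(m < n) (christoffel g m j k x * christoffel g l i m x
                  - christoffel g m i k x * christoffel g l j m x).

Definition riemann (g : 'rV[R]_n -> 'M[R]_n) (x u v w : 'rV[R]_n) : 'rV[R]_n :=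
  \row_l \sum_(i < n) \sum_(j < n) \sum_(k < n)
    riemann_coef g l i j k x * u 0 i * v 0 j * w 0 k.

Definition sectional_curvature (g : 'rV[R]_n -> 'M[R]_n) (x u v : 'rV[R]_n) : R :=
  inner (g x) (riemann g x u v v) u /
  (inner (g x) u u * inner (g x) v v - inner (g x) u v ^+ 2).

End Curvature.

Section Geometry.
Context {n : nat} (M : riemannianManifold n).

Definition nonpositively_curved : Prop :=
  forall (phi : chart n M) (x : M) (u v : 'rV[R]_n),
    atlas phi -> cdom phi x -> row_free (col_mx u v) ->
    sectional_curvature (metric phi) (phi x) u v <= 0.

(* The value does not depend on the chart when c is differentiable at s. *)
Definition speed (c : R -> M) (s : R) : R :=
  xget 0 [set r | exists phi : chart n M,
    [/\ atlas phi, cdom phi (c s) &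
        let w := derive1 (phi \o c) s in
        r = Num.sqrt (inner (metric phi (phi (c s))) w w)]].

Definition curve_length (c : R -> M) : R :=
  \int[lebesgue_measure]_(s in `[0, 1]) speed c s.

Definition C1_at (c : R -> M) (s : R) : Prop :=
  {for s, continuous c} /\
  forall phi : chart n M, atlas phi -> cdom phi (c s) ->
    (\forall u \near s, derivable (phi \o c) u 1) /\
    {for s, continuous (derive1 (phi \o c))}.

(* C^1 on the closed unit interval: C^1 on an open interval around it. *)
Definition C1_arc (c : R -> M) : Prop :=
  exists2 e : R, 0 < e & forall s, s \in `]- e, 1 + e[ -> C1_at c s.

(* [piecewise_C1 x y l]: some piecewise C^1 curve from x to y, given as a
   concatenation of C^1 arcs, has length l. *)
Inductive piecewise_C1 (x : M) : M -> R -> Prop :=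
| PiecewiseNil : piecewise_C1 x x 0
| PiecewiseSnoc c l : piecewise_C1 x (c 0) l -> C1_arc c ->
    piecewise_C1 x (c 1) (l + curve_length c).

Definition riemannian_dist (x y : M) : R := inf [set l | piecewise_C1 x y l].

Definition riemannian_ball (x : M) (r : R) : set M :=
  [set y | riemannian_dist x y < r].

Definition riemannian_complete : Prop :=
  forall u : nat -> M,
    (forall e : R, 0 < e -> exists N : nat, forall i j : nat,
        (N <= i)%N -> (N <= j)%N -> riemannian_dist (u i) (u j) < e) ->
    exists x, riemannian_dist (u i) x @[i --> \oo] --> (0 : R).

(* Geodesic equation D_{c'} c' = 0 at time s. *)
Definition geodesic_at (c : R -> M) (s : R) : Prop :=
  {for s, continuous c} /\
  forall phi : chart n M, atlas phi -> cdom phi (c s) ->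
    let x := phi \o c in
    [/\ \forall u \near s, derivable x u 1,
        derivable (derive1 x) s 1 &
        forall k, derive1 (derive1 x) s 0 k +
          \sum_(i < n) \sum_(j < n) christoffel (metric phi) k i j (x s) *
            derive1 x s 0 i * derive1 x s 0 j = 0].

(* Geodesic loops are parametrized on [0, 1] (hence proportionally to arc
   length); the value q outside [0, 1] is a normalization that makes two loops
   equal as soon as they agree on [0, 1]. The constant loop is included. *)
Definition geodesic_loop (q : M) (d : R -> M) : Prop :=
  exists (e : R) (c : R -> M),
    [/\ 0 < e, forall s, s \in `]- e, 1 + e[ -> geodesic_at c s,
        c 0 = q, c 1 = q & d = fun s => if s \in `[0, 1] then c s else q].

End Geometry.

Section Homotopy.
Context {T : topologicalType}.

(* Homotopy of paths on [0, 1], relative to the end points. *)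
Definition path_homotopic (c c' : R -> T) : Prop :=
  exists H : R * R -> T,
    [/\ {within `[0, 1] `*` `[0, 1], continuous H},
        forall s, s \in `[0, 1] -> H (s, 0) = c s /\ H (s, 1) = c' s &
        forall u, u \in `[0, 1] -> H (0, u) = c 0 /\ H (1, u) = c 1].

End Homotopy.

Definition simply_connected (T : topologicalType) : Prop :=
  (forall x y : T, exists c : R -> T,
      [/\ {within `[0, 1], continuous c}, c 0 = x & c 1 = y]) /\
  (forall c : R -> T, {within `[0, 1], continuous c} -> c 0 = c 1 ->
      path_homotopic c (fun=> c 0)).

Definition covering_map (S T : topologicalType) (p : S -> T) : Prop :=
  [/\ continuous p,
      forall q, exists x, p x = q &
      forall q, exists (U : set T) (sheets : set (set S)),
        [/\ open_nbhs q U,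
            p @^-1` U = \bigcup_(V in sheets) V,
            trivIset sheets id &
            forall V, sheets V ->
              [/\ open V, set_bij V U p &
                  forall W, open W -> W `<=` V -> open (p @` W)]]].

Section Covering.
Context {n : nat} (K M : riemannianManifold n) (p : K -> M).

(* p is smooth and the metric of K is the pull-back of the metric of M. *)
Definition metric_pullback : Prop :=
  forall (phi : chart n K) (psi : chart n M), atlas phi -> atlas psi ->
    let f := psi \o p \o cinv phi in
    let D := cdom phi `&` p @^-1` cdom psi in
    smooth_on (phi @` D) f /\
    forall x, D x ->
      metric phi (phi x) =
        'J f (phi x) *m metric psi (psi (p x)) *m ('J f (phi x))^T.

Definition riemannian_universal_covering : Prop :=
  [/\ simply_connected K, covering_map p & metric_pullback].

End Covering.

Section LoopCounting.
Context {n : nat} (M : riemannianManifold n).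

(* l([d]) = l *)
Definition class_length (q : M) (d : R -> M) (l : R) : Prop :=
  exists d0 : R -> M,
    [/\ geodesic_loop q d0, path_homotopic d d0, curve_length d0 = l &
        forall d', geodesic_loop q d' -> path_homotopic d d' ->
          l <= curve_length d'].

(* P_q(t), with value +oo for an infinite set of loops *)
Definition loop_count (q : M) (t : R) : \bar R :=
  counting [set d : R -> M |
    geodesic_loop q d /\ exists2 l, class_length q d l & l <= t].

End LoopCounting.

End RiemannianManifolds.

Arguments riemannianManifold : clear implicits.

Notation borel T := (g_sigma_algebraType (@open T)).

(* The Riemannian measure: the (unique) Borel measure equal to
   sqrt (det g) dx in every chart. *)
Definition riemannian_volume (R : realType) (n : nat)
    (M : riemannianManifold R n)
    (mu : {measure set (borel M) -> \bar R}) : Prop :=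
  forall (phi : chart n M) (A : set (borel M)), atlas phi ->
    measurable A -> A `<=` cdom phi ->
    mu A = rV_integral (fun v : 'rV[R]_n =>
      (\1_(phi @` A) v * Num.sqrt (\det (metric phi v)))%:E).

(* Main.v *)
Require Import Defs.
From mathcomp Require Import all_boot all_order all_algebra.
From mathcomp Require Import all_classical all_reals all_analysis.
From mathcomp Require Import measurable_realfun ring lra.

Set Implicit Arguments.
Unset Strict Implicit.
Unset Printing Implicit Defensive.

Import Order.TTheory GRing.Theory Num.Theory.
Import numFieldNormedType.Exports.

Local Open Scope classical_set_scope.
Local Open Scope ring_scope.

(** The inequality holds at every point x of K, with q = p x. Let N be the number
    of geodesic loops counted at q, assumed finite.

    If y_1, ..., y_m are distinct points of the ball of radius t/2 about x that lie
    over one point of M, then m <= N (fiber_loops). Indeed, choose a path of length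
    less than t/2 from x to y_1, and lift the reversed projected path from each of
    the y_i. The lifts end at distinct points z_i over q, at distance at most t
    from x. Since M is complete, so is K (covering_complete), and there is a
    minimal geodesic from x to z_i (complete_minimal_geodesic). Its projection is a
    geodesic loop at q, and it is shortest in its class, because a homotopic loop
    lifts to a path from x to z_i as well (homotopy_lift, minimal_loop). Distinct end
    points belong to distinct loops, by uniqueness of lifts.

    So p is at most N to one on the ball. As p is a local isometry, it
    preserves volumes locally, hence the volume of the ball is at most N vol(M)
    (ball_volume_le_multiplicity); dividing by vol(M) gives the claim.
    If vol(M) = 0, the volume of the ball vanishes as well.

    Three bodies of theory are built on the way.

    The distance is an infimum of lengths and geodesics solve a differential
    equation in charts, so the two have to be related. Short geodesics are
    obtained as solutions of a two-point boundary value problem, by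
    a contraction (boundary_value), and a direct comparison of energies
    (energy_comparison) shows that they are the unique shortest curves between
    their end points (local_geodesics). Consequently a curve whose distances are
    locally proportional to the parameter solves the geodesic equation
    (metric_geodesic_regular), and the existence of minimal geodesics reduces to
    metric geometry, where it is proved by long steps towards the target
    (complete_joined).

    Lifting is done for arbitrary covering maps; homotopic paths have lifts with the
    same end point.

    The Riemannian volume is computed in charts by iterated integrals. These are
    easily evaluated on parallelepipeds of a special shape only (flag_volume), but by the
    Bruhat decomposition every invertible matrix maps suitable parallelepipeds of this
    shape to others (bruhat). Cutting open sets into small cells of this kind shows that a
    map that is infinitesimally isometric at a point increases volumes near this
    point by a factor arbitrarily close to 1 at most (local_volume_le). *)

(** * Primitives and comparison of increments *)

Section Primitive.
Context {R : realType}.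
Implicit Types (f g F G : R -> R) (a b s t : R).

Lemma near_ltr s b : s < b -> \forall u \near s, u < b.
Proof.
move=> sb; have := @near_in_itvNyo R b s; rewrite !in_itv /= sb => /(_ isT).
by apply: filterS => u; rewrite in_itv.
Qed.

Lemma near_gtr s a : a < s -> \forall u \near s, a < u.
Proof.
move=> sa; have := @near_in_itvoy R a s; rewrite !in_itv /= sa => /(_ isT).
by apply: filterS => u; rewrite in_itv /= andbT.
Qed.

Lemma is_derive_continuous (W : normedModType R) (F : R -> W) (w : W) s :
  is_derive s 1 F w -> {for s, continuous F}.
Proof.
by move=> dF; apply: differentiable_continuous; apply/derivable1_diffP.
Qed.

Lemma increment_le F G (f g : R -> R) a b : a <= b ->
  (forall s, s \in `[a, b] -> is_derive s 1 F (f s)) ->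
  (forall s, s \in `[a, b] -> is_derive s 1 G (g s)) ->
  (forall s, s \in `[a, b] -> f s <= g s) ->
  F b - F a <= G b - G a.
Proof.
move=> ab dF dG fg.
have dGF s : s \in `[a, b] -> is_derive s 1 (G - F) (g s - f s).
  by move=> sab; have ? := dF s sab; have ? := dG s sab; apply: is_deriveB.
suff : (G - F) a <= (G - F) b by rewrite !fctE; lra.
apply: (@ger0_derive1_le_cc _ _ a b) => //.
- by move=> s /subset_itv_oo_cc sab; have := dGF s sab; case.
- move=> s /subset_itv_oo_cc sab; have ? := dGF s sab.
  by rewrite derive1E derive_val subr_ge0 fg.
- apply: derivable_within_continuous => s sab; by have := dGF s sab; case.
- by rewrite bound_itvE.
- by rewrite bound_itvE.
Qed.

Lemma is_derive_mulr (k s : R) : is_derive s 1 (fun t : R => t * k) k.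
Proof.
have : is_derive s 1 (k *: (@id R)) (k *: 1) by exact: is_deriveZ.
rewrite /= [k *: 1]mulr1; congr (is_derive _ _ _ _).
by apply/funext => t; rewrite !fctE /= [RHS]mulrC.
Qed.

Lemma norm_increment_le F G (f g : R -> R) a b : a <= b ->
  (forall s, s \in `[a, b] -> is_derive s 1 F (f s)) ->
  (forall s, s \in `[a, b] -> is_derive s 1 G (g s)) ->
  (forall s, s \in `[a, b] -> `|f s| <= g s) ->
  `|F b - F a| <= G b - G a.
Proof.
move=> ab dF dG fg; rewrite ler_norml; apply/andP; split; last first.
  by apply: increment_le ab dF dG _ => s sab; apply: le_trans (fg s sab); exact: ler_norm.
suff : (- F) b - (- F) a <= G b - G a by rewrite !fctE; lra.
apply: (@increment_le (- F) G (fun u => - f u) g a b) => //.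
  by move=> s sab; apply: is_deriveN (dF s sab).
by move=> s sab; apply: le_trans (fg s sab); rewrite -normrN ler_norm.
Qed.

Lemma increment_eq F G (f : R -> R) a b : a <= b ->
  (forall s, s \in `[a, b] -> is_derive s 1 F (f s)) ->
  (forall s, s \in `[a, b] -> is_derive s 1 G (f s)) ->
  F b - F a = G b - G a.
Proof.
by move=> ab dF dG; apply/eqP; rewrite eq_le !(increment_le ab dF dG,
  increment_le ab dG dF).
Qed.

Lemma increment_eq_from F G (f : R -> R) a b : a <= b ->
  (forall s, s \in `[a, b] -> is_derive s 1 F (f s)) ->
  (forall s, s \in `[a, b] -> is_derive s 1 G (f s)) ->
  F a = G a -> F b = G b.
Proof. by move=> ab dF dG; have := increment_eq ab dF dG; lra. Qed.

Lemma increment_ge0 F f a b : a <= b ->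
  (forall s, s \in `[a, b] -> is_derive s 1 F (f s)) ->
  (forall s, s \in `[a, b] -> 0 <= f s) -> F a <= F b.
Proof.
move=> ab dF f0; rewrite -subr_ge0 -[leLHS](subrr (cst 0 a : R)).
exact: (@increment_le (cst 0) F (cst 0) f a b).
Qed.

Lemma increment_cst F a b : a <= b ->
  (forall s, s \in `[a, b] -> is_derive s 1 F 0) -> F a = F b.
Proof.
move=> ab dF; apply/esym/eqP; rewrite -subr_eq0.
by rewrite (@increment_eq F (cst 0) (cst 0) a b) // subrr.
Qed.

Let integral_derive f a s : continuous f -> a < s ->
  is_derive s 1 (fun x => \int[lebesgue_measure]_(t in `[a, x]) f t) (f s).
Proof.
move=> cf as_; have [||dI I'] := @continuous_FTC1_closed R f a s (s + 1) _ _ as_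
  (cf s).
- by rewrite ltrDl.
- apply: continuous_compact_integrable; first exact: segment_compact.
  exact: continuous_subspaceT.
apply: DeriveDef; first exact: dI.
by rewrite -derive1E; exact: I'.
Qed.

(** The fundamental theorem of calculus differentiates an integral to the right
    of its base point only; the reflected function gives a primitive on the
    other side, and the two differ by a constant where both are defined. *)
Lemma ex_primitive f : continuous f ->
  exists F, F 0 = 0 /\ forall s, is_derive s 1 F (f s).
Proof.
move=> cf.
pose G x : R := \int[lebesgue_measure]_(t in `[- 1, x]) f t.
pose H x : R := - \int[lebesgue_measure]_(t in `[- 1, - x]) (f \o -%R) t.
have dG s : -1 < s -> is_derive s 1 G (f s) by exact: integral_derive.
have dH s : s < 1 -> is_derive s 1 H (f s).
  move=> s1.
  have cfN : continuous (f \o -%R).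
    by move=> x; apply: continuous_comp; [exact: opp_continuous | exact: cf].
  have := @integral_derive (f \o -%R) (-1) (- s) cfN; rewrite ltrN2 => /(_ s1).
  rewrite /= opprK => d1.
  have d2 : is_derive s 1 (-%R : R -> R) (- 1) by exact: is_deriveN.
  have := is_derive1_comp d1 d2.
  by move/is_deriveN; rewrite mulrN1 opprK.
have GH s : s \in `](-1 : R), 1[ -> G s = H s + (G 0 - H 0).
  rewrite in_itv /= => /andP[s1 s2].
  have [s0|s0] := leP 0 s.
    suff : G s - G 0 = H s - H 0 by lra.
    apply: increment_eq s0 _ _ => u; rewrite in_itv /= => /andP[u0 us].
      by apply: dG; lra.
    by apply: dH; lra.
  suff : G 0 - G s = H 0 - H s by lra.
  apply: increment_eq (ltW s0) _ _ => u; rewrite in_itv /= => /andP[u0 us].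
    by apply: dG; lra.
  by apply: dH; lra.
pose F x := if x < 0 then H x - H 0 else G x - G 0.
exists F; split; first by rewrite /F ltxx subrr.
move=> s; have [s0|s0] := ltP s 0.
  have : is_derive s 1 (H - cst (H 0)) (f s - 0).
    by apply: is_deriveB; apply: dH; lra.
  rewrite subr0; apply: near_eq_is_derive.
  by apply: filterS (near_ltr s0) => u u0; rewrite /F u0.
have : is_derive s 1 (G - cst (G 0)) (f s - 0).
  by apply: is_deriveB; apply: dG; lra.
rewrite subr0; apply: near_eq_is_derive.
have /near_gtr : -1 < s by lra.
apply: filterS => u u1; rewrite /F; case: ifPn => // u0.
rewrite !fctE GH; first by lra.
by rewrite in_itv /=; lra.
Qed.

Lemma prim_subproof : {P : (R -> R) -> R -> R | forall f, continuous f ->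
  P f 0 = 0 /\ forall s, is_derive s 1 (P f) (f s)}.
Proof.
suff /choice[P HP] : forall f, exists F : R -> R, continuous f ->
  F 0 = 0 /\ forall s, is_derive s 1 F (f s) by exists P.
move=> f; have [cf|ncf] := pselect (continuous f); last by exists 0.
by have [F HF] := ex_primitive cf; exists F.
Qed.

(** A primitive vanishing at 0, chosen once and for all so that primitives can be
    handled as an operator on functions. *)
Definition prim : (R -> R) -> R -> R := sval prim_subproof.

Lemma prim0 f : continuous f -> prim f 0 = 0.
Proof. by move=> /(svalP prim_subproof f)[]. Qed.

Lemma is_derive_prim f s : continuous f -> is_derive s 1 (prim f) (f s).
Proof. by move=> /(svalP prim_subproof f)[]. Qed.

Lemma continuous_prim f : continuous f -> continuous (prim f).
Proof. by move=> cf s; exact/is_derive_continuous/is_derive_prim. Qed.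

Lemma Rintegral01_prim f : continuous f ->
  \int[lebesgue_measure]_(s in `[0, 1]) f s = prim f 1.
Proof.
move=> cf; rewrite /Rintegral (@continuous_FTC2 _ f (prim f)) //.
- by rewrite /= prim0 // subr0.
- exact: continuous_subspaceT.
- split.
  + by move=> s _; have := is_derive_prim s cf; case.
  + by apply: cvg_at_right_filter; exact: continuous_prim.
  + by apply: cvg_at_left_filter; exact: continuous_prim.
- by move=> s _; rewrite derive1E; have ? := is_derive_prim s cf; rewrite derive_val.
Qed.

End Primitive.

Section MatrixCurves.
Context {R : realType}.

Lemma is_derive_mxP m k (x : R -> 'M[R]_(m, k)) (s : R) (v : 'M[R]_(m, k)) :
  is_derive s 1 x v <->
  forall i j, is_derive s 1 (fun u => x u i j) (v i j).
Proof.
split=> [dx i j|dx].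
  have dxs : derivable x s 1 by [].
  have /derivable_mxP/(_ i j) di := dxs.
  by split => //; rewrite -(@derive_val _ _ _ s 1 x v) derive_mx // mxE.
have dxs : derivable x s 1.
  by apply/derivable_mxP => i j; have [] := dx i j.
by split => //; rewrite derive_mx //; apply/matrixP => i j; rewrite mxE derive_val.
Qed.

Lemma is_derive_mulmx m k l (A : R -> 'M[R]_(m, k)) (B : R -> 'M[R]_(k, l))
    (s : R) A' B' : is_derive s 1 A A' -> is_derive s 1 B B' ->
  is_derive s 1 (fun u => A u *m B u) (A' *m B s + A s *m B').
Proof.
move=> /is_derive_mxP dA /is_derive_mxP dB; apply/is_derive_mxP => i j.
have -> : (fun u => (A u *m B u) i j) =
    \sum_h ((fun u => A u i h) * (fun u => B u h j)).
  by apply/funext => u; rewrite mxE fct_sumE.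
have -> : (A' *m B s + A s *m B') i j =
    \sum_h (A s i h *: B' h j + B s h j *: A' i h).
  rewrite !mxE -big_split; apply: eq_bigr => h _ /=.
  by rewrite addrC; congr (_ + _); exact: mulrC.
by apply: is_derive_sum => h; apply: is_deriveM.
Qed.

Lemma is_derive_trmx m k (A : R -> 'M[R]_(m, k)) (s : R) A' :
  is_derive s 1 A A' -> is_derive s 1 (fun u => (A u)^T) A'^T.
Proof.
move=> /is_derive_mxP dA; apply/is_derive_mxP => i j; rewrite mxE.
by have -> : (fun u => (A u)^T i j) = (fun u => A u j i)
  by apply/funext => u; rewrite mxE.
Qed.

Lemma is_derive_mx_comp m k (A : R -> 'M[R]_(m, k)) (f : R -> R) (s f' : R) A' :
  is_derive (f s) 1 A A' -> is_derive s 1 f f' ->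
  is_derive s 1 (A \o f) (f' *: A').
Proof.
move=> /is_derive_mxP dA df; apply/is_derive_mxP => i j; rewrite mxE mulrC.
exact: (is_derive1_comp (f := fun u => A u i j) (dA i j) df).
Qed.

End MatrixCurves.

Section RowVectorCurves.
Context {R : realType} {n : nat}.
Implicit Types (x : R -> 'rV[R]_n) (v : 'rV[R]_n) (s a b : R).

Lemma norm_rV_le v (e : R) : 0 <= e -> (forall i, `|v 0 i| <= e) -> `|v| <= e.
Proof.
move=> e0 ve; rewrite [`|v|]/Num.Def.normr /= mx_normrE bigmax_le // => -[i j] _ /=.
by rewrite ord1.
Qed.

Lemma coord_norm_le v i : `|v 0 i| <= `|v|.
Proof.
rewrite [leRHS]/Num.Def.normr /= mx_normrE.
exact: (le_bigmax _ (fun ij : 'I_1 * 'I_n => `|v ij.1 ij.2|) (0, i)).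
Qed.

Lemma is_derive_rVP x s v :
  is_derive s 1 x v <-> forall i, is_derive s 1 (fun u => x u 0 i) (v 0 i).
Proof.
by rewrite is_derive_mxP; split=> [dx i|dx i j]; [exact: dx | rewrite ord1].
Qed.

Lemma rV_increment_le x (x' : R -> 'rV[R]_n) (G g : R -> R) a b : a <= b ->
  (forall s, s \in `[a, b] -> is_derive s 1 x (x' s)) ->
  (forall s, s \in `[a, b] -> is_derive s 1 G (g s)) ->
  (forall s, s \in `[a, b] -> `|x' s| <= g s) ->
  `|x b - x a| <= G b - G a.
Proof.
move=> ab dx dG xg.
have xgi s i : s \in `[a, b] -> `|x' s 0 i| <= g s.
  by move=> sab; apply: le_trans (coord_norm_le _ _) (xg s sab).
have dxi i s : s \in `[a, b] -> is_derive s 1 (fun u => x u 0 i) (x' s 0 i).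
  by move=> sab; have /is_derive_rVP := dx s sab.
apply: norm_rV_le => [|i].
  rewrite -[0](subrr ((cst 0 : R -> R) a)).
  apply: (@increment_le R (cst 0) G (cst 0) g a b) => // s sab.
  exact: le_trans (xg s sab).
rewrite !mxE.
apply: (@norm_increment_le R (fun u => x u 0 i) G (fun u => x' u 0 i) g a b) => //.
by move=> s sab; exact: xgi.
Qed.

End RowVectorCurves.

(** * Strict derivatives *)

Section StrictDerivative.
Context {R : realType}.

Lemma line_derive (V W : normedModType R) (F : V -> W) (v w : V) (u : R) :
  derivable F (u *: v + w) v ->
  is_derive u 1 (fun h => F (h *: v + w)) ('D_v F (u *: v + w)).
Proof.
pose g (h : R) := h^-1 *: (F (h *: v + (u *: v + w)) - F (u *: v + w)).
have gE : (fun h : R => h^-1 *: (((fun k => F (k *: v + w)) \o shift u) (h *: 1) -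
    F (u *: v + w))) = g.
  by apply/funext => h; rewrite /g /= [h *: 1]mulr1 scalerDl addrA.
by move=> dF; apply: DeriveDef; rewrite /derivable /derive gE.
Qed.

(** Moving from z to y one coordinate at a time keeps every intermediate point
    in the sup-norm ball, so that one-variable estimates suffice. *)
Lemma partial_increment n (F : 'rV[R]_n -> R) (x y z : 'rV[R]_n) (r e : R)
    (a : 'I_n -> R) :
  `|y - x| <= r -> `|z - x| <= r ->
  (forall w i, `|w - x| <= r -> derivable F w (delta_mx 0 i) /\
     `|'D_(delta_mx 0 i) F w - a i| <= e) ->
  `|F y - F z - \sum_i (y - z) 0 i * a i| <= n%:R * e * `|y - z|.
Proof.
move=> yx zx dF.
pose walk k : 'rV[R]_n := \row_i (if (i < k)%N then y 0 i else z 0 i).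
have walkn : walk n = y by apply/rowP => i; rewrite mxE ltn_ord.
have walk0 : walk 0%N = z by apply/rowP => i; rewrite mxE.
have -> : F y - F z = \sum_(i < n) (F (walk i.+1) - F (walk i)).
  rewrite -walkn -walk0 -(telescope_sumr (F \o walk)) //.
  by rewrite big_mkord.
rewrite -sumrB; apply: le_trans (ler_norm_sum _ _ _) _.
apply: (@le_trans _ _ (\sum_(i < n) e * `|y - z|)); last first.
  by rewrite sumr_const card_ord -mulrA mulr_natl.
apply: ler_sum => i _; set d := (y - z) 0 i.
pose e_i : 'rV[R]_n := delta_mx 0 i.
have wE (t : R) : t *: (d *: e_i) + walk i = \row_j
    (if (j < i)%N then y 0 j else if j == i then z 0 j + t * (y 0 j - z 0 j)
     else z 0 j).
  apply/rowP => j; rewrite !mxE eqxx /=; have [->|ji] := eqVneq j i.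
    by rewrite ltnn mulr1 /d !mxE addrC.
  by rewrite mulr0 mulr0 add0r.
have wx t : t \in `[(0 : R), 1] -> `|t *: (d *: e_i) + walk i - x| <= r.
  rewrite in_itv /= => /andP[t0 t1].
  apply: norm_rV_le => [|j]; first exact: le_trans yx.
  have := le_trans (coord_norm_le _ j) yx; have := le_trans (coord_norm_le _ j) zx.
  rewrite wE !mxE; case: ifP => // _; case: eqVneq => // _.
  rewrite !ler_norml => /andP[z1 z2] /andP[y1 y2]; apply/andP; split; nra.
pose G t := F (t *: (d *: e_i) + walk i).
have dG t : t \in `[(0 : R), 1] -> is_derive t 1 (fun t => G t - t * (d * a i))
    (d * ('D_e_i F (t *: (d *: e_i) + walk i) - a i)).
  move=> t01; have [dt _] := dF _ i (wx t t01).
  have h1 : is_derive t 1 (fun t => F (t *: (d *: e_i) + walk i))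
      (d * 'D_e_i F (t *: (d *: e_i) + walk i)).
    have -> : (fun t => F (t *: (d *: e_i) + walk i)) =
        (fun h => F (h *: e_i + walk i)) \o (fun t => t * d).
      by apply/funext => s; rewrite /= scalerA.
    rewrite mulrC; apply: is_derive1_comp.
      by rewrite scalerA; apply: line_derive; rewrite -scalerA.
    exact: is_derive_mulr.
  by rewrite mulrBr; apply: is_deriveB; exact: is_derive_mulr.
have := @norm_increment_le R (fun t => G t - t * (d * a i))
  (fun t => t * (e * `|y - z|)) _ (cst (e * `|y - z|)) 0 1 ler01 dG.
rewrite !mul1r !mul0r !subr0.
have -> : G 1 = F (walk i.+1).
  congr F; rewrite wE; apply/rowP => j; rewrite !mxE mul1r ltnS.
  by rewrite [(j <= i)%N]leq_eqVlt val_eqE; case: eqVneq => [->|]; rewrite ?ltnn ?subrKC.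
have -> : G 0 = F (walk i) by rewrite /G scale0r add0r.
rewrite addrAC; apply; first by move=> s _; exact: is_derive_mulr.
move=> s s01; rewrite normrM mulrC; have [_ le_e] := dF _ i (wx s s01).
by apply: ler_pM => //; exact: coord_norm_le.
Qed.

Definition opnorm m n (J : 'M[R]_(m, n)) : R := m%:R * `|J|.

Lemma opnorm_ge0 m n (J : 'M[R]_(m, n)) : 0 <= opnorm J.
Proof. by rewrite mulr_ge0. Qed.

Lemma entry_norm_le m n (J : 'M[R]_(m, n)) i j : `|J i j| <= `|J|.
Proof.
rewrite [leRHS]/Num.Def.normr /= mx_normrE.
exact: (le_bigmax _ (fun ij : 'I_m * 'I_n => `|J ij.1 ij.2|) (i, j)).
Qed.

Lemma mulmx_norm_le m n (v : 'rV[R]_m) (J : 'M[R]_(m, n)) :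
  `|v *m J| <= opnorm J * `|v|.
Proof.
apply: norm_rV_le => [|j]; first by rewrite mulr_ge0 // opnorm_ge0.
rewrite mxE; apply: le_trans (ler_norm_sum _ _ _) _.
apply: (@le_trans _ _ (\sum_(i < m) `|J| * `|v|)).
  apply: ler_sum => i _; rewrite normrM mulrC.
  by apply: ler_pM => //; [exact: entry_norm_le | exact: coord_norm_le].
by rewrite sumr_const card_ord /opnorm -mulrA mulr_natl.
Qed.

(** Strict derivatives compose and invert by plain estimates, and a map is of
    class C^1 on an open set exactly when it has them there. *)
Definition strict_diff (V W : normedModType R) (F : V -> W) (x : V)
    (L : V -> W) :=
  forall e : R, 0 < e -> exists2 d : R, 0 < d & forall y z : V,
    `|y - x| < d -> `|z - x| < d -> `|F y - F z - L (y - z)| <= e * `|y - z|.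

Definition sdiff m n (F : 'rV[R]_m -> 'rV[R]_n) x (J : 'M[R]_(m, n)) :=
  strict_diff F x (fun v => v *m J).

Definition sder (W : normedModType R) (c : R -> W) (s : R) (w : W) :=
  strict_diff c s (fun h => h *: w).

Lemma strict_diff_lip (V W : normedModType R) (F : V -> W) x L (a : R) :
  strict_diff F x L -> (forall v, `|L v| <= a * `|v|) ->
  exists2 d : R, 0 < d & forall y z, `|y - x| < d -> `|z - x| < d ->
    `|F y - F z| <= (1 + a) * `|y - z|.
Proof.
move=> /(_ 1 ltr01)[d d0 H] La; exists d => // y z yx zx.
rewrite mulrDl -{1}(subrK (L (y - z)) (F y - F z)).
by apply: le_trans (ler_normD _ _) _; apply: lerD; [exact: H | exact: La].
Qed.

Lemma strict_diff_near (V W : normedModType R) (F G : V -> W) x L :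
  (\forall y \near x, F y = G y) -> strict_diff F x L -> strict_diff G x L.
Proof.
move=> /nbhs_ballP[d1 /= d10 H1] dF e e0; have [d d0 H] := dF e e0.
exists (Num.min d d1); first by rewrite lt_min d0.
have FG y : `|y - x| < d1 -> F y = G y.
  by move=> yx; apply: H1; rewrite -ball_normE /= distrC.
move=> y z; rewrite !lt_min => /andP[y1 y2] /andP[z1 z2].
by rewrite -!FG //; exact: H.
Qed.

Lemma strict_diff_ext (V W : normedModType R) (F : V -> W) x (L L' : V -> W) :
  L =1 L' -> strict_diff F x L -> strict_diff F x L'.
Proof. by move=> /funext ->. Qed.

Lemma strict_diff_comp (U V W : normedModType R) (F : V -> W) (c : U -> V) s
    (K : U -> V) (L : V -> W) (a b : R) : 0 <= a -> 0 <= b ->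
  (forall v, `|K v| <= a * `|v|) -> (forall v, `|L v| <= b * `|v|) ->
  (forall v w, L (v - w) = L v - L w) ->
  strict_diff F (c s) L -> strict_diff c s K ->
  strict_diff (F \o c) s (L \o K).
Proof.
move=> a0 b0 Ka Lb LB dF dc e e0.
have a1 : 0 < 1 + a by lra.
have b1 : 0 < 1 + b by lra.
have e2 : 0 < e / 2 by rewrite divr_gt0.
have [d d0 {}dF] := dF (e / 2 / (1 + a)) (divr_gt0 e2 a1).
have [d1 d10 H1] := dc (e / 2 / (1 + b)) (divr_gt0 e2 b1).
have [d2 d20 H2] := strict_diff_lip dc Ka.
exists (Num.min (Num.min d1 d2) (d / (1 + a))).
  by rewrite !lt_min d10 d20 divr_gt0.
move=> u v; rewrite !lt_min => /andP[/andP[u1 u2] u3] /andP[/andP[v1 v2] v3].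
have cl t : `|t - s| < d2 -> `|t - s| < d / (1 + a) -> `|c t - c s| < d.
  move=> t2 t3; apply: le_lt_trans (H2 t s t2 _) _; first by rewrite subrr normr0.
  by rewrite mulrC -ltr_pdivlMr.
have K1 := dF _ _ (cl u u2 u3) (cl v v2 v3).
have K2 := H1 u v u1 v1; have K3 := H2 u v u2 v2.
have -> : (F \o c) u - (F \o c) v - (L \o K) (u - v) =
    (F (c u) - F (c v) - L (c u - c v)) + L (c u - c v - K (u - v)).
  by rewrite /= [L (_ - K _)]LB addrA subrK.
apply: le_trans (ler_normD _ _) _; rewrite [e]splitr mulrDl; apply: lerD.
  apply: le_trans K1 _; rewrite -mulrA ler_pM2l ?divr_gt0 //.
  by rewrite ler_pdivrMl.
apply: le_trans (Lb _) _.
apply: (@le_trans _ _ ((1 + b) * `|c u - c v - K (u - v)|)).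
  by apply: ler_wpM2r => //; rewrite lerDr.
by rewrite -ler_pdivlMl // [(1 + b)^-1 * _]mulrA [(1 + b)^-1 * _]mulrC.
Qed.

Lemma sder_derive (W : normedModType R) (c : R -> W) s w : sder c s w -> is_derive s 1 c w.
Proof.
move=> H.
have lim : h^-1 *: ((c \o shift s) (h *: (1 : R)) - c s) @[h --> 0^'] --> w.
  apply/cvgrPdist_le => e e0; have [d d0 {}H] := H e e0.
  near=> h.
  have h0 : h != 0 by near: h; exact: nbhs_dnbhs_neq.
  have hd : `|h| < d by near: h; exact: dnbhs0_lt.
  have := H (h + s) s; rewrite addrK subrr normr0 => /(_ hd d0) {}H.
  rewrite /= [h *: 1]mulr1 -normrN opprB.
  have -> : h^-1 *: (c (h + s) - c s) - w = h^-1 *: (c (h + s) - c s - h *: w).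
    by rewrite [in RHS]scalerBr scalerA mulVf // scale1r.
  by rewrite normrZ normfV ler_pdivrMl ?normr_gt0 // mulrC.
by apply: DeriveDef; [apply/cvg_ex; exists w | exact: cvg_lim].
Unshelve. all: by end_near. Qed.

Lemma sder_continuous (W : normedModType R) (c : R -> W) s w : sder c s w ->
  {for s, continuous c}.
Proof. by move=> /sder_derive; exact: is_derive_continuous. Qed.

Lemma sder_chain m n (F : 'rV[R]_m -> 'rV[R]_n) (c : R -> 'rV[R]_m) s w J :
  sdiff F (c s) J -> sder c s w -> sder (F \o c) s (w *m J).
Proof.
move=> dF dc.
apply: (@strict_diff_ext _ _ _ _ ((fun v => v *m J) \o (fun h : R => h *: w))).
  by move=> h; rewrite /= -scalemxAl.
apply: (@strict_diff_comp _ _ _ F c s _ _ `|w| (opnorm J)) dF dc => //.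
- exact: opnorm_ge0.
- by move=> h; rewrite normrZ mulrC.
- by move=> v; exact: mulmx_norm_le.
- by move=> v v'; rewrite mulmxBl.
Qed.

Lemma sder_reparam (W : normedModType R) (c : R -> W) (a : R -> R) s w b :
  sder c (a s) w -> sder a s b -> sder (c \o a) s (b *: w).
Proof.
move=> dc da.
apply: (@strict_diff_ext _ _ _ _ ((fun h : R => h *: w) \o (fun h : R => h *: b))).
  by move=> h; rewrite /= scalerA.
apply: (@strict_diff_comp _ _ _ c a s _ _ `|b| `|w|) dc da => //.
- by move=> h; rewrite normrZ mulrC.
- by move=> h; rewrite normrZ mulrC.
- by move=> h h'; rewrite scalerBl.
Qed.

Lemma sder_primitive (F f : R -> R) (s : R) :
  (forall t : R, is_derive t 1 F (f t)) -> {for s, continuous f} -> sder F s (f s).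
Proof.
move=> dF cf e e0; move/cvgrPdist_le/(_ e e0)/nbhs_ballP : cf => [d /= d0 H].
have sE (a b : R) : a *: b = a * b by [].
exists d => // u v us vs.
wlog vu : u v us vs / v <= u.
  move=> K; have [vu|uv] := leP v u; first exact: K.
  have := K v u vs us (ltW uv); rewrite [`|v - u|]distrC.
  have -> : F v - F u - (v - u) *: f s = - (F u - F v - (u - v) *: f s).
    by rewrite !sE; ring.
  by rewrite normrN.
have := @norm_increment_le R (fun t => F t - t * f s) (fun t => t * e)
  (fun t => f t - f s) (cst e) v u vu.
rewrite -mulrBl [_ * e]mulrC [`|u - v|]ger0_norm ?subr_ge0 //.
have -> : F u - u * f s - (F v - v * f s) = F u - F v - (u - v) *: f s.
  by rewrite !sE; ring.
apply.
- by move=> t _; apply: is_deriveB; exact: is_derive_mulr.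
- by move=> t _; exact: is_derive_mulr.
- move=> t; rewrite in_itv /= => /andP[vt tu]; rewrite distrC; apply: H.
  rewrite -ball_normE /= distrC; move: us vs; rewrite !ltr_norml.
  by move=> /andP[u1 u2] /andP[v1 v2]; apply/andP; split; lra.
Qed.

(** The strict estimate for F between h z and h w is an estimate for h with error
    proportional to h z - h w; used first with the error 1/2 it shows that h is
    Lipschitz, which turns it into the strict estimate for h. *)
Lemma sdiff_inverse n (F h : 'rV[R]_n -> 'rV[R]_n) y J :
  sdiff F (h y) J -> J \in unitmx -> {for y, continuous h} ->
  (\forall z \near y, F (h z) = z) -> sdiff h y (invmx J).
Proof.
move=> dF Ju ch Fh.
pose b := 1 + opnorm (invmx J); have b0 : 0 < b by rewrite ltr_pwDl ?opnorm_ge0.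
have Jb (v : 'rV[R]_n) : `|v *m invmx J| <= b * `|v|.
  by apply: le_trans (mulmx_norm_le _ _) _; apply: ler_wpM2r => //; rewrite /b lerDr.
suff K e : 0 < e -> e <= 2^-1 -> exists2 d : R, 0 < d & forall z w,
    `|z - y| < d -> `|w - y| < d ->
    `|h z - h w - (z - w) *m invmx J| <= e * `|h z - h w|.
  move=> e e0; have [d2 d20 H2] := K 2^-1 ltac:(by rewrite invr_gt0) (lexx _).
  have [|d d0 H] := K (Num.min 2^-1 (e / 2 / b)) _ ltac:(by rewrite ge_min lexx).
    by rewrite lt_min invr_gt0 ltr0Sn !divr_gt0.
  exists (Num.min d d2); first by rewrite lt_min d0.
  move=> z w; rewrite !lt_min => /andP[z1 z2] /andP[w1 w2].
  have hb : `|h z - h w| <= 2 * b * `|z - w|.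
    have := H2 z w z2 w2; have := Jb (z - w).
    have := ler_normD (h z - h w - (z - w) *m invmx J) ((z - w) *m invmx J).
    by rewrite subrK; lra.
  apply: le_trans (H z w z1 w1) _.
  apply: (@le_trans _ _ (e / 2 / b * `|h z - h w|)).
    by apply: ler_wpM2r => //; rewrite ge_min lexx orbT.
  apply: (@le_trans _ _ (e / 2 / b * (2 * b * `|z - w|))).
    by apply: ler_wpM2l => //; rewrite !divr_ge0 // ltW.
  by rewrite le_eqVlt; apply/orP; left; apply/eqP; field; rewrite gt_eqF.
move=> e0 _; have [d d0 {}dF] := dF (e / b) (divr_gt0 e0 b0).
have /nbhs_ballP[d1 /= d10 Hd1] : nbhs y (fun z => `|h z - h y| < d /\ F (h z) = z).
  apply: filterI => //; move/cvgrPdist_lt/(_ d d0) : ch.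
  by apply: filterS => z; rewrite distrC.
exists d1 => // z w zy wy.
have [hz Fz] : `|h z - h y| < d /\ F (h z) = z.
  by apply: Hd1; rewrite -ball_normE /= distrC.
have [hw Fw] : `|h w - h y| < d /\ F (h w) = w.
  by apply: Hd1; rewrite -ball_normE /= distrC.
have := dF _ _ hz hw; rewrite Fz Fw => {}dF.
have -> : h z - h w - (z - w) *m invmx J =
    - ((z - w - (h z - h w) *m J) *m invmx J).
  by rewrite [(z - w - _) *m _]mulmxBl -mulmxA mulmxV // mulmx1 opprB.
rewrite normrN; apply: le_trans (Jb _) _.
by rewrite -ler_pdivlMl // mulrA [b^-1 * e]mulrC.
Qed.

Lemma diff_of_estimate (V W : normedModType R) (f : V -> W)
    (df : {linear V -> W}) x : continuous df ->
  (forall e : R, 0 < e -> \forall h \near (0 : V),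
    `|f (h + x) - f x - df h| <= e * `|h|) ->
  differentiable f x /\ 'd f x = df :> (V -> W).
Proof.
move=> cdf H.
have dE : f \o shift x = cst (f x) + df +o_ 0 id.
  apply/eqaddoP => e e0; apply: filterS (H e e0) => h.
  by rewrite !fctE /= opprD addrA.
have dU := diff_unique cdf dE.
by split => //; apply/diff_locallyP; rewrite dU.
Qed.

Lemma sdiff_jacobian m n (F : 'rV[R]_m -> 'rV[R]_n) x J : sdiff F x J ->
  differentiable F x /\ 'J F x = J.
Proof.
move=> dF.
have cont : continuous (mulmxr J : 'rV[R]_m -> 'rV[R]_n).
  move=> v; apply/(@cvgrPdist_lt _ _ _ (nbhs v)) => e e0; near=> w.
  rewrite -linearB /=; apply: le_lt_trans (mulmx_norm_le _ _) _.
  apply: (@le_lt_trans _ _ ((1 + opnorm J) * `|v - w|)).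
    by apply: ler_wpM2r => //; rewrite lerDr.
  rewrite -ltr_pdivlMl ?ltr_pwDl ?opnorm_ge0 //; near: w.
  apply: cvgr_dist_lt; first exact: cvg_id.
  by rewrite mulr_gt0 // invr_gt0 ltr_pwDl ?opnorm_ge0.
have [|dif dU] := @diff_of_estimate _ _ F (mulmxr J) x cont.
  move=> e e0; have [d d0 {}dF] := dF e e0.
  near=> h.
  have hd : `|h + x - x| < d.
    by rewrite addrK; near: h; apply: (@cvgr_norm_lt _ _ _ _ _ id 0) => //;
      rewrite ?normr0 //; exact: cvg_id.
  by have := dF (h + x) x hd; rewrite subrr normr0 addrK => /(_ d0).
split => //; rewrite /jacobian dU; apply/row_matrixP => i.
by rewrite rowE mul_rV_lin1 /= -rowE.
Unshelve. all: by end_near. Qed.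

Section SmoothOn.
Context {n : nat} {W : normedModType R} {U : set 'rV[R]_n} {f : 'rV[R]_n -> W}.
Hypothesis fU : smooth_on U f.

Lemma smooth_on_derivable x v : U x -> derivable f x v.
Proof. by move=> Ux; have [_ /(_ v)[+ _]] := fU 1%N; apply; rewrite inE. Qed.

Lemma smooth_on_continuous x : U x -> {for x, continuous f}.
Proof. by move=> Ux; have [+ _] := fU 0%N; apply; rewrite inE. Qed.

Lemma smooth_on_derive v : smooth_on U ('D_v f).
Proof. by move=> k; have [_ /(_ v)[]] := fU k.+1. Qed.

End SmoothOn.

Lemma derive_coord n m k (f : 'rV[R]_n -> 'M[R]_(m, k)) x v i j :
  derivable f x v -> 'D_v (fun y => f y i j) x = 'D_v f x i j.
Proof. by move=> df; rewrite [in RHS]derive_mx // mxE. Qed.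

Lemma norm_mx_le m k (A : 'M[R]_(m, k)) (e : R) : 0 <= e ->
  (forall i j, `|A i j| <= e) -> `|A| <= e.
Proof.
move=> e0 Ae; rewrite [`|A|]/Num.Def.normr /= mx_normrE bigmax_le // => -[i j] _ /=.
Qed.

(** Continuity of the partial derivatives makes the error of partial_increment
    small near x, entry by entry. *)
Lemma smooth_on_strict_diff n m k (U : set 'rV[R]_n) (f : 'rV[R]_n -> 'M[R]_(m, k)) x :
  open U -> U x -> smooth_on U f ->
  strict_diff f x (fun h => \sum_i h 0 i *: 'D_(delta_mx 0 i) f x).
Proof.
move=> oU Ux fU e e0; pose e' := e / (1 + n%:R).
have n0 : 0 < 1 + n%:R :> R by rewrite ltr_pwDl.
have e'0 : 0 < e' by rewrite divr_gt0.
have H : \forall w \near x, U w /\ forall i j l,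
    `|'D_(delta_mx 0 i) f w j l - 'D_(delta_mx 0 i) f x j l| <= e'.
  near=> w; split; first by near: w; exact: open_nbhs_nbhs.
  move=> i j l.
  have := entry_norm_le ('D_(delta_mx 0 i) f w - 'D_(delta_mx 0 i) f x) j l.
  rewrite !mxE => /le_trans; apply; rewrite distrC.
  move: i {j l}; near: w; apply: filter_forall => i.
  have /cvgrPdist_le := smooth_on_continuous (smooth_on_derive fU (delta_mx 0 i)) Ux.
  exact.
have /nbhs_ballP[d /= d0 Hd] := H.
exists (d / 2); first by rewrite divr_gt0.
move=> y z yx zx; apply: norm_mx_le => [|j l]; first by rewrite mulr_ge0 // ltW.
have := @partial_increment n (fun w => f w j l) x y z (d / 2) e'
  (fun i => 'D_(delta_mx 0 i) f x j l) (ltW yx) (ltW zx).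
have -> : \sum_i (y - z) 0 i * 'D_(delta_mx 0 i) f x j l =
    (\sum_i (y - z) 0 i *: 'D_(delta_mx 0 i) f x) j l.
  by rewrite summxE; apply: eq_bigr => i _; rewrite [in RHS]mxE.
set S := \sum_(i < n) _.
have -> : (f y - f z - S) j l = f y j l - f z j l - S j l.
  by rewrite mxE [(f y - f z) j l]mxE [(- f z) j l]mxE [(- S) j l]mxE.
move=> /(_ _)/le_trans; apply.
  move=> w i wx; have [|Uw fw] := Hd w.
    rewrite -ball_normE /= distrC; apply: le_lt_trans wx _.
    by rewrite ltr_pdivrMr // ltr_pMr // ltr1n.
  have dfw : derivable f w (delta_mx 0 i) := smooth_on_derivable fU Uw.
  split; first by have /derivable_mxP := dfw.
  by rewrite derive_coord.
apply: ler_wpM2r => //; rewrite /e' mulrCA ler_piMr ?(ltW e0) //.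
by rewrite ler_pdivrMr // mul1r lerDr.
Unshelve. all: by end_near. Qed.

Lemma smooth_on_sdiff n m (U : set 'rV[R]_n) (f : 'rV[R]_n -> 'rV[R]_m) x :
  open U -> U x -> smooth_on U f -> differentiable f x /\ sdiff f x ('J f x).
Proof.
move=> oU Ux fU.
pose J : 'M[R]_(n, m) := \matrix_(i, j) 'D_(delta_mx 0 i) f x 0 j.
suff sJ : sdiff f x J by have [df JE] := sdiff_jacobian sJ; rewrite JE.
apply: strict_diff_ext (smooth_on_strict_diff oU Ux fU) => h.
apply/rowP => j; rewrite summxE mxE; apply: eq_bigr => i _.
by rewrite !mxE.
Qed.

(** Only the continuity at s of the derivative enters: the mean value estimate
    is applied to c(u) - u c'(s). *)
Lemma derivable_sder n (c : R -> 'rV[R]_n) s :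
  (\forall u \near s, derivable c u 1) -> {for s, continuous (derive1 c)} ->
  sder c s (derive1 c s).
Proof.
move=> dc cc e e0; set w := derive1 c s.
have H : \forall u \near s, derivable c u 1 /\ `|derive1 c u - w| <= e.
  apply: filterI; first exact: dc.
  move/cvgrPdist_le/(_ e e0) : cc.
  by apply: filterS => u cu; rewrite distrC; exact: cu.
have /nbhs_ballP[d /= d0 Hd] := H.
exists d => // u v us vs.
wlog vu : u v us vs / v <= u.
  move=> K; have [vu|uv] := leP v u; first exact: K.
  have := K v u vs us (ltW uv); rewrite [`|v - u|]distrC.
  have -> : c v - c u - (v - u) *: w = - (c u - c v - (u - v) *: w).
    by rewrite opprB -(opprB (c u)) -(opprB u v) scaleNr opprK addrC.
  by rewrite normrN.
have inb t : t \in `[v, u] -> derivable c t 1 /\ `|derive1 c t - w| <= e.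
  rewrite in_itv /= => /andP[vt tu]; apply: Hd; rewrite -ball_normE /=.
  move: us vs; rewrite !ltr_norml => /andP[u1 u2] /andP[v1 v2].
  by apply/andP; split; lra.
have dl (t : R) : is_derive t 1 (fun t : R => t *: w) w.
  apply/is_derive_rVP => i.
  have -> : (fun u : R => (u *: w) 0 i) = (fun u => u * w 0 i).
    by apply/funext => a; rewrite mxE.
  exact: is_derive_mulr.
have := @rV_increment_le R n (fun t => c t - t *: w) (fun t => derive1 c t - w)
  (fun t => t * e) (cst e) v u vu.
rewrite -mulrBl [_ * e]mulrC ger0_norm ?subr_ge0 //.
have -> : c u - u *: w - (c v - v *: w) = c u - c v - (u - v) *: w.
  by apply/rowP => i; rewrite !mxE; ring.
apply.
- move=> t tuv; have [dct _] := inb t tuv.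
  by apply: is_deriveB; rewrite derive1E; apply: DeriveDef.
- by move=> t _; exact: is_derive_mulr.
- by move=> t tuv; have [] := inb t tuv.
Qed.

(** The strict estimate at s compares difference quotients of c taken at any two
    nearby points, hence also derivatives at nearby points, with the one at s. *)
Lemma sder_near_C1 (W : normedModType R) (c : R -> W) s :
  (\forall u \near s, exists w, sder c u w) ->
  (\forall u \near s, derivable c u 1) /\ {for s, continuous (derive1 c)}.
Proof.
move=> H; split; first by apply: filterS H => u [w /sder_derive].
have [w dcs] := nbhs_singleton H.
have dE u v : sder c u v -> derive1 c u = v.
  by move=> /sder_derive duv; rewrite derive1E derive_val.
suff : derive1 c @ s --> w by rewrite -(dE _ _ dcs).
apply/cvgrPdist_le => e e0.
have [d d0 Hd] := dcs (e / 2) ltac:(by rewrite divr_gt0).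
have : nbhs s (ball s d) by exact: nbhsx_ballx.
apply: filterS2 H => u [v dcu] us; rewrite (dE _ _ dcu).
have [d1 d10 Hd1] := dcu (e / 2) ltac:(by rewrite divr_gt0).
have uds : `|u - s| < d by move: us; rewrite -ball_normE /= distrC.
pose h := Num.min (d - `|u - s|) d1 / 2.
have h0 : 0 < h by rewrite divr_gt0 // lt_min d10 subr_gt0 uds.
have hm : h < Num.min (d - `|u - s|) d1.
  by rewrite /h ltr_pdivrMr // ltr_pMr ?ltr1n // lt_min d10 subr_gt0 uds.
have [hd hd1] : h < d - `|u - s| /\ h < d1 by apply/andP; rewrite -lt_min.
have uhs : `|u + h - s| < d.
  by rewrite addrAC; apply: le_lt_trans (ler_normD _ _) _; rewrite (gtr0_norm h0); lra.
have := Hd (u + h) u uhs uds; have := Hd1 (u + h) u.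
rewrite [u + h - u]addrAC subrr add0r normr0 (gtr0_norm h0) => /(_ hd1 d10) A B.
have E : h *: (w - v) =
    (c (u + h) - c u - h *: v) - (c (u + h) - c u - h *: w).
  by rewrite scalerBr opprB [RHS]addrC addrA subrK.
have : `|h *: (w - v)| <= h * e.
  rewrite E; apply: le_trans (ler_normB _ _) _; lra.
by rewrite normrZ (gtr0_norm h0) ler_pM2l.
Qed.

End StrictDerivative.

(** * Curves on a Riemannian manifold *)

Section Inner.
Context {R : realType} {n : nat}.
Implicit Types (G : 'M[R]_n) (u v : 'rV[R]_n).

Lemma innerE G u v : inner G u v = \sum_i \sum_j u 0 j * G j i * v 0 i.
Proof.
rewrite /inner mxE; apply: eq_bigr => i _.
by rewrite !mxE mulr_suml; apply: eq_bigr => j _.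
Qed.

Lemma inner_congr (J G : 'M[R]_n) v :
  inner (J *m G *m J^T) v v = inner G (v *m J) (v *m J).
Proof. by rewrite /inner trmx_mul !mulmxA. Qed.

Lemma innerZ G (a : R) v : inner G (a *: v) (a *: v) = a ^+ 2 * inner G v v.
Proof.
by rewrite /inner linearZ /= -scalemxAr -!scalemxAl !mxE mulrA expr2.
Qed.

Lemma innerDl G u v w : inner G (u + v) w = inner G u w + inner G v w.
Proof. by rewrite /inner !mulmxDl mxE. Qed.

Lemma innerDr G u v w : inner G u (v + w) = inner G u v + inner G u w.
Proof. by rewrite /inner linearD /= mulmxDr mxE. Qed.

Lemma inner_mxD G H u v : inner (G + H) u v = inner G u v + inner H u v.
Proof. by rewrite /inner mulmxDr mulmxDl mxE. Qed.

Lemma innerC G u v : G^T = G -> inner G u v = inner G v u.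
Proof.
move=> GT; transitivity ((u *m G *m v^T)^T 0 0); first by rewrite mxE.
by rewrite !trmx_mul trmxK GT mulmxA.
Qed.

Lemma inner_norm_le G u v : `|inner G u v| <= n%:R ^+ 2 * `|G| * `|u| * `|v|.
Proof.
rewrite innerE; apply: le_trans (ler_norm_sum _ _ _) _.
apply: (@le_trans _ _ (\sum_(i < n) n%:R * (`|G| * `|u| * `|v|))); last first.
  by rewrite sumr_const card_ord -[X in X <= _]mulr_natl expr2 !mulrA.
apply: ler_sum => i _; apply: le_trans (ler_norm_sum _ _ _) _.
apply: (@le_trans _ _ (\sum_(j < n) (`|G| * `|u| * `|v|))); last first.
  by rewrite sumr_const card_ord mulr_natl.
apply: ler_sum => j _; rewrite !normrM [_ * `|G j i|]mulrC.
apply: ler_pM; rewrite ?mulr_ge0 ?coord_norm_le //.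
by apply: ler_pM => //; [exact: entry_norm_le | exact: coord_norm_le].
Qed.

Lemma inner_cvg (T : Type) (F : set_system T) {FF : Filter F}
    (G : T -> 'M[R]_n) (u v : T -> 'rV[R]_n) (g : 'M[R]_n) (a b : 'rV[R]_n) :
  G @ F --> g -> u @ F --> a -> v @ F --> b ->
  inner (G t) (u t) (v t) @[t --> F] --> inner g a b.
Proof.
have coord m k (X : T -> 'M[R]_(m, k)) (x : 'M[R]_(m, k)) i j :
    X @ F --> x -> X t i j @[t --> F] --> x i j.
  move=> Xx.
  exact: (cvg_comp _ (fun M : 'M[R]_(m, k) => M i j) Xx (@coord_continuous _ _ _ i j x)).
move=> cG cu cv; rewrite innerE; under eq_cvg do rewrite innerE.
apply: cvg_big => [|i _]; first exact: add_continuous.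
apply: cvg_big => [|j _]; first exact: add_continuous.
by apply: cvgM; [apply: cvgM|]; exact: coord.
Qed.

End Inner.

Section Chart.
Context {R : realType} {n : nat} {T : topologicalType} (phi : @chart R n T).

Lemma chartK x : cdom phi x -> cinv phi (phi x) = x.
Proof. by move=> dx; rewrite (cmapK (c := phi)) // inE. Qed.

Lemma chart_near_range (O : set T) x : open O -> O x -> cdom phi x ->
  \forall y \near phi x, exists2 z, cdom phi z /\ O z & phi z = y.
Proof.
move=> oO Ox dx.
have rx : (phi @` cdom phi) (phi x) by exists x.
have oR : nbhs (phi x) (phi @` cdom phi).
  by apply: open_nbhs_nbhs; split => //; exact: crange_open.
have /= cx := @cinv_continuous _ _ _ phi (phi x) ltac:(by rewrite inE).
have : nbhs (cinv phi (phi x)) O.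
  by rewrite chartK //; exact: open_nbhs_nbhs.
move=> /cx; apply: filterS2 oR => y [z dz <-] /=; rewrite chartK // => Oz.
by exists z.
Qed.

Lemma chart_image_open (O : set T) : open O -> open (phi @` (cdom phi `&` O)).
Proof.
move=> oO; rewrite openE => _ [x [dx Ox] <-].
by apply: filterS (chart_near_range oO Ox dx) => y [z ? <-]; exists z.
Qed.

Lemma chart_continuous x : cdom phi x -> {for x, continuous phi}.
Proof. by move=> dx; apply: cmap_continuous; rewrite inE. Qed.

Lemma chart_near x : cdom phi x -> \forall y \near x, cdom phi y.
Proof. by move=> dx; apply: open_nbhs_nbhs; split => //; exact: cdom_open. Qed.

End Chart.

(** A map is infinitesimally isometric at a point when it has invertible
    strict derivatives there, in all charts of the two atlases, that pull back
    the metric; this covers changes of charts, Riemannian coverings and their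
    local sections at once. *)
Definition isometric_at {R : realType} {n : nat} {X Y : riemannianManifold R n}
    (F : X -> Y) (x : X) : Prop :=
  {for x, continuous F} /\
  forall (phi : @chart R n X) (psi : @chart R n Y), atlas phi -> atlas psi ->
    cdom phi x -> cdom psi (F x) ->
    exists J, sdiff (psi \o F \o cinv phi) (phi x) J /\
      metric phi (phi x) = J *m metric psi (psi (F x)) *m J^T.

Section Curves.
Context {R : realType} {n : nat} {X : riemannianManifold R n}.
Implicit Types (phi psi : @chart R n X) (c : R -> X) (s : R).

Lemma isometric_id (x : X) : isometric_at id x.
Proof.
split=> [|phi psi aphi apsi dphi dpsi]; first exact: cvg_id.
exists ('J (psi \o cinv phi) (phi x)); split; last exact: metric_change.
have oD : open (phi @` (cdom phi `&` cdom psi)).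
  by apply: chart_image_open; exact: cdom_open.
have Dx : (phi @` (cdom phi `&` cdom psi)) (phi x) by exists x.
by have [_] := smooth_on_sdiff oD Dx (atlas_smooth aphi apsi).
Qed.

Lemma metric_cvg phi x : atlas phi -> cdom phi x ->
  {for phi x, continuous (metric phi)}.
Proof. by move=> a d; apply: (smooth_on_continuous (metric_smooth a)); exists x. Qed.

(** Velocity in some, equivalently every, chart around the point. *)
Definition differentiable_curve c s : Prop :=
  {for s, continuous c} /\ forall phi, atlas phi -> cdom phi (c s) ->
    exists w, sder (phi \o c) s w.

Lemma curve_in_chart c s phi : {for s, continuous c} -> cdom phi (c s) ->
  \forall u \near s, cdom phi (c u).
Proof. by move=> cc dc; apply: cc; exact: chart_near. Qed.

End Curves.

Section PushCurves.
Context {R : realType} {n : nat} {X Y : riemannianManifold R n} (F : X -> Y).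
Implicit Types (c : R -> X) (s : R).

Lemma push_sder c s (phi : @chart R n X) (psi : @chart R n Y) w :
  atlas phi -> atlas psi -> cdom phi (c s) -> cdom psi (F (c s)) ->
  {for s, continuous c} -> isometric_at F (c s) -> sder (phi \o c) s w ->
  exists2 w', sder (psi \o (F \o c)) s w' &
    inner (metric phi (phi (c s))) w w = inner (metric psi (psi (F (c s)))) w' w'.
Proof.
move=> aphi apsi dphi dpsi cc [cF HF] dc.
have [J [dJ ->]] := HF phi psi aphi apsi dphi dpsi.
exists (w *m J); last exact: inner_congr.
apply: strict_diff_near (sder_chain (c := phi \o c) dJ dc).
by apply: filterS (curve_in_chart cc dphi) => u du; rewrite /= chartK.
Qed.

Lemma push_differentiable c s : isometric_at F (c s) ->
  differentiable_curve c s -> differentiable_curve (F \o c) s.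
Proof.
move=> iF [cc dc]; split.
  by apply: continuous_comp => //; case: iF.
move=> psi apsi dpsi; have [phi aphi dphi] := atlas_cover (c s).
have [w dw] := dc phi aphi dphi.
by have [w' dw' _] := push_sder aphi apsi dphi dpsi cc iF dw; exists w'.
Qed.

End PushCurves.

Section Speed.
Context {R : realType} {n : nat} {X : riemannianManifold R n}.
Implicit Types (phi psi : @chart R n X) (c : R -> X) (s : R).

Lemma differentiable_curve_chart c s phi w : {for s, continuous c} ->
  atlas phi -> cdom phi (c s) -> sder (phi \o c) s w -> differentiable_curve c s.
Proof.
move=> cc aphi dphi dw; split => // psi apsi dpsi.
have [w' dw' _] := push_sder (F := @id X) aphi apsi dphi dpsi cc
  (isometric_id _) dw.
by exists w'.
Qed.

(** Changes of charts are isometric for the coordinate metrics, so every chart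
    yields the same speed. *)
Lemma speedE c s phi w : {for s, continuous c} -> atlas phi ->
  cdom phi (c s) -> sder (phi \o c) s w ->
  speed c s = Num.sqrt (inner (metric phi (phi (c s))) w w).
Proof.
move=> cc aphi dphi dw; rewrite /speed; case: xgetP => [r _ [psi [apsi dpsi ->]]|].
  have [w' dw' ->] := push_sder (F := @id X) aphi apsi dphi dpsi cc
    (isometric_id _) dw.
  by rewrite derive1E; have ? := sder_derive dw'; rewrite derive_val.
move=> /(_ (Num.sqrt (inner (metric phi (phi (c s))) w w))) [].
exists phi; split => //.
by rewrite derive1E; have ? := sder_derive dw; rewrite derive_val.
Qed.

Lemma speed_ge0 c s : 0 <= speed c s.
Proof. by rewrite /speed; case: xgetP => // r _ [phi [_ _ ->]]; exact: sqrtr_ge0. Qed.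

Lemma differentiable_curve_C1 c s :
  (\forall u \near s, differentiable_curve c u) -> C1_at c s.
Proof.
move=> H; have [cc _] := nbhs_singleton H; split => // phi aphi dphi.
apply: sder_near_C1; apply: filterS2 H (curve_in_chart cc dphi) => u [_ dc] du.
exact: dc.
Qed.

Lemma C1_differentiable_curve c s : C1_at c s -> differentiable_curve c s.
Proof.
move=> [cc H]; split => // phi aphi dphi; exists (derive1 (phi \o c) s).
by apply: derivable_sder; have [] := H phi aphi dphi.
Qed.

Lemma speed_continuous c s : (\forall u \near s, differentiable_curve c u) ->
  {for s, continuous (speed c)}.
Proof.
move=> H; have [cc _] := nbhs_singleton H.
have [phi aphi dphi] := atlas_cover (c s).
have [_ /(_ phi aphi dphi)[_ cv]] := differentiable_curve_C1 H.
pose f u := Num.sqrt (inner (metric phi (phi (c u))) (derive1 (phi \o c) u)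
  (derive1 (phi \o c) u)).
have E : \forall u \near s, f u = speed c u.
  apply: filterS2 H (curve_in_chart cc dphi) => u [cu dc] du.
  have [w dw] := dc phi aphi du; rewrite (speedE cu aphi du dw).
  by rewrite /f derive1E; have ? := sder_derive dw; rewrite derive_val.
rewrite /prop_for /continuous_at -(nbhs_singleton E).
apply: cvg_trans (near_eq_cvg E) _; rewrite /f.
apply: continuous_cvg; first exact: sqrt_continuous.
apply: inner_cvg => //.
apply: (@continuous_comp _ _ _ (phi \o c) (metric phi)); last exact: metric_cvg.
by apply: continuous_comp => //; exact: chart_continuous.
Qed.

Lemma differentiable_curve_near_eq (c c' : R -> X) s :
  (\forall u \near s, c u = c' u) -> differentiable_curve c s ->
  differentiable_curve c' s /\ speed c' s = speed c s.
Proof.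
move=> H [cc dc]; have E := nbhs_singleton H.
have cc' : {for s, continuous c'}.
  rewrite /prop_for /continuous_at -E; apply: cvg_trans cc.
  by apply: near_eq_cvg; apply: filterS H.
have dE phi w : sder (phi \o c) s w -> sder (phi \o c') s w.
  by apply: strict_diff_near; apply: filterS H => u /= ->.
have [phi aphi dphi] := atlas_cover (c s); have [w dw] := dc phi aphi dphi.
split; last by rewrite (speedE cc' aphi _ (dE _ _ dw)) -E // (speedE cc aphi dphi dw).
by apply: (differentiable_curve_chart cc' aphi _ (dE _ _ dw)); rewrite -E.
Qed.

Lemma reparam_speed c (a : R -> R) s b : differentiable_curve c (a s) ->
  sder a s b -> differentiable_curve (c \o a) s /\
    speed (c \o a) s = `|b| * speed c (a s).
Proof.
move=> [cc dc] da.
have cca : {for s, continuous (c \o a)}.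
  by apply: continuous_comp => //; exact: sder_continuous da.
have [phi aphi dphi] := atlas_cover (c (a s)); have [w dw] := dc phi aphi dphi.
have dw' : sder (phi \o (c \o a)) s (b *: w) by exact: sder_reparam dw da.
split; first exact: differentiable_curve_chart cca aphi dphi dw'.
rewrite (speedE cca aphi dphi dw') (speedE cc aphi dphi dw) innerZ.
by rewrite sqrtrM ?sqr_ge0 // sqrtr_sqr.
Qed.

Lemma cst_speed (x : X) s :
  differentiable_curve (fun=> x) s /\ speed (fun=> x) s = 0.
Proof.
have [phi aphi dphi] := atlas_cover x.
have d0 : sder (phi \o (fun=> x)) s 0.
  by move=> e e0; exists 1 => // u v _ _; rewrite /= subrr scaler0 subrr normr0 mulr_ge0 // ltW.
have cc : {for s, continuous (fun=> x : X)} by exact: cvg_cst.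
split; first exact: differentiable_curve_chart cc aphi dphi d0.
by rewrite (speedE cc aphi dphi d0) /inner !mul0mx mxE sqrtr0.
Qed.

End Speed.

Lemma push_speed {R : realType} {n : nat} {X Y : riemannianManifold R n}
    (F : X -> Y) (c : R -> X) (s : R) :
  isometric_at F (c s) -> differentiable_curve c s ->
  speed (F \o c) s = speed c s.
Proof.
move=> iF [cc dc]; have [phi aphi dphi] := atlas_cover (c s).
have [psi apsi dpsi] := atlas_cover (F (c s)).
have [w dw] := dc phi aphi dphi.
have [w' dw' E] := push_sder aphi apsi dphi dpsi cc iF dw.
rewrite (speedE cc aphi dphi dw) E (speedE _ apsi dpsi dw') //.
by apply: continuous_comp => //; case: iF.
Qed.

(** * Reparametrized arcs and the distance *)

Section SmoothStep.
Context {R : realType}.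
Implicit Types s u : R.

Definition bump u : R := Num.max 0 (u * (1 - u)).

Lemma bump_ge0 u : 0 <= bump u. Proof. by rewrite le_max lexx. Qed.

Lemma bump_continuous : continuous bump.
Proof.
move=> u; apply: (@continuous_max _ _ (fun=> 0) (fun u => u * (1 - u))).
  exact: cvg_cst.
by apply: cvgM; [exact: cvg_id | apply: cvgB; [exact: cvg_cst | exact: cvg_id]].
Qed.

Lemma prim_bump_gt0 : 0 < prim bump 1.
Proof.
have dp s := @is_derive_prim R bump s bump_continuous.
have p0 : prim bump 0 = 0 by rewrite prim0 //; exact: bump_continuous.
have inc (a b : R) : a <= b -> prim bump a <= prim bump b.
  by move=> ab; apply: (increment_ge0 ab (fun s _ => dp s)) => s _; exact: bump_ge0.
have i1 : prim bump (3 / 4) <= prim bump 1 by apply: inc; lra.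
have i2 : prim bump 0 <= prim bump (1 / 4) by apply: inc; lra.
have : 3 / 4 * (3 / 16) - 1 / 4 * (3 / 16) <= prim bump (3 / 4) - prim bump (1 / 4).
  apply: (@increment_le R (fun t => t * (3 / 16)) _ (fun=> 3 / 16) bump).
  - by lra.
  - by move=> s _; exact: is_derive_mulr.
  - move=> s; rewrite in_itv /= => /andP[s1 s2]; rewrite le_max; apply/orP; right.
    by nra.
by lra.
Qed.

(** A C^1 step from 0 to 1: composing with it flattens both ends of an arc,
    so that arcs can be concatenated without leaving the C^1 class. *)
Definition step s : R := prim bump s / prim bump 1.

Definition dstep s : R := bump s / prim bump 1.

Lemma dstep_ge0 s : 0 <= dstep s.
Proof. by rewrite divr_ge0 ?bump_ge0 // ltW // prim_bump_gt0. Qed.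

Lemma dstep_continuous : continuous dstep.
Proof. by move=> s; apply: cvgMr_tmp; exact: bump_continuous. Qed.

Lemma step_derive s : is_derive s 1 step (dstep s).
Proof.
have dp := @is_derive_prim R bump s bump_continuous.
have : is_derive s 1 ((prim bump 1)^-1 *: prim bump) ((prim bump 1)^-1 *: bump s).
  exact: is_deriveZ.
rewrite [_ *: bump s]mulrC; congr (is_derive _ _ _ _).
by apply/funext => t; rewrite /step !fctE mulrC.
Qed.

Let constant_outside (a b : R) : a <= b -> b <= 0 \/ 1 <= a -> step a = step b.
Proof.
move=> ab H; apply: increment_cst ab _ => s; rewrite in_itv /= => /andP[as_ sb].
suff <- : dstep s = 0 by exact: step_derive.
rewrite /dstep /bump max_l ?mul0r //.
by case: H => [b0|a1]; [rewrite mulr_le0_ge0 | rewrite mulr_ge0_le0]; lra.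
Qed.

Lemma step_le0 s : s <= 0 -> step s = 0.
Proof.
move=> s0; rewrite (constant_outside s0); last by left.
by rewrite /step prim0 ?mul0r //; exact: bump_continuous.
Qed.

Lemma step_ge1 s : 1 <= s -> step s = 1.
Proof.
move=> s1; rewrite -(constant_outside s1); last by right.
by rewrite /step divff // gt_eqF // prim_bump_gt0.
Qed.

Lemma step_itv s : 0 <= step s <= 1.
Proof.
have inc (a b : R) : a <= b -> step a <= step b.
  move=> ab; apply: (increment_ge0 ab) => t _; first exact: step_derive.
  exact: dstep_ge0.
apply/andP; split.
  by have [s0|/ltW s0] := leP s 0; [rewrite step_le0 | rewrite -[0](step_le0 (lexx 0)) inc].
by have [s0|/ltW s0] := leP 1 s; [rewrite step_ge1 | rewrite -[leRHS](step_ge1 (lexx 1)) inc].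
Qed.

(** The retraction of the line onto the unit interval, by which paths and
    homotopies become globally continuous maps. *)
Definition clamp : R -> R := locked (fun s => Num.max 0 (Num.min 1 s)).

Let clampE s : clamp s = Num.max 0 (Num.min 1 s).
Proof. by rewrite /clamp -lock. Qed.

Lemma clamp_itv s : 0 <= clamp s <= 1.
Proof. by rewrite clampE le_max lexx /= ge_max ler01 ge_min lexx. Qed.

Lemma unit0 : 0 <= (0 : R) <= 1. Proof. by rewrite lexx ler01. Qed.
Lemma unit1 : 0 <= (1 : R) <= 1. Proof. by rewrite lexx ler01. Qed.

Lemma clamp_id s : 0 <= s <= 1 -> clamp s = s.
Proof. by move=> /andP[s0 s1]; rewrite clampE min_r // max_r. Qed.

Lemma clamp_continuous : continuous clamp.
Proof.
rewrite /clamp -lock => u; apply: (@continuous_max _ _ (fun=> 0) (fun u => Num.min 1 u)); first exact: cvg_cst.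
by apply: (@continuous_min _ _ (fun=> 1) id); [exact: cvg_cst | exact: cvg_id].
Qed.

End SmoothStep.


Section Arcs.
Context {R : realType} {n : nat} {X : riemannianManifold R n}.
Implicit Types (c : R -> X) (x y z : X) (s u : R).

(** The working class of paths: at rest outside [0, 1] and differentiable on the
    whole line, so that no one-sided derivatives occur and pieces of arcs,
    reversed arcs and concatenations are again arcs. *)
Definition arc c x y : Prop :=
  [/\ forall s, differentiable_curve c s, forall s, s <= 0 -> c s = x
    & forall s, 1 <= s -> c s = y].

Lemma arc_continuous c x y : arc c x y -> continuous c.
Proof. by move=> [dc _ _] s; case: (dc s). Qed.

Lemma arc_speed_continuous c x y : arc c x y -> continuous (speed c).
Proof. by move=> [dc _ _] s; apply: speed_continuous; near do exact: dc.
Unshelve. all: by end_near. Qed.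

Lemma arc_C1 c x y s : arc c x y -> C1_at c s.
Proof. by move=> [dc _ _]; apply: differentiable_curve_C1; near do exact: dc.
Unshelve. all: by end_near. Qed.

Lemma arc_speed0 c x y s : arc c x y -> s <= 0 \/ 1 <= s -> speed c s = 0.
Proof.
move=> ac H; have [dc c0 c1] := ac.
have out u : u < 0 \/ 1 < u -> speed c u = 0.
  move=> [u0|u1].
    have H1 : \forall v \near u, (fun=> x) v = c v.
      by apply: filterS (near_ltr u0) => v /ltW /c0.
    by rewrite (differentiable_curve_near_eq H1 (cst_speed x u).1).2 (cst_speed x u).2.
  have H1 : \forall v \near u, (fun=> y) v = c v.
    by apply: filterS (near_gtr u1) => v /ltW /c1.
  by rewrite (differentiable_curve_near_eq H1 (cst_speed y u).1).2 (cst_speed y u).2.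
apply/eqP; rewrite eq_le speed_ge0 andbT leNgt; apply/negP => sp.
have cs : speed c @ s --> speed c s by exact: arc_speed_continuous ac _.
move/cvgr_gt/(_ _ sp)/nbhs_ballP : cs => [d /= d0 Hd].
have K u : `|u - s| < d -> u < 0 \/ 1 < u -> False.
  move=> us uo; have : 0 < speed c u by apply: Hd; rewrite -ball_normE /= distrC.
  by rewrite out // ltxx.
case: H => sH.
  apply: (K (s - d / 2)); last by left; lra.
  by rewrite addrAC subrr add0r normrN gtr0_norm; lra.
apply: (K (s + d / 2)); last by right; lra.
by rewrite addrAC subrr add0r gtr0_norm; lra.
Qed.

Definition arc_length c : R -> R := locked (prim (speed c)).

Let arc_length_prim c : arc_length c = prim (speed c).
Proof. by rewrite /arc_length -lock. Qed.

Lemma arc_lengthE c x y : arc c x y -> curve_length c = arc_length c 1.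
Proof. by move=> ac; rewrite /curve_length Rintegral01_prim ?arc_length_prim //; exact: arc_speed_continuous ac. Qed.

Lemma arc_length0 c x y : arc c x y -> arc_length c 0 = 0.
Proof. by move=> ac; rewrite arc_length_prim prim0 //; exact: arc_speed_continuous ac. Qed.

Lemma arc_length_derive c x y s : arc c x y ->
  is_derive s 1 (arc_length c) (speed c s).
Proof. by rewrite arc_length_prim => ac; apply: is_derive_prim; exact: arc_speed_continuous ac. Qed.

Lemma arc_length_le c x y s u : arc c x y -> s <= u ->
  arc_length c s <= arc_length c u.
Proof.
move=> ac su.
apply: (increment_ge0 su (fun t _ => arc_length_derive t ac)) => t _.
exact: speed_ge0.
Qed.

Lemma arc_length_const c x y s u : arc c x y -> s <= u -> u <= 0 \/ 1 <= s ->
  arc_length c s = arc_length c u.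
Proof.
move=> ac su H.
have d0 (t : R) : t \in `[s, u] -> is_derive t 1 (arc_length c) 0.
  rewrite in_itv /= => /andP[st tu]; have <- : speed c t = 0.
    by apply: arc_speed0 ac _; case: H => ?; [left | right]; lra.
  exact: arc_length_derive ac.
exact: increment_cst su d0.
Qed.

Lemma curve_length_ge0 c : 0 <= curve_length c.
Proof. by apply: Rintegral_ge0 => s _; exact: speed_ge0. Qed.

Lemma arc_cst x : arc (fun=> x) x x /\ curve_length (fun=> x) = 0.
Proof.
have ax : arc (fun=> x) x x by split => // s; have [] := cst_speed x s.
split => //; rewrite (arc_lengthE ax) -(arc_length0 ax).
have d0 (t : R) : is_derive t 1 (arc_length (fun=> x)) 0.
  by rewrite -(cst_speed x t).2; exact: arc_length_derive ax.
by rewrite (increment_cst ler01 (fun t _ => d0 t)).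
Qed.

(** Running through a piece of a curve, forwards or backwards, at the pace of
    the smooth step. *)
Lemma subarc c s0 s1 : (forall s, 0 <= s <= 1 -> \forall u \near s,
    differentiable_curve c u) -> 0 <= s0 <= 1 -> 0 <= s1 <= 1 ->
  exists2 c', arc c' (c s0) (c s1) & curve_length c' =
    `|prim (speed c \o clamp) s1 - prim (speed c \o clamp) s0| /\
    forall s, exists2 u, 0 <= u <= 1 & c' s = c u.
Proof.
move=> rc s0I s1I; pose a s := s0 + step s * (s1 - s0).
pose da s := dstep s * (s1 - s0).
have aI s : 0 <= a s <= 1.
  move: s0I s1I; have := @step_itv R s; rewrite /a.
  by move=> /andP[p0 p1] /andP[a0 a1] /andP[b0 b1]; apply/andP; split; nra.
have dda s : is_derive s 1 a (da s).
  have -> : a = cst s0 + (s1 - s0) *: step.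
    by apply/funext => t; rewrite /a !fctE [_ *: _]mulrC.
  rewrite /da mulrC -[X in is_derive _ _ _ X]add0r.
  by apply: is_deriveD; apply: is_deriveZ (step_derive s).
have cda : continuous da by move=> s; apply: cvgMr_tmp; exact: dstep_continuous.
have sa s : sder a s (da s) by apply: sder_primitive dda _; exact: cda.
have dca s : differentiable_curve c (a s) by exact: nbhs_singleton (rc _ (aI s)).
have aa : arc (c \o a) (c s0) (c s1).
  split=> [s|s s_le|s s_ge]; first exact: (reparam_speed (dca s) (sa s)).1.
    by rewrite /= /a step_le0 // mul0r addr0.
  by rewrite /= /a step_ge1 // mul1r subrKC.
exists (c \o a); first exact: aa.
split; last by move=> s; exists (a s).
pose sg := speed c \o clamp.
have csg : continuous sg.
  move=> s; apply: continuous_comp; first exact: clamp_continuous.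
  by apply: speed_continuous; apply: rc; exact: clamp_itv.
have dP s : is_derive s 1 (prim sg \o a) (sg (a s) * da s).
  by apply: is_derive1_comp (is_derive_prim _ csg) (dda s).
have sE s : speed (c \o a) s = `|da s| * sg (a s).
  by rewrite (reparam_speed (dca s) (sa s)).2 /sg /= clamp_id.
have a0 : a 0 = s0 by rewrite /a step_le0 // mul0r addr0.
have a1 : a 1 = s1 by rewrite /a step_ge1 // mul1r subrKC.
have dL s := arc_length_derive s aa.
rewrite (arc_lengthE aa) -[LHS]subr0 -(arc_length0 aa) -[in RHS]a0 -[in RHS]a1.
have nn : 0 <= arc_length (c \o a) 1 - arc_length (c \o a) 0.
  by rewrite subr_ge0; apply: arc_length_le aa _.
have [s01|s10] := leP s0 s1.
  have dL' s : is_derive s 1 (arc_length (c \o a)) (sg (a s) * da s).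
    have <- // : speed (c \o a) s = sg (a s) * da s.
    by rewrite sE mulrC ger0_norm // mulr_ge0 ?dstep_ge0 // subr_ge0.
  rewrite -[LHS](ger0_norm nn); congr (`|_|).
  exact: (increment_eq ler01 (fun s _ => dL' s) (fun s _ => dP s)).
have dL' s : is_derive s 1 (arc_length (c \o a)) (- (sg (a s) * da s)).
  have <- // : speed (c \o a) s = - (sg (a s) * da s).
  rewrite sE mulrC ler0_norm ?mulrN // mulr_ge0_le0 ?dstep_ge0 //.
  by rewrite subr_le0 ltW.
have dP' s : is_derive s 1 (- (prim sg \o a)) (- (sg (a s) * da s)).
  exact: is_deriveN (dP s).
rewrite -[LHS](ger0_norm nn) [RHS]distrC; congr (`|_|).
rewrite (increment_eq ler01 (fun s _ => dL' s) (fun s _ => dP' s)).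
by rewrite !fctE opprK addrC.
Qed.

Lemma arc_of_C1_arc c : C1_arc c ->
  exists2 c', arc c' (c 0) (c 1) & curve_length c' = curve_length c.
Proof.
move=> [e e0 H].
have rc s : 0 <= s <= 1 -> \forall u \near s, differentiable_curve c u.
  move=> /andP[s0 s1]; have : s \in `]- e, 1 + e[ by rewrite in_itv /=; lra.
  move=> /near_in_itvoo; apply: filterS => u /H; exact: C1_differentiable_curve.
have [c' ac' [E _]] := subarc rc unit0 unit1.
exists c'; first exact: ac'.
have csg : continuous (speed c \o clamp).
  move=> s; apply: continuous_comp; first exact: clamp_continuous.
  by apply: speed_continuous; apply: rc; exact: clamp_itv.
rewrite -[LHS]ger0_norm ?curve_length_ge0 // E normr_id (prim0 csg) oppr0 addr0.
rewrite -(Rintegral01_prim csg) ger0_norm; last first.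
  by apply: Rintegral_ge0 => s _; exact: speed_ge0.
by apply: eq_Rintegral => s; rewrite inE /= in_itv => sI; rewrite /= clamp_id.
Qed.

Section ArcPieces.
Context {c : R -> X} {x y : X} (ac : arc c x y).

Let prim_clamp s : 0 <= s <= 1 -> prim (speed c \o clamp) s = arc_length c s.
Proof.
move=> /andP[s0 s1].
have csg : continuous (speed c \o clamp).
  move=> u; apply: continuous_comp; first exact: clamp_continuous.
  exact: arc_speed_continuous ac _.
have dp (t : R) : t \in `[0, s] -> is_derive t 1 (prim (speed c \o clamp)) (speed c t).
  rewrite in_itv /= => /andP[t0 ts].
  have <- : (speed c \o clamp) t = speed c t by rewrite /= clamp_id //; lra.
  exact: is_derive_prim.
apply: increment_eq_from s0 dp (fun t _ => arc_length_derive t ac) _.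
by rewrite (prim0 csg) (arc_length0 ac).
Qed.

Lemma arc_piece s0 s1 : 0 <= s0 <= 1 -> 0 <= s1 <= 1 ->
  exists2 c', arc c' (c s0) (c s1) &
    curve_length c' = `|arc_length c s1 - arc_length c s0|.
Proof.
move=> s0I s1I; have [|c' ac' [E _]] := @subarc c s0 s1 _ s0I s1I.
  by move=> s _; case: ac => dc _ _; near do exact: dc.
by exists c'; [exact: ac' | rewrite E !prim_clamp].
Unshelve. all: by end_near. Qed.

Lemma arc0 : c 0 = x. Proof. by case: ac => _ -> //. Qed.
Lemma arc1 : c 1 = y. Proof. by case: ac => _ _ ->. Qed.

Lemma arc_rev : exists2 c', arc c' y x & curve_length c' = curve_length c.
Proof.
have [c' ac' E] := arc_piece unit1 unit0.
exists c'; first by rewrite -arc0 -arc1.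
by rewrite E distrC (arc_length0 ac) oppr0 addr0 -(arc_lengthE ac) ger0_norm // curve_length_ge0.
Qed.

End ArcPieces.

(** The gap between the two pieces, where the curve rests, spares a discussion
    of the derivatives at the junction. *)
Lemma arc_concat c1 c2 x y z : arc c1 x y -> arc c2 y z ->
  exists2 c, arc c x z & curve_length c = curve_length c1 + curve_length c2 /\
    c (2^-1) = y /\ arc_length c 2^-1 = curve_length c1.
Proof.
move=> a1 a2; pose c s := if s <= 2^-1 then c1 (s * 3) else c2 (s * 3 - 2).
have [d1 c10 c11] := a1; have [d2 c20 c21] := a2.
have s3 s : sder (fun s => s * 3 : R) s 3.
  by apply: (@sder_primitive R _ (fun=> 3)) => [t|]; [exact: is_derive_mulr | exact: cvg_cst].
have s32 s : sder (fun s => s * 3 - 2 : R) s 3.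
  apply: (@sder_primitive R _ (fun=> 3)) => [t|]; last exact: cvg_cst.
  by rewrite -[X in is_derive _ _ _ X]subr0; apply: is_deriveB; exact: is_derive_mulr.
have left_eq s : s < 2 / 3 -> \forall u \near s, (c1 \o (fun s => s * 3)) u = c u.
  move=> s23; apply: filterS (near_ltr s23) => u u23; rewrite /c; case: ifPn => //.
  by rewrite -ltNge /= => u2; rewrite c11 ?c20 //; lra.
have right_eq s : 1 / 3 < s ->
    \forall u \near s, (c2 \o (fun s => s * 3 - 2)) u = c u.
  move=> s13; apply: filterS (near_gtr s13) => u u13; rewrite /c; case: ifPn => //.
  by move=> u2 /=; rewrite c11 ?c20 //; lra.
have key s : differentiable_curve c s /\
    speed c s = speed c1 (s * 3) * 3 + speed c2 (s * 3 - 2) * 3.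
  have [s2|s2] := leP s 2^-1.
    have s23 : s < 2 / 3 by lra.
    have s32l : s * 3 - 2 <= 0 by lra.
    have [da va] := reparam_speed (a := fun s => s * 3) (d1 (s * 3)) (s3 s).
    have [dcs ->] := differentiable_curve_near_eq (left_eq s s23) da.
    split; first exact: dcs.
    rewrite va ger0_norm // mulrC (arc_speed0 (s := s * 3 - 2) a2) ?mul0r ?addr0 //.
    by left.
  have s13 : 1 / 3 < s by lra.
  have s31 : 1 <= s * 3 by lra.
  have [da va] := reparam_speed (a := fun s => s * 3 - 2)
    (d2 (s * 3 - 2)) (s32 s).
  have [dcs ->] := differentiable_curve_near_eq (right_eq s s13) da.
  split; first exact: dcs.
  rewrite va ger0_norm // mulrC (arc_speed0 (s := s * 3) a1) ?mul0r ?add0r //.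
  by right.
have ac : arc c x z.
  split=> [s|s s0|s s1]; first exact: (key s).1.
    by rewrite /c ifT ?c10 //; lra.
  by rewrite /c ifF ?c21 //; [lra | apply/negbTE; rewrite -ltNge; lra].
have dG s : is_derive s 1 (fun s => arc_length c1 (s * 3) + arc_length c2 (s * 3 - 2))
    (speed c s).
  rewrite (key s).2.
  have e1 := is_derive1_comp (g := fun s => s * 3)
    (arc_length_derive (s * 3) a1) (sder_derive (s3 s)).
  have e2 := is_derive1_comp (g := fun s => s * 3 - 2)
    (arc_length_derive (s * 3 - 2) a2)
    (sder_derive (s32 s)).
  exact: is_deriveD e1 e2.
have LE s : 0 <= s -> arc_length c s =
    arc_length c1 (s * 3) + arc_length c2 (s * 3 - 2).
  move=> s0; apply: increment_eq_from s0 (fun t _ => arc_length_derive t ac)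
    (fun t _ => dG t) _.
  rewrite (arc_length0 ac) mul0r (arc_length0 a1) add0r.
  have le2 : 0 - 2 <= 0 :> R by lra.
  by rewrite (arc_length_const a2 le2 (or_introl (lexx _))) (arc_length0 a2).
exists c; first exact: ac.
split; [|split].
- rewrite (arc_lengthE ac) LE // (arc_lengthE a1) (arc_lengthE a2); congr (_ + _).
    by apply/esym; apply: arc_length_const a1 _ _; [lra | right].
  by congr arc_length; lra.
- by rewrite /c lexx c11 //; lra.
- rewrite LE ?invr_ge0 // (arc_lengthE a1) -[RHS]addr0; congr (_ + _).
    by apply/esym; apply: arc_length_const a1 _ _; [lra | right].
  rewrite -(arc_length0 a2); apply: arc_length_const a2 _ _; first by lra.
  by left.
Qed.

(** Flattening the ends of each piece changes neither its end points nor its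
    length, so the distance is an infimum over arcs. *)
Lemma piecewise_C1P x y l : piecewise_C1 x y l <->
  exists2 c, arc c x y & curve_length c = l.
Proof.
split=> [|[c ac <-]].
  elim=> [|c {}l _ [c1 a1 <-] /arc_of_C1_arc [c2 a2 <-]].
    by exists (fun=> x); have [] := arc_cst x.
  by have [c' ac' [E _]] := arc_concat a1 a2; exists c'; [exact: ac' | exact: E].
rewrite -[curve_length c]add0r -(arc1 ac); apply: PiecewiseSnoc.
  rewrite (arc0 ac); exact: PiecewiseNil.
by exists 1 => // s _; exact: arc_C1 ac.
Qed.

End Arcs.

(** * Distance and coordinates *)

Section Distance.
Context {R : realType} {n : nat} {X : riemannianManifold R n}.
Implicit Types (x y z : X) (c : R -> X).

Definition arcwise : Prop := forall x y, exists c, arc c x y.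

Let lengths x y : [set l : R | piecewise_C1 x y l] =
  [set l | exists2 c, arc c x y & curve_length c = l].
Proof. by apply/seteqP; split => l /=; rewrite piecewise_C1P. Qed.

Let lengths_lb x y : lbound [set l : R | piecewise_C1 x y l] 0.
Proof. by rewrite lengths => _ [c _ <-]; exact: curve_length_ge0. Qed.

Lemma dist_le_length c x y : arc c x y -> riemannian_dist x y <= curve_length c.
Proof.
move=> ac; apply: ge_inf; first by exists 0; exact: lengths_lb.
by rewrite lengths; exists c.
Qed.

Hypothesis aX : arcwise.

Let lengths_inf x y : has_inf [set l : R | piecewise_C1 x y l].
Proof.
split; last by exists 0; exact: lengths_lb.
by have [c ac] := aX x y; exists (curve_length c); rewrite lengths; exists c.
Qed.

Lemma dist_lt_length x y (r : R) : riemannian_dist x y < r ->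
  exists2 c, arc c x y & curve_length c < r.
Proof.
rewrite -subr_gt0 => /inf_adherent/(_ (lengths_inf x y))[l].
move=> pl lt_l; move: pl; rewrite lengths => -[c ac cE]; exists c => //.
by rewrite cE; apply: lt_le_trans lt_l _; rewrite -/(riemannian_dist x y) subrKC.
Qed.

Lemma dist_ge0 x y : 0 <= riemannian_dist x y.
Proof. by apply: lb_le_inf; [case: (lengths_inf x y) | exact: lengths_lb]. Qed.

Lemma dist_xx x : riemannian_dist x x = 0.
Proof.
apply/eqP; rewrite eq_le dist_ge0 andbT; have [ax <-] := arc_cst x.
exact: dist_le_length.
Qed.

Lemma dist_sym x y : riemannian_dist x y = riemannian_dist y x.
Proof.
suff H (u v : X) : riemannian_dist u v <= riemannian_dist v u.
  by apply/eqP; rewrite eq_le !H.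
apply/ler_addgt0Pr => e e0.
have /dist_lt_length[c ac /ltW cl] : riemannian_dist v u < riemannian_dist v u + e.
  by rewrite ltrDl.
have [c' ac' E] := arc_rev ac; apply: le_trans cl; rewrite -E.
exact: dist_le_length.
Qed.

Lemma dist_triangle y x z :
  riemannian_dist x z <= riemannian_dist x y + riemannian_dist y z.
Proof.
apply/ler_addgt0Pr => e e0; have e2 : 0 < e / 2 by rewrite divr_gt0.
have /dist_lt_length[c ac cl] : riemannian_dist x y < riemannian_dist x y + e / 2.
  by rewrite ltrDl.
have /dist_lt_length[c' ac' cl'] : riemannian_dist y z < riemannian_dist y z + e / 2.
  by rewrite ltrDl.
have [c2 ac2 [E _]] := arc_concat ac ac'.
apply: le_trans (dist_le_length ac2) _; rewrite E [e in leRHS]splitr addrACA.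
by apply: lerD; exact: ltW.
Qed.

End Distance.

Arguments arcwise {R n} X.

Section ChartBounds.
Context {R : realType} {n : nat} {X : riemannianManifold R n}.

(** The comparison of the metric with the coordinate norm, from which everything
    about the topology of the distance follows. *)
Definition coordinate_ball (phi : @chart R n X) (p : 'rV[R]_n)
    (r lo hi : R) : Prop :=
  [/\ atlas phi, 0 < r, 0 < lo, 0 < hi & forall v, `|v - p| <= r ->
    (exists2 z, cdom phi z & phi z = v) /\
    forall w, (lo * `|w|) ^+ 2 <= inner (metric phi v) w w <= (hi * `|w|) ^+ 2].

(** The minimum on the unit sphere of the norm, which is compact. *)
Lemma positive_form_lower (G : 'M[R]_n) : (forall v, v != 0 -> 0 < inner G v v) ->
  exists2 m : R, 0 < m & forall v, m * `|v| ^+ 2 <= inner G v v.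
Proof.
move=> Gpos; pose S := [set v : 'rV[R]_n | `|v| = 1].
have [S0|/set0P S0] := eqVneq S set0.
  exists 1 => // v; have [->|v0] := eqVneq v 0.
    by rewrite normr0 expr0n mulr0 /inner !mul0mx mxE.
  suff : S (`|v|^-1 *: v) by rewrite S0.
  by rewrite /S /= normrZ normfV normr_id mulVf // normr_eq0.
have cN : continuous (fun v : 'rV[R]_n => `|v|) by exact: norm_continuous.
have cS : compact S.
  apply: bounded_closed_compact.
    by exists 1; split => // r r1 v /= ->; exact: ltW.
  by apply: (@preimage_closed _ _ (fun v : 'rV[R]_n => `|v|) [set t : R | t = 1]) => [v _|];
    [exact: cN | exact: closed_eq].
have [|v0 Sv0 min] := @compact_EVT_min _ R (fun v => inner G v v) S S0 cS.
  apply: continuous_subspaceT => v.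
  by apply: (inner_cvg (F := nbhs v)); [exact: cvg_cst | exact: cvg_id | exact: cvg_id].
have v00 : v0 != 0.
  apply/eqP => v00; move: Sv0; rewrite inE /S /= v00 normr0 => /eqP.
  by rewrite eq_sym oner_eq0.
exists (inner G v0 v0); first exact: Gpos.
move=> v; have [->|vn0] := eqVneq v 0.
  by rewrite normr0 expr0n mulr0 /inner !mul0mx mxE.
have nv0 : `|v| != 0 by rewrite normr_eq0.
have := min (`|v|^-1 *: v); rewrite inE /S /= normrZ normfV normr_id mulVf //.
move=> /(_ erefl); rewrite innerZ exprVn.
by rewrite ler_pdivlMl ?exprn_gt0 ?normr_gt0 // mulrC.
Qed.

(** The bounds hold at the centre and survive a small perturbation of the form. *)
Lemma ex_coordinate_ball (phi : @chart R n X) (x : X) :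
  atlas phi -> cdom phi x ->
  exists r lo hi, coordinate_ball phi (phi x) r lo hi.
Proof.
move=> aphi dphi; set G := metric phi (phi x).
have [m m0 Hm] := positive_form_lower (fun v v0 => metric_pos aphi dphi v0).
pose N := n%:R ^+ 2 + 1 : R; have N0 : 0 < N by rewrite ltr_wpDl // sqr_ge0.
pose e := m / 2 / N; have e0 : 0 < e by rewrite !divr_gt0.
have H : \forall v \near phi x, (exists2 z, cdom phi z & phi z = v) /\
    `|metric phi v - G| < e.
  apply: filterI.
    apply: filterS (chart_near_range (openT) I dphi) => v [z [dz _] <-].
    by exists z.
  have /cvgrPdist_lt/(_ e e0) := metric_cvg aphi dphi.
  by apply: filterS => v; rewrite distrC.
have /nbhs_ballP[d /= d0 Hd] := H.
pose h := m / 2 + N * `|G| + 1.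
have h0' : 0 < h by rewrite ltr_wpDl // addr_ge0 ?divr_ge0 ?mulr_ge0 // ltW.
exists (d / 2), (Num.sqrt (m / 2)), (Num.sqrt h); split => //.
- by rewrite divr_gt0.
- by rewrite sqrtr_gt0 divr_gt0.
- by rewrite sqrtr_gt0.
move=> v vd; have [|rv Gv] := Hd v.
  rewrite -ball_normE /= distrC; apply: le_lt_trans vd _.
  by rewrite ltr_pdivrMr // ltr_pMr // ltr1n.
split => // w; rewrite !exprMn !sqr_sqrtr ?divr_ge0 ?(ltW h0') ?(ltW m0) //.
have E : inner (metric phi v) w w = inner G w w + inner (metric phi v - G) w w.
  by rewrite -inner_mxD subrKC.
have B1 : `|inner (metric phi v - G) w w| <= m / 2 * `|w| ^+ 2.
  apply: le_trans (inner_norm_le _ _ _) _; rewrite -mulrA -expr2.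
  apply: ler_wpM2r; first exact: sqr_ge0.
  apply: (@le_trans _ _ (N * e)); last by rewrite /e mulrC divfK // gt_eqF.
  by apply: ler_pM; rewrite ?sqr_ge0 // ?lerDl // ltW.
have B2 : `|inner G w w| <= N * `|G| * `|w| ^+ 2.
  apply: le_trans (inner_norm_le _ _ _) _; rewrite -mulrA -expr2.
  apply: ler_wpM2r; first exact: sqr_ge0.
  by apply: ler_wpM2r => //; rewrite lerDl.
have B3 := Hm w; have B4 := sqr_ge0 `|w|; rewrite E; apply/andP.
move: B1 B2; rewrite !ler_norml => /andP[b1 b2] /andP[b3 b4]; split.
  have -> : m / 2 * `|w| ^+ 2 = m * `|w| ^+ 2 - m / 2 * `|w| ^+ 2 by lra.
  lra.
rewrite /h mulrDl mulrDl mul1r; lra.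
Qed.

Lemma chart_curve (phi : @chart R n X) (x : R -> 'rV[R]_n) s w : atlas phi ->
  (exists2 z, cdom phi z & phi z = x s) -> sder x s w ->
  differentiable_curve (cinv phi \o x) s /\
  speed (cinv phi \o x) s = Num.sqrt (inner (metric phi (x s)) w w).
Proof.
move=> aphi [z dz zE] dx.
have cx := sder_continuous dx.
have cc : {for s, continuous (cinv phi \o x)}.
  apply: continuous_comp => //; apply: cinv_continuous.
  by rewrite inE -zE; exists z.
have dc : cdom phi ((cinv phi \o x) s) by rewrite /= -zE chartK.
have dw : sder (phi \o (cinv phi \o x)) s w.
  apply: strict_diff_near dx.
  have H : nbhs (x s) [set v | v = phi (cinv phi v)].
    rewrite -zE; apply: filterS (chart_near_range openT I dz) => v [y [dy _] <-].
    by rewrite /= chartK.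
  exact: (cx _ H).
split; first exact: differentiable_curve_chart cc aphi dc dw.
by rewrite (speedE cc aphi dc dw) /= -zE chartK.
Qed.

Section InBall.
Context {phi : @chart R n X} {p : 'rV[R]_n} {r lo hi : R}.
Hypothesis cb : coordinate_ball phi p r lo hi.
Implicit Types (c : R -> X) (x y z : X) (rho : R).

Definition in_ball rho z : Prop := cdom phi z /\ `|phi z - p| < rho.

Lemma speed_lower c s : differentiable_curve c s -> cdom phi (c s) ->
  `|phi (c s) - p| <= r -> exists2 w, sder (phi \o c) s w &
  speed c s = Num.sqrt (inner (metric phi (phi (c s))) w w) /\
  lo * `|w| <= speed c s.
Proof.
case: cb => aphi r0 lo0 hi0 B [cc dc] dphi cr.
have [w dw] := dc phi aphi dphi; exists w => //.
have sE := speedE cc aphi dphi dw; split => //; rewrite sE.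
have [_ /(_ w)/andP[Bl _]] := B _ cr.
rewrite -[leLHS]ger0_norm ?mulr_ge0 ?(ltW lo0) // -sqrtr_sqr.
exact: ler_wsqrtr.
Qed.

Lemma length_lower c x y s u : arc c x y -> s <= u ->
  (forall t, s <= t <= u -> cdom phi (c t) /\ `|phi (c t) - p| <= r) ->
  lo * `|phi (c u) - phi (c s)| <= arc_length c u - arc_length c s.
Proof.
case: (cb) => aphi r0 lo0 hi0 B ac su H; have [dc _ _] := ac.
have dphi t : t \in `[s, u] ->
    is_derive t 1 (phi \o c) (derive1 (phi \o c) t) /\
    `|derive1 (phi \o c) t| <= speed c t * lo^-1.
  rewrite in_itv /= => /H[d1 d2]; have [w dw [_ lw]] := speed_lower (dc t) d1 d2.
  have dw' := sder_derive dw; rewrite derive1E derive_val; split => //.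
  by rewrite ler_pdivlMr // mulrC.
have dl (t : R) : is_derive t 1 (fun t => arc_length c t * lo^-1) (speed c t * lo^-1).
  have -> : (fun t => arc_length c t * lo^-1) =
      (fun v => v * lo^-1) \o arc_length c by [].
  rewrite mulrC; apply: is_derive1_comp (is_derive_mulr _ _) (arc_length_derive t ac).
rewrite -ler_pdivlMl // mulrC mulrBl.
apply: (rV_increment_le su (fun t tI => (dphi t tI).1) (fun t _ => dl t)).
by move=> t tI; exact: (dphi t tI).2.
Qed.

Lemma in_ball_open rho : open [set z | in_ball rho z].
Proof.
rewrite openE => z [dz zr]; apply: filterI; first exact: chart_near.
have := @chart_continuous R n X phi z dz.
have : nbhs (phi z) [set v | `|v - p| < rho].
  have : nbhs (phi z) (ball (phi z) (rho - `|phi z - p|)).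
    by apply: nbhsx_ballx; rewrite subr_gt0.
  apply: filterS => v; rewrite -ball_normE /= => vz.
  rewrite -(subrK (phi z) v) -addrA; apply: le_lt_trans (ler_normD _ _) _.
  by rewrite distrC; lra.
by move=> H /(_ _ H).
Qed.

Lemma closed_ball_closed rho : rho <= r ->
  closed [set z | cdom phi z /\ `|phi z - p| <= rho].
Proof.
case: (cb) => aphi r0 lo0 hi0 B rr; pose S := [set v : 'rV[R]_n | `|v - p| <= rho].
have inR v : S v -> exists2 z, cdom phi z & phi z = v.
  by move=> Sv; have [] := B v (le_trans Sv rr).
have -> : [set z | cdom phi z /\ `|phi z - p| <= rho] = cinv phi @` S.
  apply/seteqP; split => z /=; first by move=> [dz zr]; exists (phi z); rewrite ?chartK.
  by move=> [v Sv <-]; have [z' dz' zE] := inR v Sv; rewrite -zE chartK // zE.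
apply: compact_closed; first exact: manifold_hausdorff.
apply: continuous_compact.
  apply: continuous_in_subspaceT => v /[!inE] /inR[z dz <-].
  by apply: cinv_continuous; rewrite inE; exists z.
apply: bounded_closed_compact.
  exists (rho + `|p|); split => [|M M1 v /= Sv]; first by rewrite num_real.
  rewrite -(subrK p v); apply: le_trans (ler_normD _ _) _.
  by apply/ltW/(le_lt_trans _ M1); rewrite lerD2r.
apply: (@preimage_closed _ _ (fun v : 'rV[R]_n => `|v - p|) [set t : R | t <= rho]).
  move=> v _; apply: continuous_comp; last exact: norm_continuous.
  by apply: (@cvgB _ _ _ (nbhs v) _ id (fun=> p)); [exact: cvg_id | exact: cvg_cst].
exact: closed_le.
Qed.

(** First exit: the closed coordinate ball is compact, hence closed, so an arc
    can only leave it through its boundary sphere. *)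
Lemma arc_exit c x y rho : arc c x y -> rho <= r -> in_ball rho x ->
  (forall t, in_ball rho (c t)) \/
  exists s, [/\ 0 <= s <= 1, forall t, t < s -> in_ball rho (c t),
    cdom phi (c s) & `|phi (c s) - p| = rho].
Proof.
move=> ac rr bx; have [dc c0 c1] := ac.
have [allb|/existsNP[t1 nt1]] := pselect (forall t, in_ball rho (c t)); first by left.
right; pose A := [set s | forall t, t <= s -> in_ball rho (c t)].
have A0 : A 0 by move=> t /c0 ->.
have Aub s : A s -> s <= t1.
  by move=> As; rewrite leNgt; apply/negP => /ltW /As.
have hA : has_sup A by split; [exists 0 | exists t1 => s; exact: Aub].
pose S := sup A.
have S0 : 0 <= S by apply: ub_le_sup => //; case: hA.
have ltS t : t < S -> in_ball rho (c t).
  rewrite -subr_gt0 => /sup_adherent/(_ hA)[s As]; rewrite opprB subrKC => ts.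
  exact/As/ltW.
have cS : {for S, continuous c} by case: (dc S).
have nS : ~ in_ball rho (c S).
  move=> bS; have /nbhs_ballP[d /= d0 Hd] : nbhs S (fun u => in_ball rho (c u)).
    have H : nbhs (c S) [set z | in_ball rho z].
      by apply: open_nbhs_nbhs; split => //; exact: in_ball_open.
    exact: (cS _ H).
  have : A (S + d / 2).
    move=> t tS; have [tl|tg] := ltP t S; first exact: ltS.
    apply: Hd; rewrite -ball_normE /= distrC ger0_norm ?subr_ge0 //.
    by rewrite ltrBlDl (le_lt_trans tS) // ltrD2l ltr_pdivrMr // ltr_pMr // ltr1n.
  move=> /(ub_le_sup (proj2 hA)); apply/negP; rewrite -ltNge ltrDl divr_gt0 //.
have clS : cdom phi (c S) /\ `|phi (c S) - p| <= rho.
  apply: contrapT => nc.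
  have oC := closed_ball_closed rr; rewrite -openC in oC.
  have /nbhs_ballP[d /= d0 Hd] : nbhs S
      (fun u => ~ (cdom phi (c u) /\ `|phi (c u) - p| <= rho)).
    have H : nbhs (c S) (~` [set z | cdom phi z /\ `|phi z - p| <= rho]).
      exact: open_nbhs_nbhs.
    exact: (cS _ H).
  apply: (Hd (S - d / 2)).
    rewrite -ball_normE /= opprB subrKC gtr0_norm ?divr_gt0 //.
    by rewrite ltr_pdivrMr // ltr_pMr // ltr1n.
  have [|d1 d2] := ltS (S - d / 2); first by rewrite gtrBl divr_gt0.
  by split => //; exact: ltW.
have [dS leS] := clS; exists S; split => //.
  rewrite S0 /=; rewrite leNgt; apply/negP => S1; apply: nS.
  by rewrite (c1 S (ltW S1)) -(c1 1 (lexx 1)); exact: ltS.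
apply/eqP; rewrite eq_le leS /= leNgt; apply/negP => lt_r; apply: nS; split => //.
Qed.

(** Leaving the ball costs at least the coordinate distance to its boundary. *)
Lemma short_arc_in_ball c x y rho rho' : arc c x y -> rho <= r ->
  cdom phi x -> `|phi x - p| <= rho' -> rho' < rho ->
  curve_length c < lo * (rho - rho') -> forall t, in_ball rho (c t).
Proof.
case: (cb) => aphi r0 lo0 hi0 B ac rr dx xr r'r cl.
have bx : in_ball rho x by split => //; exact: le_lt_trans r'r.
have [//|[s [/andP[s0 s1] lts ds es]]] := arc_exit ac rr bx; exfalso.
have H t : 0 <= t <= s -> cdom phi (c t) /\ `|phi (c t) - p| <= r.
  move=> /andP[t0]; rewrite le_eqVlt => /orP[/eqP ->|ts]; first by rewrite es.
  by have [d1 d2] := lts t ts; split => //; apply: le_trans (ltW d2) rr.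
have K := length_lower ac s0 H.
have K2 := arc_length_le ac s1.
rewrite (arc0 ac) (arc_length0 ac) in K.
have K3 : rho - rho' <= `|phi (c s) - phi x|.
  have := ler_normD (phi (c s) - phi x) (phi x - p); rewrite addrA subrK es; lra.
have K4 := arc_lengthE ac.
have : lo * (rho - rho') <= lo * `|phi (c s) - phi x| by rewrite ler_pM2l.
by move: K K2 cl; rewrite K4; move: (arc_length c s) (arc_length c 1) => u v; lra.
Qed.

Lemma in_ball_segment x y t rho : in_ball rho x -> in_ball rho y ->
  0 <= t <= 1 -> `|phi x + t *: (phi y - phi x) - p| < rho.
Proof.
move=> [_ bx] [_ by_] /andP[t0 t1].
have -> : phi x + t *: (phi y - phi x) - p =
    (1 - t) *: (phi x - p) + t *: (phi y - p).
  by apply/rowP => i; rewrite !mxE; ring.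
apply: le_lt_trans (ler_normD _ _) _; rewrite !normrZ !ger0_norm ?subr_ge0 //.
have [->|t00] := eqVneq t 0; first by rewrite subr0 mul1r mul0r addr0.
have tp : 0 < t by rewrite lt_neqAle eq_sym t00.
have : t * `|phi y - p| < t * rho by rewrite ltr_pM2l.
have : (1 - t) * `|phi x - p| <= (1 - t) * rho.
  by apply: ler_wpM2l; [rewrite subr_ge0 | exact: ltW].
lra.
Qed.

(** Witnessed by the straight segment of the chart. *)
Lemma dist_upper x y : in_ball r x -> in_ball r y ->
  exists2 c, arc c x y & curve_length c <= hi * `|phi y - phi x|.
Proof.
case: (cb) => aphi r0 lo0 hi0 B bx by_.
pose v (t : R) := phi x + step t *: (phi y - phi x).
have sv t : sder v t (dstep t *: (phi y - phi x)).
  have s1 : sder (@step R) t (dstep t).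
    by apply: sder_primitive => [u|]; [exact: step_derive | exact: dstep_continuous].
  have s2 : sder (fun u : R => phi x + u *: (phi y - phi x)) (step t) (phi y - phi x).
    move=> e e0; exists 1 => // a b _ _.
    have -> : phi x + a *: (phi y - phi x) - (phi x + b *: (phi y - phi x)) -
       (a - b) *: (phi y - phi x) = 0 by apply/rowP => i; rewrite !mxE; ring.
    by rewrite normr0 mulr_ge0 // ltW.
  exact: sder_reparam s2 s1.
have vr t : `|v t - p| <= r by apply/ltW/in_ball_segment => //; exact: step_itv.
have key t := chart_curve aphi (B _ (vr t)).1 (sv t).
have ac : arc (cinv phi \o v) x y.
  split=> [t|t t0|t t1]; first exact: (key t).1.
    by rewrite /= /v step_le0 // scale0r addr0 chartK //; case: bx.
  by rewrite /= /v step_ge1 // scale1r subrKC chartK //; case: by_.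
exists (cinv phi \o v); first exact: ac.
rewrite (arc_lengthE ac).
set m := hi * `|phi y - phi x|.
have m0 : 0 <= m by rewrite mulr_ge0 // ltW.
have le_speed t : speed (cinv phi \o v) t <= dstep t * m.
  have dm0 : 0 <= dstep t * m by apply: mulr_ge0 => //; exact: dstep_ge0.
  rewrite (key t).2 -(ger0_norm dm0) -sqrtr_sqr.
  apply: ler_wsqrtr; rewrite innerZ [(dstep t * m) ^+ 2]exprMn ler_wpM2l ?sqr_ge0 //.
  by have [_ /(_ (phi y - phi x))/andP[]] := B _ (vr t).
have ds (t : R) : is_derive t 1 (fun t => step t * m) (dstep t * m).
  have -> : (fun t => step t * m) = (fun u => u * m) \o step by [].
  by rewrite mulrC; apply: is_derive1_comp (is_derive_mulr _ _) (step_derive t).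
have := increment_le ler01 (fun t _ => arc_length_derive t ac) (fun t _ => ds t)
  (fun t _ => le_speed t).
rewrite (arc_length0 ac) step_ge1 // step_le0 // mul0r mul1r.
by move: (arc_length _ 1) => L; lra.
Qed.

End InBall.
End ChartBounds.

(** * The topology of the distance *)

Section DistanceTopology.
Context {R : realType} {n : nat} {X : riemannianManifold R n}.
Implicit Types (x y z : X).

Lemma ex_ball_around z : exists (phi : @chart R n X) r lo hi,
  coordinate_ball phi (phi z) r lo hi /\ cdom phi z.
Proof.
have [phi aphi dz] := atlas_cover z.
have [r [lo [hi cb]]] := ex_coordinate_ball aphi dz.
by exists phi, r, lo, hi.
Qed.

Lemma center_in_ball (phi : @chart R n X) z (rho : R) : cdom phi z -> 0 < rho ->
  in_ball (phi := phi) (p := phi z) rho z.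
Proof. by move=> dz r0; split => //; rewrite subrr normr0. Qed.

Lemma arcs_near z : \forall y \near z, exists c, arc c z y.
Proof.
have [phi [r [lo [hi [cb dz]]]]] := ex_ball_around z.
have r0 : 0 < r by case: cb.
have bz := center_in_ball dz r0.
have : nbhs z [set y | in_ball (phi := phi) (p := phi z) r y].
  by apply: open_nbhs_nbhs; split; [exact: in_ball_open | exact: bz].
by apply: filterS => y by_; have [c ac _] := dist_upper cb bz by_; exists c.
Qed.

(** Points close to a given one are joined to it by a segment of a chart, hence
    the arc components are open, and so are their complements. *)
Lemma connected_arcwise : connected [set: X] -> arcwise X.
Proof.
move=> cX x; pose A := [set y | exists c, arc c x y].
have oA : open A.
  rewrite openE => y [c ac]; apply: filterS (arcs_near y) => z [c' ac'].
  by have [c'' ac'' _] := arc_concat ac ac'; exists c''.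
have oCA : open (~` A).
  rewrite openE => y nAy; apply: filterS (arcs_near y) => z [c' ac'] [c ac].
  apply: nAy; have [c1 ac1 _] := arc_rev ac'.
  by have [c'' ac'' _] := arc_concat ac ac1; exists c''.
have AT : A = [set: X].
  apply: cX; first by exists x, (fun=> x); case: (arc_cst x).
    by exists A; rewrite ?setTI.
  by exists A; rewrite ?setTI // -[A]setCK; exact: open_closedC.
by move=> y; have : A y by rewrite AT.
Qed.

Hypothesis aX : arcwise X.

Lemma dist_near z (e : R) : 0 < e -> \forall y \near z, riemannian_dist z y < e.
Proof.
move=> e0; have [phi [r [lo [hi [cb dz]]]]] := ex_ball_around z.
have [aphi r0 lo0 hi0 _] := cb.
pose rho := Num.min r (e / hi); have rho0 : 0 < rho by rewrite lt_min r0 divr_gt0.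
have bz := center_in_ball dz r0.
have : nbhs z [set y | in_ball (phi := phi) (p := phi z) rho y].
  apply: open_nbhs_nbhs; split; first exact: in_ball_open.
  exact: center_in_ball.
apply: filterS => y [dy]; rewrite lt_min => /andP[yr ye].
have [c ac cl] := dist_upper cb bz (conj dy yr).
apply: le_lt_trans (dist_le_length ac) _; apply: le_lt_trans cl _.
by rewrite mulrC -ltr_pdivlMr.
Qed.

(** A point whose distance to the centre is less than the cost of leaving a
    small coordinate ball lies in that ball. *)
Lemma nbhs_dist z (U : set X) : nbhs z U ->
  exists2 e : R, 0 < e & forall y, riemannian_dist z y < e -> U y.
Proof.
move=> Uz; have [phi [r [lo [hi [cb dz]]]]] := ex_ball_around z.
have [aphi r0 lo0 hi0 _] := cb.
have Uz' : U° z by exact: Uz.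
have /nbhs_ballP[d /= d0 Hd] := chart_near_range (@open_interior _ U) Uz' dz.
pose rho := Num.min r d; have rho0 : 0 < rho by rewrite lt_min r0.
exists (lo * rho); first exact: mulr_gt0.
move=> y /(dist_lt_length aX)[c ac cl].
have rr : rho <= r by rewrite ge_min lexx.
have := short_arc_in_ball (rho' := 0) cb ac rr dz _ rho0.
rewrite subrr normr0 subr0 => /(_ (lexx _) cl 1); rewrite (arc1 ac) => -[dy].
rewrite lt_min => /andP[_ yd]; have [|z' [dz' Uz1] zE] := Hd (phi y).
  by rewrite -ball_normE /= distrC.
by rewrite -(chartK dy) -zE chartK //; exact: interior_subset Uz1.
Qed.

Lemma dist_eq0 x y : riemannian_dist x y = 0 -> x = y.
Proof.
move=> d0; apply: contrapT => xy.
have /(nbhs_dist (z := x))[e e0 He] : nbhs x (~` [set y]).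
  apply: open_nbhs_nbhs; split => //; rewrite openC.
  apply: accessible_closed_set1; apply: hausdorff_accessible.
  exact: manifold_hausdorff.
by apply: (He y) => //; rewrite d0.
Qed.

Lemma dist_lipschitz x y z :
  `|riemannian_dist x y - riemannian_dist x z| <= riemannian_dist y z.
Proof.
have := dist_triangle aX y x z; have := dist_triangle aX z x y.
rewrite (dist_sym aX z y).
move: (riemannian_dist x y) (riemannian_dist x z) (riemannian_dist y z) => a b c.
by rewrite ler_norml; lra.
Qed.

Lemma dist_continuous x : continuous (riemannian_dist x : X -> R).
Proof.
move=> y; apply/cvgrPdist_lt => e e0.
by apply: filterS (dist_near y e0) => z; apply: le_lt_trans; exact: dist_lipschitz.
Qed.

Lemma ball_open x (r : R) : open (riemannian_ball x r).
Proof.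
rewrite openE => y; rewrite /riemannian_ball /= => yr.
have cd : riemannian_dist x @ y --> riemannian_dist x y by exact: dist_continuous.
by move/cvgr_lt : cd; apply.
Qed.

Lemma locally_compact_dist z : exists2 e : R, 0 < e &
  compact [set y | riemannian_dist z y <= e].
Proof.
have [phi [r [lo [hi [cb dz]]]]] := ex_ball_around z.
have [aphi r0 lo0 hi0 B] := cb.
pose Kr := cinv phi @` [set v : 'rV[R]_n | `|v - phi z| <= r].
have cK : compact Kr.
  apply: continuous_compact.
    apply: continuous_in_subspaceT => v /[!inE] /B[[z' dz' <-] _].
    by apply: cinv_continuous; rewrite inE; exists z'.
  apply: bounded_closed_compact.
    exists (r + `|phi z|); split => [|M M1 v /= Sv]; first by rewrite num_real.
    rewrite -(subrK (phi z) v); apply: le_trans (ler_normD _ _) _.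
    by apply/ltW/(le_lt_trans _ M1); rewrite lerD2r.
  apply: (@preimage_closed _ _ (fun v : 'rV[R]_n => `|v - phi z|) [set t : R | t <= r]).
    move=> v _; apply: continuous_comp; last exact: norm_continuous.
    by apply: (@cvgB _ _ _ (nbhs v) _ id (fun=> phi z)); [exact: cvg_id | exact: cvg_cst].
  exact: closed_le.
exists (lo * (r / 2)); first by rewrite mulr_gt0 // divr_gt0.
apply: subclosed_compact cK _.
  apply: (@preimage_closed _ _ (riemannian_dist z) [set t : R | t <= lo * (r / 2)]).
    by move=> v _; exact: dist_continuous.
  exact: closed_le.
move=> y /= dy; have r2 : r / 2 < r by rewrite ltr_pdivrMr // ltr_pMr // ltr1n.
have /(dist_lt_length aX)[c ac cl] : riemannian_dist z y < lo * r.
  by apply: le_lt_trans dy _; rewrite ltr_pM2l.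
have := short_arc_in_ball (rho' := 0) cb ac (lexx r) dz _ r0.
rewrite subrr normr0 subr0 => /(_ (lexx _) cl 1); rewrite (arc1 ac) => -[dy' yr].
by exists (phi y); [exact: ltW | rewrite chartK].
Qed.

End DistanceTopology.

(** * A two-point boundary value problem *)

Section VectorPrimitive.
Context {R : realType} {n : nat}.
Implicit Types (f g F G : R -> 'rV[R]_n) (s : R).

Definition vprim f s : 'rV[R]_n := \row_i prim (fun u => f u 0 i) s.

Let coord_cont f i : continuous f -> continuous (fun u => f u 0 i).
Proof.
move=> cf s.
exact: (cvg_comp _ (fun M : 'rV[R]_n => M 0 i) (cf s) (@coord_continuous _ _ _ 0 i (f s))).
Qed.

Lemma vprim0 f : continuous f -> vprim f 0 = 0.
Proof. by move=> cf; apply/rowP => i; rewrite !mxE prim0 //; exact: coord_cont. Qed.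

Lemma is_derive_vprim f s : continuous f -> is_derive s 1 (vprim f) (f s).
Proof.
move=> cf; apply/is_derive_rVP => i.
have -> : (fun u => vprim f u 0 i) = prim (fun u => f u 0 i).
  by apply/funext => u; rewrite mxE.
by apply: is_derive_prim; exact: coord_cont.
Qed.

Lemma continuous_vprim f : continuous f -> continuous (vprim f).
Proof. by move=> cf s; exact/is_derive_continuous/is_derive_vprim. Qed.

Lemma vprim_dist f g (m s : R) : continuous f -> continuous g ->
  (forall u, -1 <= u <= 2 -> `|f u - g u| <= m) -> -1 <= s <= 2 ->
  `|vprim f s - vprim g s| <= 2 * m.
Proof.
move=> cf cg fg /andP[s1 s2].
have m0 : 0 <= m.
  by apply: le_trans (normr_ge0 _) (fg 0 _); apply/andP; split; lra.
have d (u : R) : is_derive u 1 (vprim f - vprim g) (f u - g u).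
  by apply: is_deriveB; exact: is_derive_vprim.
have dm (u : R) := is_derive_mulr m u.
have E : (vprim f - vprim g) 0 = 0 by rewrite !fctE !vprim0 // subrr.
have [s0|s0] := leP 0 s.
  have := rV_increment_le s0 (fun u _ => d u) (fun u _ => dm u).
  rewrite E subr0 => /(_ _)/le_trans; apply => [u|]; last by nra.
  by rewrite in_itv /= => /andP[u1 u2]; apply: fg; apply/andP; split; lra.
have := rV_increment_le (ltW s0) (fun u _ => d u) (fun u _ => dm u).
rewrite E add0r normrN => /(_ _)/le_trans; apply => [u|]; last by nra.
by rewrite in_itv /= => /andP[u1 u2]; apply: fg; apply/andP; split; lra.
Qed.

Lemma geometric_limit (x : nat -> 'rV[R]_n) (m : R) : 0 <= m ->
  (forall k, `|x k.+1 - x k| <= m / 2 ^+ k) ->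
  exists l, forall k, `|l - x k| <= 2 * m / 2 ^+ k.
Proof.
move=> m0 H.
have p0 k : 0 < 2 ^+ k :> R by rewrite exprn_gt0.
have H2 k j : `|x (k + j)%N - x k| <= 2 * m / 2 ^+ k - 2 * m / 2 ^+ (k + j).
  elim: j => [|j IH]; first by rewrite addn0 !subrr normr0.
  have -> : x (k + j.+1)%N - x k = (x (k + j).+1 - x (k + j)%N) + (x (k + j)%N - x k).
    by rewrite addnS addrA subrK.
  apply: le_trans (ler_normD _ _) _; have := H (k + j)%N.
  have -> : 2 * m / 2 ^+ (k + j.+1) = m / 2 ^+ (k + j).
    by rewrite addnS exprS; field; rewrite gt_eqF.
  by move: IH; rewrite -[2 * m / 2 ^+ (k + j)]mulrA; lra.
have H3 k j : (k <= j)%N -> `|x j - x k| <= 2 * m / 2 ^+ k.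
  move=> kj; rewrite -(subnKC kj); apply: le_trans (H2 _ _) _.
  by rewrite lerBlDr lerDl divr_ge0 ?mulr_ge0 // ltW.
have small (e : R) : 0 < e -> \forall k \near \oo, 2 * m / 2 ^+ k < e.
  move=> e0; have : (2 * m) * 2^-1 ^+ k @[k --> \oo] --> 2 * m * 0.
    apply: cvgMl_tmp; apply: cvg_expr; rewrite ger0_norm ?invr_ge0 //.
    by rewrite invf_lt1 // ltr1n.
  rewrite mulr0 => /cvgr_lt/(_ e e0); apply: filterS => k.
  by rewrite exprVn.
have cx : cvgn x.
  apply/cauchy_cvgP/cauchy_exP => e e0.
  have [N _ HN] := small e e0; exists (x N), N => // j Nj.
  have HN' : 2 * m / 2 ^+ N < e := HN N (leqnn N).
  by rewrite -ball_normE /= distrC; apply: le_lt_trans HN'; exact: H3.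
exists (lim (x @ \oo)) => k; apply: contrapT => /negP; rewrite -ltNge => lt_k.
have : \forall j \near \oo, `|lim (x @ \oo) - x j| < `|lim (x @ \oo) - x k| - 2 * m / 2 ^+ k.
  by move/cvgrPdist_lt : cx; apply; rewrite subr_gt0.
move=> [N _ HN]; have := HN (maxn N k) (leq_maxl _ _).
have := H3 k (maxn N k) (leq_maxr _ _).
have := ler_normD (lim (x @ \oo) - x (maxn N k)) (x (maxn N k) - x k).
by rewrite addrA subrK /=; lra.
Qed.

End VectorPrimitive.

Section BoundaryValue.
Context {R : realType} {n : nat}.
(* Q is the acceleration as a function of position and velocity; it is
   quadratic in the velocity, whence the shape of the bounds *)
Variables (Q : 'rV[R]_n -> 'rV[R]_n -> 'rV[R]_n) (p : 'rV[R]_n) (r L : R).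
Hypotheses (r_gt0 : 0 < r) (L_gt0 : 0 < L).
Hypothesis Q_le : forall v a, `|v - p| <= r -> `|Q v a| <= L * `|a| ^+ 2.
Hypothesis Q_lip : forall v w a b, `|v - p| <= r -> `|w - p| <= r ->
  `|Q v a - Q w b| <= L * (`|v - w| * `|a| ^+ 2 + `|a - b| * (`|a| + `|b|)).

(* The acceleration is only controlled on [-1, 2]; evaluating it there at the
   nearest point lets the iteration act on functions of the whole line. *)
Let cl (s : R) : R := clamp ((s + 1) * 3^-1) * 3 - 1.

Let cl_itv s : -1 <= cl s <= 2.
Proof.
by have /andP[] := clamp_itv ((s + 1) * 3^-1); rewrite /cl; move: clamp => c; lra.
Qed.

Let cl_id s : -1 <= s <= 2 -> cl s = s.
Proof.
move=> /andP[s1 s2]; rewrite /cl clamp_id; first by lra.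
by apply/andP; split; lra.
Qed.

Let cl_cont : continuous cl.
Proof.
have c1 : continuous (fun s : R => (s + 1) * 3^-1).
  move=> u; apply: cvgMr_tmp; apply: cvgD; [exact: cvg_id | exact: cvg_cst].
move=> u; apply: cvgB; last exact: cvg_cst.
apply: cvgMr_tmp; apply: (@continuous_comp _ _ _ (fun s : R => (s + 1) * 3^-1) clamp).
  exact: c1.
exact: clamp_continuous.
Qed.

Section Fixed.
Variables (a b : 'rV[R]_n).
Let d := `|b - a|.
(* The velocities stay below 7 d and differ by at most 6 m when the
   accelerations differ by m, the positions by 12 m; the resulting Lipschitz
   factor L (12 (7 d)^2 + 6 (14 d)) = L d (588 d + 84) <= 672 L d has to be at
   most 1/2. The positions move by at most 12 d + 2 d from a. *)
Hypotheses (d1 : d <= 1) (Ld : L * d <= 1344^-1) (ra : `|a - p| + 14 * d <= r).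

Let d_ge0 : 0 <= d. Proof. exact: normr_ge0. Qed.

Definition pos (f : R -> 'rV[R]_n) (s : R) : 'rV[R]_n :=
  a + s *: (b - a) + (vprim (vprim f) s - s *: vprim (vprim f) 1).

Definition vel (f : R -> 'rV[R]_n) (s : R) : 'rV[R]_n :=
  b - a + (vprim f s - vprim (vprim f) 1).

Definition accel (f : R -> 'rV[R]_n) (s : R) : 'rV[R]_n :=
  Q (pos f (cl s)) (vel f (cl s)).

Let pos_derive f (s : R) : continuous f -> is_derive s 1 (pos f) (vel f s).
Proof.
move=> cf; apply/is_derive_rVP => i.
have H := is_derive_vprim s (continuous_vprim cf).
have /is_derive_rVP/(_ i) Hi := H.
have E : (fun u => pos f u 0 i) = (fun u => a 0 i + u * (b 0 i - a 0 i) +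
    (vprim (vprim f) u 0 i - u * vprim (vprim f) 1 0 i)).
  by apply/funext => u; rewrite !mxE.
have -> : vel f s 0 i = 0 + (b 0 i - a 0 i) +
    (vprim f s 0 i - vprim (vprim f) 1 0 i).
  by rewrite !mxE add0r.
rewrite E; apply: is_deriveD.
  by apply: is_deriveD; first exact: is_derive_mulr.
by apply: is_deriveB; exact: is_derive_mulr.
Qed.

Let vel_derive f (s : R) : continuous f -> is_derive s 1 (vel f) (f s).
Proof.
move=> cf; have H := is_derive_vprim s cf.
have -> : vel f = cst (b - a) + (vprim f - cst (vprim (vprim f) 1)) by [].
by rewrite -[f s]subr0 -[_ - 0]add0r; apply: is_deriveD; apply: is_deriveB.
Qed.

Let pos_cont f : continuous f -> continuous (pos f).
Proof. by move=> cf s; exact: (is_derive_continuous (pos_derive s cf)). Qed.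

Let vel_cont f : continuous f -> continuous (vel f).
Proof. by move=> cf s; exact: (is_derive_continuous (vel_derive s cf)). Qed.

Let dist_pos_vel f g (m : R) : continuous f -> continuous g ->
  (forall u, `|f u - g u| <= m) -> forall s, -1 <= s <= 2 ->
  `|pos f s - pos g s| <= 12 * m /\ `|vel f s - vel g s| <= 6 * m.
Proof.
move=> cf cg fg s sI; have I1 : -1 <= (1 : R) <= 2 by apply/andP; split; lra.
have P1 u : -1 <= u <= 2 -> `|vprim f u - vprim g u| <= 2 * m.
  by apply: vprim_dist => // v _; exact: fg.
have P2 u : -1 <= u <= 2 ->
    `|vprim (vprim f) u - vprim (vprim g) u| <= 2 * (2 * m).
  by apply: vprim_dist => //; exact: continuous_vprim.
split.
  have -> : pos f s - pos g s = (vprim (vprim f) s - vprim (vprim g) s) -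
      s *: (vprim (vprim f) 1 - vprim (vprim g) 1).
    by apply/rowP => i; rewrite !mxE; ring.
  apply: le_trans (ler_normB _ _) _; rewrite normrZ.
  have := P2 s sI; have := P2 1 I1.
  have : `|s| <= 2 by rewrite ler_norml; move: sI => /andP[]; lra.
  move: (normr_ge0 s) (normr_ge0 (vprim (vprim f) 1 - vprim (vprim g) 1)).
  by move: `|s| `|_| `|_| => x y z; nra.
have -> : vel f s - vel g s = (vprim f s - vprim g s) -
    (vprim (vprim f) 1 - vprim (vprim g) 1).
  by apply/rowP => i; rewrite !mxE; ring.
by apply: le_trans (ler_normB _ _) _; have := P1 s sI; have := P2 1 I1; lra.
Qed.

Let inv (f : R -> 'rV[R]_n) := continuous f /\ forall u, `|f u| <= d.

Let zf : R -> 'rV[R]_n := fun=> 0.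

Let zero_cont : continuous zf.
Proof. by move=> s; exact: cvg_cst. Qed.

Let vprim_zero s : vprim zf s = 0.
Proof.
apply/rowP => i; have c0 : continuous ((fun=> 0) : R -> R) by move=> u; exact: cvg_cst.
have -> : (0 : 'rV[R]_n) 0 i = prim (fun=> 0) 0 by rewrite (prim0 c0) mxE.
have -> : vprim zf s 0 i = prim (fun=> 0) s.
  by rewrite mxE; congr prim; apply/funext => u; rewrite mxE.
have [s0|/ltW s0] := leP s 0.
  by rewrite (increment_cst s0 (fun u _ => is_derive_prim u c0)).
by rewrite (increment_cst s0 (fun u _ => is_derive_prim u c0)).
Qed.

Let pos_vel_bound f s : inv f -> -1 <= s <= 2 ->
  `|pos f s - p| <= r /\ `|vel f s| <= 7 * d.
Proof.
move=> [cf fd] sI.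
have [|A B] := @dist_pos_vel f zf d cf zero_cont _ s sI.
  by move=> u; rewrite subr0.
have s2 : `|s| <= 2 by rewrite ler_norml; move: sI => /andP[]; lra.
have vv : vprim (vprim zf) = zf.
  have -> : vprim zf = zf by apply/funext => u; rewrite vprim_zero.
  by apply/funext => u; rewrite vprim_zero.
split.
  have -> : pos f s - p = (pos f s - pos zf s) + (a - p) + s *: (b - a).
    by rewrite /pos vv; apply/rowP => i; rewrite !mxE; ring.
  apply: le_trans (ler_normD _ _) _; rewrite normrZ -/d.
  have := ler_normD (pos f s - pos zf s) (a - p).
  move: A ra d_ge0 s2 (normr_ge0 s); move: `|_ - _| `|_ - p| `|_ + _| `|s| => *; nra.
have -> : vel f s = (vel f s - vel zf s) + (b - a).
  by rewrite /vel vv vprim_zero; apply/rowP => i; rewrite !mxE; ring.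
by apply: le_trans (ler_normD _ _) _; rewrite -/d; lra.
Qed.

Let Q_cont v w : `|v - p| <= r -> forall e : R, 0 < e ->
  exists2 dd : R, 0 < dd & forall v' w', `|v' - p| <= r -> `|v - v'| < dd ->
    `|w - w'| < dd -> `|Q v w - Q v' w'| < e.
Proof.
move=> vr e e0.
pose N := L * (`|w| ^+ 2 + (2 * `|w| + 1)) + 1.
have N0 : 0 < N.
  by rewrite ltr_wpDl // mulr_ge0 ?(ltW L_gt0) // !addr_ge0 ?sqr_ge0 // mulr_ge0.
exists (Num.min 1 (e / N)); first by rewrite lt_min ltr01 divr_gt0.
move=> v' w' v'r; rewrite !lt_min => /andP[v1 v2] /andP[w1 w2].
apply: le_lt_trans (Q_lip w w' vr v'r) _.
have w'n : `|w'| <= `|w| + 1.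
  have := ler_normB w (w - w'); rewrite opprB addrCA subrr addr0.
  by move: w1; lra.
have eN : e = e / N * N by rewrite divfK // gt_eqF.
rewrite eN; set m := e / N in v2 w2 eN *.
have m0 : 0 < m by rewrite divr_gt0.
apply: (@le_lt_trans _ _ (m * (L * (`|w| ^+ 2 + (2 * `|w| + 1))))); last first.
  by rewrite ltr_pM2l // ltrDl.
rewrite [leRHS]mulrCA ler_pM2l // [leRHS]mulrDr; apply: lerD.
  by apply: ler_wpM2r; [exact: sqr_ge0 | exact: ltW].
by apply: ler_pM; [exact: normr_ge0 | exact: addr_ge0 | exact: ltW | lra].
Qed.

Let accel_cont f : inv f -> continuous (accel f).
Proof.
move=> fI s; have [cf _] := fI; apply/cvgrPdist_lt => e e0.
have [ps vs] := pos_vel_bound fI (cl_itv s).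
have [dd dd0 H] := Q_cont (vel f (cl s)) ps e0.
have c1 : {for s, continuous (pos f \o cl)}.
  by apply: continuous_comp; [exact: cl_cont | exact: pos_cont].
have c2 : {for s, continuous (vel f \o cl)}.
  by apply: continuous_comp; [exact: cl_cont | exact: vel_cont].
have /cvgrPdist_lt/(_ dd dd0) n1 := c1; have /cvgrPdist_lt/(_ dd dd0) n2 := c2.
apply: filterS2 n1 n2 => u u1 u2.
by apply: H => //; have [] := pos_vel_bound fI (cl_itv u).
Qed.

Let accel_inv f : inv f -> inv (accel f).
Proof.
move=> fI; split; first exact: accel_cont.
move=> u; have [pu vu] := pos_vel_bound fI (cl_itv u).
apply: le_trans (Q_le _ pu) _.
apply: (@le_trans _ _ (L * (7 * d) ^+ 2)).
  by apply: ler_wpM2l; [exact: ltW | rewrite lerXn2r // nnegrE // mulr_ge0].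
rewrite exprMn expr2 mulrCA mulrC.
have -> : L * d ^+ 2 * (7 * 7) = (L * d * 49) * d by ring.
have H49 : L * d * 49 <= 1 by move: Ld; move: (L * d) => x; lra.
exact: ler_piMl d_ge0 H49.
Qed.

Let accel_contract f g (m : R) : inv f -> inv g -> (forall u, `|f u - g u| <= m) ->
  forall u, `|accel f u - accel g u| <= m / 2.
Proof.
move=> fI gI fg u; have m0 : 0 <= m by apply: le_trans (normr_ge0 _) (fg 0).
have [pu vu] := pos_vel_bound fI (cl_itv u).
have [pu' vu'] := pos_vel_bound gI (cl_itv u).
have [A B] := dist_pos_vel fI.1 gI.1 fg (cl_itv u).
apply: le_trans (Q_lip _ _ pu pu') _.
apply: (@le_trans _ _ (L * (12 * m * (7 * d) ^+ 2 + 6 * m * (7 * d + 7 * d)))).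
  apply: ler_wpM2l; first exact: ltW.
  apply: lerD; last by apply: ler_pM => //; rewrite ?addr_ge0 // lerD.
  by apply: ler_pM => //; rewrite ?sqr_ge0 // lerXn2r // nnegrE // mulr_ge0.
have -> : L * (12 * m * (7 * d) ^+ 2 + 6 * m * (7 * d + 7 * d)) =
  m * (L * d * (588 * d + 84)) by ring.
apply: ler_wpM2l => //.
have Ld0 : 0 <= L * d by rewrite mulr_ge0 // ltW.
have d84 : 588 * d + 84 <= 672 by move: d1; move: d => x; lra.
have d84' : 0 <= 588 * d + 84 by move: d_ge0; move: d => x; lra.
apply: (@le_trans _ _ (1344^-1 * 672)); last by lra.
exact: ler_pM.
Qed.

(** Integrating an acceleration twice and correcting by an affine function gives
    the motion [pos f] from a to b, with velocity [vel f]; the solution is the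
    fixed point of the contraction f -> Q(pos f, vel f). Its existence up to
    the times -1 and 2, beyond the two end points, is what later extends
    minimal segments. *)
Lemma boundary_value : exists y y' : R -> 'rV[R]_n,
  [/\ y 0 = a, y 1 = b, continuous y', forall s : R, is_derive s 1 y (y' s)
    & forall s : R, -1 <= s <= 2 -> [/\ is_derive s 1 y' (Q (y s) (y' s)),
       `|y s - p| <= r & `|y' s| <= 7 * d]].
Proof.
pose f k := iter k accel zf.
have fI k : inv (f k).
  elim: k => [|k IH]; last exact: accel_inv.
  by split; [exact: zero_cont | move=> u; rewrite normr0].
have step k u : `|f k.+1 u - f k u| <= d / 2 ^+ k.
  elim: k u => [|k IH] u.
    by rewrite expr0 divr1 subr0; have [_] := fI 1%N.
  have := accel_contract (fI k.+1) (fI k) IH u.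
  by rewrite -mulrA -invfM -exprSr.
have /choice[F HF] : forall u, exists l, forall k, `|l - f k u| <= 2 * d / 2 ^+ k.
  by move=> u; apply: geometric_limit => // k; exact: step.
have small (e : R) : 0 < e -> exists k, 2 * d / 2 ^+ k < e.
  move=> e0; have [k _ Hk] : \forall k \near \oo, 2 * d / 2 ^+ k < e.
    have : (2 * d) * 2^-1 ^+ k @[k --> \oo] --> 2 * d * 0.
      apply: cvgMl_tmp; apply: cvg_expr; rewrite ger0_norm ?invr_ge0 //.
      by rewrite invf_lt1 // ltr1n.
    rewrite mulr0 => /cvgr_lt/(_ e e0); apply: filterS => k.
    by rewrite exprVn.
  by exists k; apply: Hk => /=.
have cF : continuous F.
  move=> s; apply/cvgrPdist_lt => e e0.
  have e3 : 0 < e / 3 by rewrite divr_gt0.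
  have [k Hk] := small _ e3.
  have /cvgrPdist_lt/(_ _ e3) := (fI k).1 s; apply: filterS => u su.
  have := HF s k; have := HF u k; rewrite [`|F u - _|]distrC.
  have := ler_normD (F s - f k s) (f k s - f k u).
  have := ler_normD ((F s - f k s) + (f k s - f k u)) (f k u - F u).
  by rewrite !addrA !subrK; lra.
have FI : inv F.
  split => // u; apply/ler_addgt0Pr => e e0; have [k Hk] := small e e0.
  have := ler_normD (F u - f k u) (f k u); rewrite subrK.
  by have := HF u k; have [_ /(_ u)] := fI k; lra.
have FE u : accel F u = F u.
  apply/eqP; rewrite -subr_eq0 -normr_le0; apply/ler_addgt0Pr => e e0; rewrite add0r.
  have [k Hk] := small _ (divr_gt0 e0 (ltr0n R 2)).
  have := accel_contract FI (fI k) (fun v => HF v k) u.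
  have H1 := HF u k.+1; rewrite distrC in H1.
  have := ler_normD (accel F u - f k.+1 u) (f k.+1 u - F u); rewrite addrA subrK.
  have : 2 * d / 2 ^+ k.+1 <= 2 * d / 2 ^+ k.
    rewrite ler_wpM2l ?mulr_ge0 //.
    by rewrite lef_pV2 ?posrE ?exprn_gt0 // ler_eXn2l ?ltr1n.
  rewrite /f /=; lra.
have cl0 : -1 <= (0 : R) <= 2 by apply/andP; split; lra.
exists (pos F), (vel F); split.
- by rewrite /pos scale0r addr0 scale0r subr0 (vprim0 (continuous_vprim cF)) addr0.
- by rewrite /pos !scale1r subrr addr0 subrKC.
- exact: vel_cont.
- by move=> s; exact: pos_derive.
move=> s sI; have [A B] := pos_vel_bound FI sI; split => //.
have -> : Q (pos F s) (vel F s) = F s by rewrite -FE /accel cl_id.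
exact: vel_derive.
Qed.

End Fixed.
End BoundaryValue.

(** * The geodesic equation in a chart *)

Section MatrixNorm.
Context {R : realType}.

Lemma mulmx_norm_le2 m k l (A : 'M[R]_(m, k)) (B : 'M[R]_(k, l)) :
  `|A *m B| <= k%:R * `|A| * `|B|.
Proof.
apply: norm_mx_le => [|i j]; first by rewrite !mulr_ge0.
rewrite mxE; apply: le_trans (ler_norm_sum _ _ _) _.
apply: (@le_trans _ _ (\sum_(h < k) `|A| * `|B|)).
  apply: ler_sum => h _; rewrite normrM.
  by apply: ler_pM => //; exact: entry_norm_le.
by rewrite sumr_const card_ord -mulrA mulr_natl.
Qed.

Lemma trmx_norm m k (A : 'M[R]_(m, k)) : `|A^T| = `|A|.
Proof.
suff H m' k' (B : 'M[R]_(m', k')) : `|B^T| <= `|B|.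
  by apply/eqP; rewrite eq_le H -[in leLHS](trmxK A) H.
by apply: norm_mx_le => // i j; rewrite mxE; exact: entry_norm_le.
Qed.

Lemma invmx_sub n (A B : 'M[R]_n) : A \in unitmx -> B \in unitmx ->
  invmx A - invmx B = invmx A *m (B - A) *m invmx B.
Proof.
move=> uA uB; rewrite mulmxBr mulmxBl mulVmx // mul1mx -mulmxA mulmxV // mulmx1.
by [].
Qed.

(** A positive form bounded below is invertible, with a bound on the inverse. *)
Lemma invmx_norm_le n (A : 'M[R]_n) (m : R) : 0 < m ->
  (forall w, m * `|w| ^+ 2 <= inner A w w) ->
  A \in unitmx /\ `|invmx A| <= n%:R / m.
Proof.
move=> m0 Am.
have bnd (w : 'rV[R]_n) : m * `|w| <= n%:R * `|w *m A|.
  have [->|w0] := eqVneq w 0; first by rewrite normr0 mulr0 mulr_ge0.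
  have wp : 0 < `|w| by rewrite normr_gt0.
  rewrite -(ler_pM2r wp) -mulrA -expr2; apply: le_trans (Am w) _.
  rewrite /inner; apply: le_trans (ler_norm _) _.
  apply: le_trans (entry_norm_le _ _ _) _; apply: le_trans (mulmx_norm_le2 _ _) _.
  by rewrite trmx_norm.
have uA : A \in unitmx.
  rewrite -row_free_unit; apply/row_freeP.
  have: kermx A = 0.
    apply/row_matrixP => i; rewrite row0; apply/eqP; rewrite -normr_le0.
    rewrite -(pmulr_rle0 _ m0); apply: le_trans (bnd _) _.
    by rewrite -row_mul mulmx_ker row0 normr0 mulr0.
  by move/eqP; rewrite kermx_eq0 => /row_freeP.
split => //; apply: norm_mx_le => [|i j]; first by rewrite divr_ge0 // ltW.
have := bnd (row i (invmx A)); rewrite -row_mul mulVmx // => H.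
apply: (@le_trans _ _ `|row i (invmx A)|).
  by have := coord_norm_le (row i (invmx A)) j; rewrite mxE.
rewrite ler_pdivlMr // mulrC; apply: le_trans H _.
rewrite -[leRHS]mulr1; apply: ler_wpM2l => //.
by apply: norm_rV_le => // k; rewrite !mxE; case: (i == k); rewrite ?normr1 ?normr0.
Qed.

End MatrixNorm.

Section Acceleration.
Context {R : realType} {n : nat}.
Implicit Types (D : 'I_n -> 'M[R]_n) (a b v w : 'rV[R]_n).

(** For a = b these are the Christoffel symbols with lowered index, applied to
    the velocity a twice: along a geodesic, y'' g = - lower_gamma y' y'. The
    expression is bilinear, which makes differences easy to estimate. *)
Definition lower_gamma D a b : 'rV[R]_n :=
  a *m (\sum_i b 0 i *: D i) - 2^-1 *: \row_l inner (D l) a b.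

Lemma lower_gamma_norm_le D a b (m : R) : 0 <= m -> (forall i, `|D i| <= m) ->
  `|lower_gamma D a b| <= 2 * n%:R ^+ 2 * m * `|a| * `|b|.
Proof.
move=> m0 Dm; have n2 : 0 <= n%:R ^+ 2 * m * `|a| * `|b| by rewrite !mulr_ge0 ?sqr_ge0.
have -> : 2 * n%:R ^+ 2 * m * `|a| * `|b| = n%:R ^+ 2 * m * `|a| * `|b| +
    n%:R ^+ 2 * m * `|a| * `|b| by ring.
apply: le_trans (ler_normB _ _) _; apply: lerD.
  apply: le_trans (mulmx_norm_le2 _ _) _.
  have -> : n%:R ^+ 2 * m * `|a| * `|b| = n%:R * `|a| * (n%:R * (`|b| * m)) by ring.
  apply: ler_wpM2l; first by rewrite mulr_ge0.
  apply: le_trans (ler_norm_sum _ _ _) _.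
  apply: (@le_trans _ _ (\sum_(i < n) `|b| * m)).
    apply: ler_sum => i _; rewrite normrZ; apply: ler_pM => //.
    exact: coord_norm_le.
  by rewrite sumr_const card_ord mulr_natl.
rewrite normrZ ger0_norm ?invr_ge0 //.
apply: (@le_trans _ _ (2^-1 * (n%:R ^+ 2 * m * `|a| * `|b|))); last by lra.
apply: ler_wpM2l; first by rewrite invr_ge0.
apply: norm_rV_le => // l; rewrite mxE; apply: le_trans (inner_norm_le _ _ _) _.
do 2!apply: ler_wpM2r => //; apply: ler_wpM2l; first exact: sqr_ge0.
exact: Dm.
Qed.

Lemma lower_gammaBD D D' a b :
  lower_gamma D a b - lower_gamma D' a b = lower_gamma (fun i => D i - D' i) a b.
Proof.
rewrite /lower_gamma opprB addrACA -[in RHS]scalerN.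
have -> : \sum_i b 0 i *: (D i - D' i) = \sum_i b 0 i *: D i - \sum_i b 0 i *: D' i.
  by rewrite -sumrB; apply: eq_bigr => i _; rewrite scalerBr.
rewrite mulmxBr; apply/rowP => l; rewrite !mxE.
have -> : inner (D l - D' l) a b = inner (D l) a b - inner (D' l) a b.
  by rewrite /inner mulmxBr mulmxBl !mxE.
by ring.
Qed.

Lemma lower_gammaBv D a b :
  lower_gamma D a a - lower_gamma D b b =
  lower_gamma D (a - b) a + lower_gamma D b (a - b).
Proof.
rewrite /lower_gamma mulmxBl.
have -> : \sum_i (a - b) 0 i *: D i = \sum_i a 0 i *: D i - \sum_i b 0 i *: D i.
  by rewrite -sumrB; apply: eq_bigr => i _; rewrite !mxE scalerBl.
rewrite mulmxBr; apply/rowP => l; rewrite !mxE.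
have -> : inner (D l) (a - b) a = inner (D l) a a - inner (D l) b a.
  by rewrite /inner !mulmxBl !mxE.
have -> : inner (D l) b (a - b) = inner (D l) b a - inner (D l) b b.
  by rewrite /inner linearB /= mulmxBr !mxE.
by ring.
Qed.

Definition metric_derive (g : 'rV[R]_n -> 'M[R]_n) (v : 'rV[R]_n) (i : 'I_n) :
  'M[R]_n := 'D_(delta_mx 0 i) g v.

Definition geodesic_acceleration (g : 'rV[R]_n -> 'M[R]_n) v a : 'rV[R]_n :=
  - (lower_gamma (metric_derive g v) a a *m (invmx (g v))^T).

Lemma christoffel_acceleration (g : 'rV[R]_n -> 'M[R]_n) v a k :
  (forall i, derivable g v (delta_mx 0 i)) ->
  \sum_(i < n) \sum_(j < n) christoffel g k i j v * a 0 i * a 0 j =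
  - geodesic_acceleration g v a 0 k.
Proof.
move=> dg; rewrite /geodesic_acceleration [in RHS]mxE opprK [in RHS]mxE.
set D := metric_derive g v; set H := invmx (g v).
have pE i j l : partial i (fun y => g y j l) v = D i j l.
  by rewrite /partial derive_coord.
have lE l : lower_gamma D a a 0 l = \sum_i \sum_j a 0 i * a 0 j * D i j l -
    2^-1 * \sum_i \sum_j a 0 i * a 0 j * D l i j.
  rewrite /lower_gamma !mxE; congr (_ - _).
    rewrite exchange_big; apply: eq_bigr => j _; rewrite summxE mulr_sumr.
    by apply: eq_bigr => i _; rewrite mxE; ring.
  rewrite innerE exchange_big; congr (_ * _); apply: eq_bigr => i _.
  by apply: eq_bigr => j _; ring.
under [RHS]eq_bigr => l _ do rewrite lE mxE.
transitivity (\sum_l H k l * (\sum_i \sum_j 2^-1 * (a 0 i * a 0 j * D i j l) +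
    \sum_i \sum_j 2^-1 * (a 0 i * a 0 j * D j i l) -
    \sum_i \sum_j 2^-1 * (a 0 i * a 0 j * D l i j))).
  transitivity (\sum_i \sum_j \sum_l H k l * (2^-1 * (a 0 i * a 0 j * D i j l) +
      2^-1 * (a 0 i * a 0 j * D j i l) - 2^-1 * (a 0 i * a 0 j * D l i j))).
    apply: eq_bigr => i _; apply: eq_bigr => j _.
    rewrite /christoffel -/H -mulrA -mulrA [LHS]mulrA mulr_sumr mulr_suml.
    by apply: eq_bigr => l _; rewrite !pE; ring.
  under eq_bigr => i _ do rewrite exchange_big.
  rewrite exchange_big; apply: eq_bigr => l _.
  rewrite -big_split -sumrB mulr_sumr; apply: eq_bigr => i _ /=.
  by rewrite -big_split -sumrB mulr_sumr.
apply: eq_bigr => l _; rewrite [RHS]mulrC; congr (_ * _).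
have -> : \sum_i \sum_j 2^-1 * (a 0 i * a 0 j * D j i l) =
    \sum_i \sum_j 2^-1 * (a 0 i * a 0 j * D i j l).
  rewrite exchange_big; apply: eq_bigr => i _; apply: eq_bigr => j _.
  by rewrite [a 0 j * _]mulrC.
congr (_ - _); last first.
  by rewrite mulr_sumr; apply: eq_bigr => i _; rewrite mulr_sumr.
rewrite -big_split; apply: eq_bigr => i _ /=; rewrite -big_split.
by apply: eq_bigr => j _ /=; lra.
Qed.

(** All that is needed of the metric near a point: the Lipschitz bounds serve to
    solve the geodesic equation, the second-order Taylor estimate to compare
    energies of nearby curves. *)
Definition metric_bounds (g : 'rV[R]_n -> 'M[R]_n) (p : 'rV[R]_n) (r lo C : R) :=
  [/\ forall v, `|v - p| <= r -> [/\ (g v)^T = g v, `|g v| <= C,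
       forall i, `|metric_derive g v i| <= C
     & strict_diff g v (fun h => \sum_i h 0 i *: metric_derive g v i)],
    forall v, `|v - p| <= r -> forall w, (lo * `|w|) ^+ 2 <= inner (g v) w w
   & forall v w, `|v - p| <= r -> `|w - p| <= r ->
     [/\ `|g w - g v| <= C * `|w - v|,
       forall i, `|metric_derive g w i - metric_derive g v i| <= C * `|w - v|
     & `|g w - g v - \sum_i (w - v) 0 i *: metric_derive g v i| <=
       C * `|w - v| ^+ 2]].

Section Bounds.
Variables (g : 'rV[R]_n -> 'M[R]_n) (p : 'rV[R]_n) (r lo C : R).
Hypotheses (lo0 : 0 < lo) (C0 : 0 < C) (gb : metric_bounds g p r lo C).

Let unit_inv v : `|v - p| <= r ->
  g v \in unitmx /\ `|invmx (g v)| <= n%:R / lo ^+ 2.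
Proof.
move=> vr; have [_ low _] := gb; apply: invmx_norm_le; first by rewrite exprn_gt0.
by move=> w; rewrite -exprMn; exact: low.
Qed.

Let I := n%:R / lo ^+ 2.
Let I0 : 0 <= I. Proof. by rewrite divr_ge0 // sqr_ge0. Qed.
Let B := 2 * n%:R ^+ 2 * C.
Let B0 : 0 <= B. Proof. by rewrite !mulr_ge0 ?sqr_ge0 // ltW. Qed.

Lemma acceleration_metric v a : `|v - p| <= r ->
  geodesic_acceleration g v a *m g v = - lower_gamma (metric_derive g v) a a.
Proof.
move=> vr; have [H _ _] := gb; have [gT _ _ _] := H v vr.
have [ug _] := unit_inv vr; rewrite /geodesic_acceleration mulNmx -mulmxA.
by rewrite trmx_inv gT mulVmx // mulmx1.
Qed.

Let acc_const := 1 + (n%:R * I * B + n%:R * (n%:R * I * (n%:R * C * I)) * B).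

Let gamma_le v a : `|v - p| <= r ->
  `|lower_gamma (metric_derive g v) a a| <= B * `|a| ^+ 2.
Proof.
move=> vr; have [H _ _] := gb; have [_ _ Dc _] := H v vr.
apply: le_trans (lower_gamma_norm_le a a (ltW C0) Dc) _.
by rewrite /B expr2 !mulrA.
Qed.

(** The growth and Lipschitz conditions required by the boundary value problem:
    the geodesic acceleration is a quadratic form in the velocity whose
    coefficients are Lipschitz in the position. *)
Lemma acceleration_bounds : exists2 L : R, 0 < L &
  (forall v a, `|v - p| <= r -> `|geodesic_acceleration g v a| <= L * `|a| ^+ 2) /\
  forall v w a b, `|v - p| <= r -> `|w - p| <= r ->
    `|geodesic_acceleration g v a - geodesic_acceleration g w b| <=
    L * (`|v - w| * `|a| ^+ 2 + `|a - b| * (`|a| + `|b|)).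
Proof.
have nI0 : 0 <= n%:R * I by rewrite mulr_ge0.
have nB0 : 0 <= n%:R * I * B by rewrite mulr_ge0.
have C0' : 0 <= C by exact: ltW.
have nC0 : 0 <= n%:R * C * I by rewrite mulr_ge0 // mulr_ge0.
have M0 : 0 <= n%:R * (n%:R * I * (n%:R * C * I)) * B by rewrite mulr_ge0 // mulr_ge0 // mulr_ge0.
exists acc_const; first by rewrite /acc_const ltr_wpDr // addr_ge0.
split=> [v a vr|v w a b vr wr].
  rewrite normrN; apply: le_trans (mulmx_norm_le2 _ _) _; rewrite trmx_norm.
  apply: (@le_trans _ _ (n%:R * (B * `|a| ^+ 2) * I)).
    apply: ler_pM; rewrite ?mulr_ge0 //; last by have [] := unit_inv vr.
    by apply: ler_wpM2l => //; exact: gamma_le.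
  have -> : n%:R * (B * `|a| ^+ 2) * I = n%:R * I * B * `|a| ^+ 2 by ring.
  apply: ler_wpM2r; first exact: sqr_ge0.
  by rewrite /acc_const; lra.
set la := lower_gamma (metric_derive g v) a a.
set lb := lower_gamma (metric_derive g w) b b.
set la' := lower_gamma (metric_derive g w) a a.
set Iv := (invmx (g v))^T; set Iw := (invmx (g w))^T.
have E : geodesic_acceleration g v a - geodesic_acceleration g w b =
    - (((la - la') + (la' - lb)) *m Iw + la *m (Iv - Iw)).
  rewrite addrA subrK mulmxBl mulmxBr addrCA addrC.
  rewrite /geodesic_acceleration -/la -/lb -/Iv -/Iw.
  move: (la *m Iw) (lb *m Iw) (la *m Iv) => x y z.
  by apply/rowP => k; rewrite !mxE; ring.
have [_ iv] := unit_inv vr; have [uw iw] := unit_inv wr; have [uv _] := unit_inv vr.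
have [H1 _ H2] := gb; have [gwv dvw _] := H2 w v wr vr.
have [_ _ Dw _] := H1 w wr.
have K1 : `|la - la'| <= B * (`|v - w| * `|a| ^+ 2).
  rewrite /la /la' lower_gammaBD.
  have Cvw : 0 <= C * `|v - w| by rewrite mulr_ge0 // ltW.
  apply: le_trans (lower_gamma_norm_le _ _ Cvw dvw) _.
  by rewrite le_eqVlt; apply/orP; left; apply/eqP; rewrite /B; ring.
have K2 : `|la' - lb| <= B * (`|a - b| * (`|a| + `|b|)).
  rewrite /la' /lb lower_gammaBv; apply: le_trans (ler_normD _ _) _.
  have := lower_gamma_norm_le (a - b) a (ltW C0) Dw.
  have := lower_gamma_norm_le b (a - b) (ltW C0) Dw; rewrite -/B.
  have -> : B * (`|a - b| * (`|a| + `|b|)) = B * `|a - b| * `|a| + B * `|b| * `|a - b|.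
    by ring.
  by rewrite addrC => *; apply: lerD.
have K3 : `|Iv - Iw| <= n%:R * (n%:R * I * (C * `|v - w|)) * I.
  have -> : Iv - Iw = (invmx (g v) - invmx (g w))^T by rewrite linearB.
  rewrite trmx_norm invmx_sub //.
  apply: le_trans (mulmx_norm_le2 _ _) _.
  apply: ler_pM => //; rewrite ?mulr_ge0 //.
  apply: ler_wpM2l => //; apply: le_trans (mulmx_norm_le2 _ _) _.
  by apply: ler_pM => //; rewrite ?mulr_ge0 // ?ler_wpM2l // distrC gwv.
rewrite E normrN; apply: le_trans (ler_normD _ _) _.
have T1 : `|(la - la' + (la' - lb)) *m Iw| <=
    n%:R * I * B * (`|v - w| * `|a| ^+ 2 + `|a - b| * (`|a| + `|b|)).
  apply: le_trans (mulmx_norm_le2 _ _) _; rewrite trmx_norm.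
  apply: (@le_trans _ _ (n%:R * (B * (`|v - w| * `|a| ^+ 2) +
      B * (`|a - b| * (`|a| + `|b|))) * I)).
    apply: ler_pM => //; rewrite ?mulr_ge0 //; apply: ler_wpM2l => //.
    by apply: le_trans (ler_normD _ _) _; exact: lerD.
  by rewrite le_eqVlt; apply/orP; left; apply/eqP; ring.
have T2 : `|la *m (Iv - Iw)| <=
    n%:R * (n%:R * I * (n%:R * C * I)) * B * (`|v - w| * `|a| ^+ 2).
  apply: le_trans (mulmx_norm_le2 _ _) _.
  apply: (@le_trans _ _ (n%:R * (B * `|a| ^+ 2) *
      (n%:R * (n%:R * I * (C * `|v - w|)) * I))).
    apply: ler_pM => //; rewrite ?mulr_ge0 //; apply: ler_wpM2l => //.
    exact: gamma_le.
  by rewrite le_eqVlt; apply/orP; left; apply/eqP; ring.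
have x0 : 0 <= `|v - w| * `|a| ^+ 2 by rewrite mulr_ge0 ?sqr_ge0.
have y0 : 0 <= `|a - b| * (`|a| + `|b|) by rewrite mulr_ge0 // addr_ge0.
move: T1 T2 x0 y0; rewrite /acc_const.
move: (`|v - w| * `|a| ^+ 2) (`|a - b| * (`|a| + `|b|)) => x y.
move: (n%:R * I * B) nB0 (n%:R * (n%:R * I * (n%:R * C * I)) * B) M0 => P P0 S S0.
by move: `|_ *m Iw| `|la *m _| => t1 t2; nra.
Qed.

End Bounds.
End Acceleration.

Lemma le_sum_term {R : realType} (I : finType) (F : I -> R) i :
  (forall j, 0 <= F j) -> F i <= \sum_j F j.
Proof. by move=> F0; rewrite (bigD1 i) //= lerDl sumr_ge0. Qed.

Section ChartMetricBounds.
Context {R : realType} {n : nat} {X : riemannianManifold R n}.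

(** Near the point the first two derivatives of the metric are bounded by
    continuity; the mean value estimate along the coordinates turns the bounds
    into Lipschitz and Taylor estimates. *)
Lemma ex_metric_bounds (phi : @chart R n X) (x : X) : atlas phi -> cdom phi x ->
  exists r lo hi C, [/\ coordinate_ball phi (phi x) r lo hi, 0 < C
    & metric_bounds (metric phi) (phi x) r lo C].
Proof.
move=> aphi dx; have [r [lo [hi cb]]] := ex_coordinate_ball aphi dx.
have [_ r0 lo0 hi0 B] := cb; set g := metric phi; set p := phi x.
pose U := phi @` cdom phi.
have oU : open U by exact: crange_open.
have gU : smooth_on U g by exact: metric_smooth.
have inU v : `|v - p| <= r -> U v by move=> /B[[z dz zE] _]; exists z.
have Up : U p by exists x.
pose e_ (i : 'I_n) : 'rV[R]_n := delta_mx 0 i.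
have loc (f : 'rV[R]_n -> 'M[R]_n) : {for p, continuous f} ->
    \forall v \near p, `|f v| <= `|f p| + 1.
  move=> cf; move/cvgrPdist_le/(_ 1 ltr01) : cf; apply: filterS => v fv.
  rewrite -lerBlDl; apply: le_trans (lerB_dist _ _) _.
  by rewrite distrC.
pose M0 : R := `|g p| + 1.
pose M1 : R := \sum_i (`|metric_derive g p i| + 1).
pose M2 : R := \sum_i \sum_j (`|'D_(e_ j) ('D_(e_ i) g) p| + 1).
have H : \forall v \near p, `|g v| <= M0 /\
   (forall i, `|metric_derive g v i| <= M1) /\
   (forall i j, `|'D_(e_ j) ('D_(e_ i) g) v| <= M2).
  apply: filterI.
    by apply: loc; exact: smooth_on_continuous gU _ Up.
  apply: filterI.
    apply: (@filter_forall _ _ (fun i v => `|metric_derive g v i| <= M1) (nbhs p)) => i.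
    have := loc ('D_(e_ i) g)
      (smooth_on_continuous (smooth_on_derive gU (e_ i)) Up).
    apply: filterS => v /le_trans; apply.
    apply: (le_sum_term (F := fun i => `|metric_derive g p i| + 1)) => k.
    by rewrite addr_ge0.
  apply: (@filter_forall _ _ (fun i v => forall j,
    `|'D_(e_ j) ('D_(e_ i) g) v| <= M2) (nbhs p)) => i.
  apply: (@filter_forall _ _ (fun j v =>
    `|'D_(e_ j) ('D_(e_ i) g) v| <= M2) (nbhs p)) => j.
  have := loc ('D_(e_ j) ('D_(e_ i) g)) (smooth_on_continuous
    (smooth_on_derive (smooth_on_derive gU (e_ i)) (e_ j)) Up).
  apply: filterS => v /le_trans; apply.
  pose F i := \sum_j (`|'D_(e_ j) ('D_(e_ i) g) p| + 1) : R.
  apply: (@le_trans _ _ (F i)).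
    apply: (le_sum_term (F := fun j => `|'D_(e_ j) ('D_(e_ i) g) p| + 1)) => k.
    by rewrite addr_ge0.
  apply: (le_sum_term (F := F)) => k.
  by rewrite /F sumr_ge0 // => l _; rewrite addr_ge0.
have /nbhs_ballP[d /= d0 Hd] := H.
have M00 : 0 <= M0 by rewrite addr_ge0.
have M10 : 0 <= M1 by rewrite sumr_ge0 // => i _; rewrite addr_ge0.
have M20 : 0 <= M2.
  apply: sumr_ge0 => i _; apply: sumr_ge0 => j _.
  exact: addr_ge0 (normr_ge0 _) ler01.
pose rho := Num.min r (d / 2); have rho0 : 0 < rho by rewrite lt_min r0 divr_gt0.
have rhor : rho <= r by rewrite ge_min lexx.
have Hrho v : `|v - p| <= rho -> U v /\ (`|g v| <= M0 /\
   (forall i, `|metric_derive g v i| <= M1) /\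
   (forall i j, `|'D_(e_ j) ('D_(e_ i) g) v| <= M2)).
  move=> vr; split; first exact/inU/(le_trans vr).
  apply: Hd; rewrite -ball_normE /= distrC; apply: le_lt_trans vr _.
  by rewrite gt_min; apply/orP; right; rewrite ltr_pdivrMr // ltr_pMr // ltr1n.
pose r' := rho / 3; have r'0 : 0 < r' by rewrite divr_gt0.
have r'rho : r' <= rho by rewrite /r'; lra.
pose N := n%:R : R; have N0 : 0 <= N by [].
pose C := 1 + (M0 + M1 + N * M1 + N * M2 + N * (N * M2)).
have NM1 : 0 <= N * M1 by rewrite mulr_ge0.
have NM2 : 0 <= N * M2 by rewrite mulr_ge0.
have NNM2 : 0 <= N * (N * M2) by rewrite mulr_ge0.
have C0 : 0 < C by rewrite /C; lra.
have lip (f : 'rV[R]_n -> 'M[R]_n) (m : R) v w : 0 <= m ->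
    (forall u, `|u - p| <= rho -> (forall i, derivable f u (e_ i)) /\
      forall i, `|'D_(e_ i) f u| <= m) ->
    `|v - p| <= r' -> `|w - p| <= r' -> `|f w - f v| <= N * m * `|w - v|.
  move=> m0 fu vr wr; apply: norm_mx_le => [|j l]; first by rewrite !mulr_ge0.
  have := @partial_increment R n (fun u => f u j l) p w v r' m (fun=> 0) wr vr.
  have -> : \sum_i (w - v) 0 i * (0 : R) = 0 by rewrite big1 // => i _; rewrite mulr0.
  rewrite subr0 => K; rewrite mxE [(- f v) j l]mxE; apply: K => u i ur.
  have [du bu] := fu u (le_trans ur r'rho).
  split; first by have /derivable_mxP := du i.
  rewrite derive_coord // subr0; apply: le_trans (bu i); exact: entry_norm_le.
have lip1 i v w : `|v - p| <= rho -> `|w - p| <= rho ->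
    `|metric_derive g w i - metric_derive g v i| <= N * M2 * `|w - v|.
  move=> vr wr; apply: norm_mx_le => [|j l]; first by rewrite !mulr_ge0.
  have := @partial_increment R n (fun u => 'D_(e_ i) g u j l) p w v rho M2
    (fun=> 0) wr vr.
  have -> : \sum_i0 (w - v) 0 i0 * (0 : R) = 0 by rewrite big1 // => k _; rewrite mulr0.
  rewrite subr0 => K; rewrite mxE [(- metric_derive g v i) j l]mxE; apply: K => u k ur.
  have [Uu [_ [_ /(_ i k) b2]]] := Hrho u ur.
  have du : derivable ('D_(e_ i) g) u (e_ k).
    exact: (smooth_on_derivable (smooth_on_derive gU (e_ i)) Uu).
  split; first by have /derivable_mxP := du.
  by rewrite derive_coord // subr0; apply: le_trans b2; exact: entry_norm_le.
exists r', lo, hi, C; split => //.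
  by split => // v vr; apply: B; apply: le_trans vr _; exact: le_trans r'rho rhor.
split.
- move=> v vr; have vr' := le_trans vr r'rho.
  have [Uv [b0 [b1 _]]] := Hrho v vr'; have [z dz zE] := Uv.
  split; first by rewrite /g -zE; exact: metric_symmetric.
  + by apply: le_trans b0 _; rewrite /C; lra.
  + by move=> i; apply: le_trans (b1 i) _; rewrite /C; lra.
  + exact: smooth_on_strict_diff oU Uv gU.
- move=> v vr w; have vr' : `|v - p| <= r by apply: le_trans vr _; exact: le_trans r'rho rhor.
  by have [_ /(_ w)/andP[Hl _]] := B v vr'.
move=> v w vr wr.
have vr' := le_trans vr r'rho; have wr' := le_trans wr r'rho.
split.
- apply: (@le_trans _ _ (N * M1 * `|w - v|)).
    apply: lip => // u ur; have [Uu [_ [b1 _]]] := Hrho u ur; split => // i.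
    exact: (smooth_on_derivable gU Uu).
  by apply: ler_wpM2r => //; rewrite /C; lra.
- move=> i; apply: le_trans (lip1 i v w vr' wr') _.
  by apply: ler_wpM2r => //; rewrite /C; lra.
apply: norm_mx_le => [|j l]; first by rewrite mulr_ge0 ?sqr_ge0 // ltW.
have := @partial_increment R n (fun u => g u j l) v w v `|w - v| (N * M2 * `|w - v|)
  (fun i => metric_derive g v i j l) (lexx _).
rewrite subrr normr0 => /(_ (normr_ge0 _)).
have -> : \sum_i (w - v) 0 i * metric_derive g v i j l =
    (\sum_i (w - v) 0 i *: metric_derive g v i) j l.
  by rewrite summxE; apply: eq_bigr => i _; rewrite [in RHS]mxE.
set S := \sum_(i < n) _ => K.
have -> : (g w - g v - S) j l = g w j l - g v j l - S j l.
  by rewrite mxE [(g w - g v) j l]mxE [(- g v) j l]mxE [(- S) j l]mxE.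
apply: le_trans (K _) _ => [u i uv|].
  have ur : `|u - p| <= rho.
    have := ler_normD (u - v) (v - p); rewrite addrA subrK.
    have := ler_normB (w - p) (v - p); rewrite opprB addrA subrK.
    by move: vr wr uv; rewrite /r'; lra.
  have [Uu _] := Hrho u ur.
  have du : derivable g u (e_ i) by exact: (smooth_on_derivable gU Uu).
  split; first by have /derivable_mxP := du.
  rewrite derive_coord //; have := entry_norm_le (metric_derive g u i - metric_derive g v i) j l.
  rewrite mxE [(- metric_derive g v i) j l]mxE => /le_trans; apply.
  apply: le_trans (lip1 i v u vr' ur) _.
  by apply: ler_wpM2l.
have -> : n%:R * (N * M2 * `|w - v|) * `|w - v| = N * (N * M2) * `|w - v| ^+ 2 by ring.
by apply: ler_wpM2r; [exact: sqr_ge0 | rewrite /C; lra].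
Qed.

End ChartMetricBounds.

(** * Geodesics minimize energy among nearby curves *)

Section ScalarDerivatives.
Context {R : realType}.

Lemma is_derive_mulrr (f : R -> R) (s df k : R) : is_derive s 1 f df ->
  is_derive s 1 (fun u => f u * k) (df * k).
Proof.
move=> d; rewrite mulrC.
exact: (is_derive1_comp (f := fun u => u * k) (is_derive_mulr k (f s)) d).
Qed.

Definition dot n (a b : 'rV[R]_n) : R := (a *m b^T) 0 0.

Lemma dotE n (a b : 'rV[R]_n) : dot a b = \sum_i a 0 i * b 0 i.
Proof. by rewrite /dot mxE; apply: eq_bigr => i _; rewrite mxE. Qed.

Lemma is_derive_dot n (a b : R -> 'rV[R]_n) (s : R) da db :
  is_derive s 1 a da -> is_derive s 1 b db ->
  is_derive s 1 (fun u => dot (a u) (b u)) (dot da (b s) + dot (a s) db).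
Proof.
move=> Da Db; have /is_derive_mxP/(_ 0 0) := is_derive_mulmx Da (is_derive_trmx Db).
by rewrite mxE.
Qed.

Lemma inner_dot n (G : 'M[R]_n) a b : inner G a b = dot (a *m G) b.
Proof. by []. Qed.

Lemma dot_gradient n (D : 'I_n -> 'M[R]_n) (a h : 'rV[R]_n) :
  dot (\row_l inner (D l) a a) h = inner (\sum_i h 0 i *: D i) a a.
Proof.
have innerZm (k : R) (A : 'M[R]_n) : inner (k *: A) a a = k * inner A a a.
  by rewrite /inner -scalemxAr -scalemxAl mxE.
have -> : inner (\sum_i h 0 i *: D i) a a = \sum_i inner (h 0 i *: D i) a a.
  apply: (big_morph (fun A => inner A a a)) => [A A'|]; first exact: inner_mxD.
  by rewrite /inner mulmx0 mul0mx mxE.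
by rewrite dotE; apply: eq_bigr => i _; rewrite mxE innerZm mulrC.
Qed.

End ScalarDerivatives.

(** The algebra of the pointwise comparison: X, Y, Z stand for the metric at the
    competitor evaluated on (a, a), (a, b), (b, b), where a is the velocity of
    the geodesic and b the deviation of the velocities, q for |b|, X' for the
    first-order term of X about the energy E, and Y' for the leading term of Y.
    What is left is lo^2 (q - I w)^2 >= 0. *)
Lemma complete_square {R : realFieldType} (th w q lo I E k sg X X' Y Y' Z : R) :
  0 <= th -> 0 <= w -> E + X' - k * I ^+ 2 * sg ^+ 2 <= X ->
  Y' - k * I * sg * q <= Y -> lo ^+ 2 * q ^+ 2 <= Z ->
  (w * (th ^+ 2 * E - th ^+ 2 * k * I ^+ 2 * sg ^+ 2 - lo ^+ 2 * I ^+ 2)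
    + (th ^+ 2 * w * X' + 2 * th * Y')
    + q * (2 * lo ^+ 2 * I - 2 * th * k * I * sg)) * w
  <= (th * w) ^+ 2 * X + 2 * (th * w) * Y + Z.
Proof.
move=> th0 w0 P1 P2 P3.
have Q1 : (th * w) ^+ 2 * (E + X' - k * I ^+ 2 * sg ^+ 2) <= (th * w) ^+ 2 * X.
  by apply: ler_wpM2l => //; exact: sqr_ge0.
have Q2 : 2 * (th * w) * (Y' - k * I * sg * q) <= 2 * (th * w) * Y.
  by apply: ler_wpM2l => //; rewrite !mulr_ge0.
have Q3 : 0 <= lo ^+ 2 * (q - I * w) ^+ 2 by rewrite mulr_ge0 // sqr_ge0.
rewrite [leLHS](_ : _ = (th * w) ^+ 2 * (E + X' - k * I ^+ 2 * sg ^+ 2) +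
  2 * (th * w) * (Y' - k * I * sg * q) + (lo ^+ 2 * q ^+ 2
  - lo ^+ 2 * (q - I * w) ^+ 2)); last by ring.
by apply: lerD; [exact: lerD | apply: le_trans P3; rewrite gerBl].
Qed.

Section Energy.
Context {R : realType} {n : nat}.
Variables (g : 'rV[R]_n -> 'M[R]_n) (p : 'rV[R]_n) (r lo C : R).
Hypotheses (lo0 : 0 < lo) (C0 : 0 < C) (gb : metric_bounds g p r lo C).
Variables (y y' : R -> 'rV[R]_n) (sg : R).
Hypothesis y'_cont : continuous y'.
Hypothesis y_derive : forall s : R, is_derive s 1 y (y' s).
Hypothesis y_geod : forall s : R, -1 <= s <= 2 ->
  [/\ is_derive s 1 y' (geodesic_acceleration g (y s) (y' s)),
     `|y s - p| <= r & `|y' s| <= sg].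

Let D v := metric_derive g v.
Let mom s := y' s *m g (y s).
Let force s : 'rV[R]_n := 2^-1 *: \row_l inner (D (y s) l) (y' s) (y' s).

Lemma curve_sder (x x' : R -> 'rV[R]_n) (s : R) : continuous x' ->
  (forall s : R, is_derive s 1 x (x' s)) -> sder x s (x' s).
Proof.
move=> cx' dx; have E : derive1 x = x'.
  by apply/funext => u; rewrite derive1E; have ? := dx u; rewrite derive_val.
rewrite -E; apply: derivable_sder; last by rewrite E; exact: cx'.
by near=> u; have [] := dx u.
Unshelve. all: by end_near. Qed.

Let metric_along (s : R) : -1 <= s <= 2 ->
  is_derive s 1 (g \o y) (\sum_i y' s 0 i *: D (y s) i).
Proof.
move=> sI; have [_ yr _] := y_geod sI; have [H _ _] := gb.
have [_ _ Dc dg] := H _ yr; apply: sder_derive.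
pose L (h : 'rV[R]_n) := \sum_i h 0 i *: D (y s) i.
apply: (@strict_diff_ext _ _ _ _ _ (L \o (fun h : R => h *: y' s))).
  move=> h; rewrite /L /= scaler_sumr; apply: eq_bigr => i _.
  by rewrite mxE scalerA.
apply: (@strict_diff_comp _ _ _ _ g y s _ _ `|y' s| (n%:R * C)) dg (curve_sder _ y'_cont y_derive).
- exact: normr_ge0.
- by rewrite mulr_ge0 // ltW.
- by move=> h; rewrite normrZ mulrC.
- move=> v; apply: le_trans (ler_norm_sum _ _ _) _.
  apply: (@le_trans _ _ (\sum_(i < n) C * `|v|)).
    apply: ler_sum => i _; rewrite normrZ mulrC.
    by apply: ler_pM => //; exact: coord_norm_le.
  by rewrite sumr_const card_ord -mulrA mulr_natl.
- move=> v w; rewrite -sumrB; apply: eq_bigr => i _.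
  by rewrite !mxE scalerBl.
Qed.

(** Euler-Lagrange form of the geodesic equation. *)
Let mom_derive (s : R) : -1 <= s <= 2 -> is_derive s 1 mom (force s).
Proof.
move=> sI; have [dy' yr _] := y_geod sI.
have := is_derive_mulmx dy' (metric_along sI).
rewrite (acceleration_metric lo0 gb _ yr) /lower_gamma opprB -addrA [- _ + _]addrC.
by rewrite subrr addr0.
Qed.

Definition geodesic_energy : R := inner (g (y 0)) (y' 0) (y' 0).

Lemma energy_conserved (s : R) : -1 <= s <= 2 ->
  inner (g (y s)) (y' s) (y' s) = geodesic_energy.
Proof.
have dE (u : R) : -1 <= u <= 2 -> is_derive u 1 (fun u => dot (mom u) (y' u)) 0.
  move=> uI; have [dy' yr _] := y_geod uI; have [H _ _] := gb.
  have [gT _ _ _] := H _ yr.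
  have := is_derive_dot (mom_derive uI) dy'.
  set a := geodesic_acceleration _ _ _.
  have -> : dot (mom u) a = - dot (lower_gamma (D (y u)) (y' u) (y' u)) (y' u).
    rewrite -inner_dot innerC // inner_dot (acceleration_metric lo0 gb _ yr).
    by rewrite /dot mulNmx mxE.
  have -> : dot (lower_gamma (D (y u)) (y' u) (y' u)) (y' u) = dot (force u) (y' u).
    set S := \row_l inner (D (y u) l) (y' u) (y' u).
    have E : dot (y' u *m (\sum_i y' u 0 i *: D (y u) i)) (y' u) = dot S (y' u).
      by rewrite dot_gradient.
    rewrite /lower_gamma -/S /force -/S /dot mulmxBl -scalemxAl mxE.
    rewrite -[(_ *m _ *m _) 0 0]/(dot _ _) E /dot !mxE.
    by move: (\sum_j _) => T; lra.
  by rewrite subrr.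
move=> /andP[s1 s2]; rewrite inner_dot; have [s0|/ltW s0] := leP s 0.
  apply: (@increment_cst _ (fun u => dot (mom u) (y' u)) _ _ s0) => u.
  by rewrite in_itv /= => /andP[u1 u2]; apply: dE; apply/andP; split; lra.
apply/esym; apply: (@increment_cst _ (fun u => dot (mom u) (y' u)) _ _ s0) => u.
by rewrite in_itv /= => /andP[u1 u2]; apply: dE; apply/andP; split; lra.
Qed.

Section Comparison.
Variables (z z' : R -> 'rV[R]_n) (v l : R -> R) (u1 th dl : R).
Hypothesis z_derive : forall s : R, is_derive s 1 z (z' s).
Hypotheses (z'_cont : continuous z') (v_cont : continuous v).
Hypotheses (v_ge0 : forall s, 0 <= v s) (z_ball : forall s, `|z s - p| <= r).
Hypothesis v_sqr : forall s, v s ^+ 2 = inner (g (z s)) (z' s) (z' s).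
Hypotheses (l_derive : forall s : R, is_derive s 1 l (v s)) (l0 : l 0 = 0).
Hypotheses (u1_ge : -1 <= u1) (th0 : 0 < th) (u2_le : u1 + th <= 2) (dl0 : 0 < dl).
Hypotheses (z0 : z 0 = y u1) (z1 : z 1 = y (u1 + th)).
Let k := n%:R ^+ 2 * C.
Hypotheses (sg0 : 0 <= sg) (sg_small : 9 * k * sg ^+ 2 + 6 * k * sg <= lo ^+ 2 / 2).

Let L := l 1.

Let l_mono s t : s <= t -> l s <= l t.
Proof. by move=> st; apply: (increment_ge0 st (fun u _ => l_derive u)). Qed.

Let Lp : 0 < L + dl.
Proof. by rewrite ltr_wpDl // -l0 l_mono. Qed.

(* The time density of the competitor z: the speed, normalized to integral 1.
   The summand dl keeps it positive where z rests. The geodesic is compared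
   with z at the time ph s, not s. *)
Let om s := (v s + dl) / (L + dl).
Let Om s := (l s + s * dl) / (L + dl).
Let ph s := u1 + th * Om s.

Let om_gt0 s : 0 < om s. Proof. by rewrite divr_gt0 // ltr_wpDl. Qed.

Let Om_derive (s : R) : is_derive s 1 Om (om s).
Proof.
apply: is_derive_mulrr.
exact: (is_deriveD (l_derive s) (is_derive_mulr dl s)).
Qed.

Let ph_derive (s : R) : is_derive s 1 ph (th * om s).
Proof.
rewrite mulrC -[X in is_derive _ _ _ X]add0r; apply: is_deriveD.
have -> : (fun x => th * Om x) = (fun s => Om s * th).
  by apply/funext => u; rewrite mulrC.
exact: is_derive_mulrr.
Qed.

Let Om0 : Om 0 = 0. Proof. by rewrite /Om l0 mul0r addr0 mul0r. Qed.
Let Om1 : Om 1 = 1. Proof. by rewrite /Om mul1r divff // gt_eqF. Qed.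

Let ph_itv s : 0 <= s <= 1 -> -1 <= ph s <= 2.
Proof.
move=> /andP[s0 s1].
have a1 : 0 <= Om s.
  by rewrite -Om0; apply: (increment_ge0 s0 (fun u _ => Om_derive u)) => u _; exact: ltW.
have a2 : Om s <= 1.
  by rewrite -Om1; apply: (increment_ge0 s1 (fun u _ => Om_derive u)) => u _; exact: ltW.
rewrite /ph; have h1 : 0 <= th * Om s by rewrite mulr_ge0 // ltW.
have h2 : th * Om s <= th by rewrite ler_piMr // ltW.
move: (th * Om s) h1 h2 u1_ge u2_le => q q1 q2 q3 q4.
by apply/andP; split; lra.
Qed.

Let h s := z s - y (ph s).
Let b s := z' s - (th * om s) *: y' (ph s).

Let h_derive (s : R) : is_derive s 1 h (b s).
Proof.
exact: (is_deriveB (z_derive s)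
  (is_derive_mx_comp (y_derive (ph s)) (ph_derive s))).
Qed.

Let nb_cont : continuous (fun s => `|b s|).
Proof.
have c1 : continuous ph by move=> s; exact: (is_derive_continuous (ph_derive s)).
have c2 : continuous om.
  move=> s; apply: cvgMr_tmp; apply: cvgD; [exact: v_cont | exact: cvg_cst].
move=> s; apply: continuous_comp; last exact: norm_continuous.
apply: (@cvgB _ _ _ (nbhs s) _ z' (fun s => (th * om s) *: y' (ph s))); first exact: z'_cont.
apply: (@cvgZ _ _ _ (nbhs s) _ (fun s => th * om s) (y' \o ph)).
  by apply: cvgMl_tmp; exact: c2.
by apply: continuous_comp; [exact: c1 | exact: y'_cont].
Qed.

Let N := prim (fun s => `|b s|).
Let I := N 1.

Let N_derive (s : R) : is_derive s 1 N `|b s|. Proof. exact: is_derive_prim. Qed.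

Let N_mono s t : s <= t -> N s <= N t.
Proof. by move=> st; apply: (increment_ge0 st (fun u _ => N_derive u)). Qed.

Let N0 : N 0 = 0. Proof. exact: prim0. Qed.
Let I0 : 0 <= I. Proof. by rewrite -N0 N_mono. Qed.

Let h0 : h 0 = 0. Proof. by rewrite /h /ph Om0 mulr0 addr0 z0 subrr. Qed.
Let h1 : h 1 = 0. Proof. by rewrite /h /ph Om1 mulr1 z1 subrr. Qed.

Let h_le s : 0 <= s <= 1 -> `|h s| <= I.
Proof.
move=> /andP[s0 s1]; have := rV_increment_le s0 (fun u _ => h_derive u)
  (fun u _ => N_derive u) (fun u _ => lexx _).
by rewrite h0 N0 !subr0 => /le_trans; apply; exact: N_mono.
Qed.

(* By the Euler-Lagrange equation the first-order terms in the comparison of the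
   energies are, up to the factor 2 th, the derivative of W, which vanishes at
   both ends. *)
Let W s := dot (mom (ph s)) (h s).
Let dW s := th * om s * dot (force (ph s)) (h s) + dot (mom (ph s)) (b s).

Let W_derive (s : R) : 0 <= s <= 1 -> is_derive s 1 W (dW s).
Proof.
move=> sI; have d1 := is_derive_mx_comp (mom_derive (ph_itv sI)) (ph_derive s).
have := is_derive_dot d1 (h_derive s); rewrite /dW.
by congr (is_derive _ _ _ (_ + _)); rewrite /dot -scalemxAl mxE.
Qed.

Let E := geodesic_energy.
Let A := th ^+ 2 * E - th ^+ 2 * k * I ^+ 2 * sg ^+ 2 - lo ^+ 2 * I ^+ 2.
Let B := 2 * lo ^+ 2 * I - 2 * th * k * I * sg.

Let pointwise s : 0 <= s <= 1 ->
  om s * A + dW s * (2 * th) + `|b s| * B <= v s * (L + dl).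
Proof.
move=> sI; have phI := ph_itv sI; have [_ yr ysg] := y_geod phI.
have [H low H2] := gb; have zr := z_ball s.
set a := y' (ph s); set G := g (z s); set G0 := g (y (ph s)).
have [GT _ _ _] := H _ zr; rewrite -/G in GT.
have [lip _ taylor] := H2 _ _ yr zr; rewrite -/G -/G0 in lip taylor.
set DG := \sum_i h s 0 i *: D (y (ph s)) i.
have hI := h_le sI; have b0 := normr_ge0 (b s).
have k0 : 0 <= k by rewrite mulr_ge0 ?sqr_ge0 // ltW.
have a0 := normr_ge0 a; have H0 := normr_ge0 (h s).
have P1 : E + inner DG a a - k * I ^+ 2 * sg ^+ 2 <= inner G a a.
  have := inner_norm_le (G - G0 - DG) a a.
  have -> : inner (G - G0 - DG) a a = inner G a a - E - inner DG a a.
    rewrite /E -(energy_conserved phI) -/G0 -/a.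
    have -> : inner G a a = inner (G - G0 - DG) a a + (inner G0 a a + inner DG a a).
      by rewrite -!inner_mxD; congr inner; rewrite [G0 + DG]addrC addrA !subrK.
    lra.
  have : n%:R ^+ 2 * `|G - G0 - DG| * `|a| * `|a| <= k * I ^+ 2 * sg ^+ 2.
    rewrite -[leLHS]mulrA -expr2; apply: ler_pM.
    - by rewrite mulr_ge0 // sqr_ge0.
    - exact: sqr_ge0.
    - rewrite /k -[leRHS]mulrA; apply: ler_wpM2l; first exact: sqr_ge0.
      apply: le_trans taylor _; apply: ler_wpM2l; first exact: ltW.
      by rewrite lerXn2r // nnegrE.
    - by rewrite lerXn2r // nnegrE.
  rewrite ler_norml => bd /andP[lb _].
  by move: lb bd; move: (n%:R ^+ 2 * _ * _ * _) => X; lra.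
have P2 : inner G0 a (b s) - k * I * sg * `|b s| <= inner G a (b s).
  have := inner_norm_le (G - G0) a (b s).
  have -> : inner (G - G0) a (b s) = inner G a (b s) - inner G0 a (b s).
    by apply/eqP; rewrite eq_sym subr_eq -inner_mxD subrK.
  have : n%:R ^+ 2 * `|G - G0| * `|a| * `|b s| <= k * I * sg * `|b s|.
    apply: ler_wpM2r => //; apply: ler_pM => //.
    rewrite /k -[leRHS]mulrA; apply: ler_wpM2l; first exact: sqr_ge0.
    by apply: le_trans lip _; apply: ler_wpM2l => //; exact: ltW.
  rewrite ler_norml => bd /andP[lb _].
  by move: lb bd; move: (n%:R ^+ 2 * _ * _ * _) => X; lra.
have P3 : (lo * `|b s|) ^+ 2 <= inner G (b s) (b s) by exact: low.
have V : v s ^+ 2 = (th * om s) ^+ 2 * inner G a a +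
    2 * (th * om s) * inner G a (b s) + inner G (b s) (b s).
  rewrite v_sqr -/G; have -> : z' s = (th * om s) *: a + b s by rewrite /b subrKC.
  move: (b s) => q; rewrite innerDl !innerDr innerZ [inner G q (_ *: _)]innerC //.
  have -> : inner G ((th * om s) *: a) q = th * om s * inner G a q.
    by rewrite /inner -!scalemxAl mxE.
  by ring.
have dWE : dW s * (2 * th) = th ^+ 2 * om s * inner DG a a + 2 * th * inner G0 a (b s).
  rewrite /dW -inner_dot -/a -/G0.
  have -> : dot (force (ph s)) (h s) = 2^-1 * inner DG a a.
    by rewrite /force /dot -scalemxAl mxE -dot_gradient.
  by lra.
have O := om_gt0 s.
have vom : v s * (L + dl) * om s = v s * (v s + dl).
  by rewrite /om -mulrA; congr (_ * _); rewrite mulrC divfK // gt_eqF.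
have key : v s ^+ 2 <= v s * (L + dl) * om s.
  by rewrite vom expr2; apply: ler_wpM2l => //; rewrite lerDl ltW.
rewrite -(ler_pM2r O); apply: le_trans key; rewrite V dWE /A /B.
move: P1 P2 P3; rewrite exprMn.
move: (inner G a a) (inner G a (b s)) (inner G (b s) (b s)) (inner DG a a)
  (inner G0 a (b s)) => X Y Z X' Y' P1 P2 P3.
move: (om s) O `|b s| b0 P2 P3 => w w0 q q0 P2 P3.
exact: (@complete_square _ th w q lo I E k sg X X' Y Y' Z (ltW th0) (ltW w0)).
Qed.

(** A curve z with the end points of a piece of the geodesic y is at least as long
    as this piece, and much longer if it strays: let h be the deviation of z from
    y, in the parametrization of y proportional to the arc length of z, and I the
    total variation of h. Expanding the square of the speed of z about y, the
    first-order terms integrate to 0, while the second-order ones contain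
    lo^2 |h'|^2 and errors that are dominated by it as the velocity sg of y is
    small. The deviation is at most I since h vanishes at the ends. *)
Lemma energy_comparison s : 0 <= s <= 1 ->
  th ^+ 2 * E + lo ^+ 2 / 2 * `|z s - y (u1 + th * ((l s + s * dl) / (L + dl)))| ^+ 2
    <= L * (L + dl).
Proof.
move=> sI.
have dF (u : R) : u \in `[0, 1] -> is_derive u 1
    (fun u => Om u * A + W u * (2 * th) + N u * B)
    (om u * A + dW u * (2 * th) + `|b u| * B).
  rewrite in_itv /= => uI; apply: is_deriveD.
    by apply: is_deriveD; apply: is_derive_mulrr; [exact: Om_derive | exact: W_derive].
  by apply: is_derive_mulrr; exact: N_derive.
have dG (u : R) : u \in `[0, 1] -> is_derive u 1 (fun u => l u * (L + dl)) (v u * (L + dl)).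
  by move=> _; apply: is_derive_mulrr; exact: l_derive.
have := increment_le ler01 dF dG (fun u uI => pointwise uI).
have W0 : W 0 = 0 by rewrite /W h0 /dot trmx0 mulmx0 mxE.
have W1 : W 1 = 0 by rewrite /W h1 /dot trmx0 mulmx0 mxE.
rewrite Om0 Om1 W0 W1 N0 l0 !mul0r !addr0 !subr0 mul1r -/I -/L => K.
have HI : `|z s - y (u1 + th * ((l s + s * dl) / (L + dl)))| ^+ 2 <= I ^+ 2.
  by rewrite lerXn2r // ?nnegrE //; exact: h_le.
have k0 : 0 <= k by rewrite mulr_ge0 ?sqr_ge0 // ltW.
have th3 : th <= 3 by move: u1_ge u2_le; lra.
have S1 : (th ^+ 2 * k * sg ^+ 2 + 2 * th * k * sg) <= lo ^+ 2 / 2.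
  apply: le_trans sg_small; apply: lerD.
    apply: ler_wpM2r; first exact: sqr_ge0.
    apply: ler_wpM2r => //; have -> : 9 = 3 ^+ 2 :> R by ring.
    by rewrite lerXn2r // nnegrE // ltW.
  apply: ler_wpM2r => //; apply: ler_wpM2r => //; lra.
apply: le_trans K; rewrite /A /B -/E.
have S2 := ler_wpM2r (sqr_ge0 I) S1.
have S3 : lo ^+ 2 / 2 * `|z s - y (u1 + th * ((l s + s * dl) / (L + dl)))| ^+ 2 <=
    lo ^+ 2 / 2 * I ^+ 2.
  by apply: ler_wpM2l => //; rewrite divr_ge0 // sqr_ge0.
have -> : th ^+ 2 * E - th ^+ 2 * k * I ^+ 2 * sg ^+ 2 - lo ^+ 2 * I ^+ 2 +
    I * (2 * lo ^+ 2 * I - 2 * th * k * I * sg) = th ^+ 2 * E + (lo ^+ 2 * I ^+ 2 -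
    (th ^+ 2 * k * sg ^+ 2 + 2 * th * k * sg) * I ^+ 2) by ring.
rewrite lerD2l; apply: le_trans S3 _.
by rewrite lerBrDr -lerBrDl; apply: le_trans S2 _; rewrite lerBrDl -mulrDl; lra.
Qed.

End Comparison.
End Energy.

(** * Short geodesics realize the distance *)

Lemma sder_affine {R : realType} (a b s : R) : sder (fun t => a + t * b) s b.
Proof.
move=> e e0; exists 1 => // t t' _ _.
have -> : a + t * b - (a + t' * b) - (t - t') *: b = 0 by rewrite /GRing.scale /=; ring.
by rewrite normr0 mulr_ge0 // ltW.
Qed.

Section ConstantSpeed.
Context {R : realType} {n : nat} {X : riemannianManifold R n}.

Lemma affine_reparam (c : R -> X) (a b s : R) :
  (\forall t \near a + s * b, differentiable_curve c t) ->
  (\forall t \near s, differentiable_curve (fun t => c (a + t * b)) t) /\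
  speed (fun t => c (a + t * b)) s = `|b| * speed c (a + s * b).
Proof.
move=> cd; split.
  have ac : {for s, continuous (fun t : R => a + t * b)}.
    exact: sder_continuous (sder_affine a b s).
  near=> t; apply: (reparam_speed (a := fun t => a + t * b) _ (sder_affine a b t)).1.
  by near: t; exact: (ac _ cd).
by have [] := reparam_speed (a := fun t => a + t * b) (nbhs_singleton cd) (sder_affine a b s).
Unshelve. all: by end_near. Qed.

Lemma constant_speed_dist_le (c : R -> X) (u v sp : R) : u < v ->
  (forall s, u <= s <= v -> (\forall t \near s, differentiable_curve c t) /\ speed c s = sp) ->
  riemannian_dist (c u) (c v) <= (v - u) * sp.
Proof.
move=> uv H; have b0 : 0 < v - u by rewrite subr_gt0.
have I (s : R) : 0 <= s <= 1 -> u <= u + s * (v - u) <= v.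
  by move=> /andP[s0 s1]; apply/andP; split; nra.
pose c' s := c (u + s * (v - u)).
have gd (s : R) : 0 <= s <= 1 -> \forall t \near s, differentiable_curve c' t.
  by move=> /I /H[/affine_reparam[]].
have gs s : speed c' (clamp s) = (v - u) * sp.
  have /I/H[/affine_reparam[_]] := clamp_itv s.
  by rewrite /c' => -> ->; rewrite gtr0_norm.
have [e ae [le _]] := subarc gd (s0 := 0) (s1 := 1) ltac:(lra) ltac:(lra).
have := dist_le_length ae; rewrite le /c' mul0r mul1r addr0 addrC subrK.
have E : speed c' \o clamp = cst ((v - u) * sp) by apply/funext => t; rewrite /= gs.
have cc : continuous (speed c' \o clamp) by rewrite E => t; exact: cvg_cst.
have dp (t : R) : is_derive t 1 (prim (speed c' \o clamp)) ((v - u) * sp).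
  by rewrite -(gs t); exact: is_derive_prim.
have -> : prim (speed c' \o clamp) 1 - prim (speed c' \o clamp) 0 = (v - u) * sp.
  rewrite (increment_eq (G := fun t => t * ((v - u) * sp)) ler01 (fun t _ => dp t)
    (fun t _ => is_derive_mulr _ t)); by rewrite mul0r mul1r subr0.
by rewrite ger0_norm // mulr_ge0 ?(ltW b0) // -(H u _).2 ?speed_ge0 // lexx ltW.
Qed.

End ConstantSpeed.

(** Two curves of lengths L1, L2 that nearly realize the distances t q and
    (1 - t) q meet at a parameter close to t, and their total length is close to
    q; the fraction is the one in the energy comparison at the junction 1/2. *)
Lemma split_ratio {R : realFieldType} (q e t L1 L2 : R) :
  0 < q -> 0 < e -> e <= 1 -> e <= q -> 0 <= t <= 1 -> t * q <= L1 ->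
  (1 - t) * q <= L2 -> L1 < t * q + e -> L2 < (1 - t) * q + e ->
  [/\ L1 + L2 < 3 * q,
     `|0 + 1 * ((L1 + 2^-1 * e) / (L1 + L2 + e)) - t| <= 3 * e / q &
     (L1 + L2) * (L1 + L2 + e) - q ^+ 2 <= (5 * q + 6) * e].
Proof.
move=> q0 e0 e1 eq /andP[t0 t1] m1 m2 l1 l2.
have s1 : q <= L1 + L2 by lra.
have s2 : L1 + L2 <= q + 2 * e by lra.
have D : 0 < L1 + L2 + e by lra.
split; first by lra.
  have -> : 0 + 1 * ((L1 + 2^-1 * e) / (L1 + L2 + e)) - t =
      (L1 + 2^-1 * e - t * (L1 + L2 + e)) / (L1 + L2 + e).
    by field; rewrite gt_eqF.
  rewrite normrM [`|_^-1|]gtr0_norm ?invr_gt0 //.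
  apply: ler_pM; rewrite ?invr_ge0 ?normr_ge0 ?(ltW D) //; last first.
    by rewrite lef_pV2 ?posrE //; lra.
  have h1 := ler_wpM2l t0 s1; have h2 := ler_wpM2l t0 s2.
  have h3 := ler_wpM2r (ltW e0) t1; have h4 := mulr_ge0 t0 (ltW e0).
  by rewrite ler_norml; apply/andP; split; lra.
have : (L1 + L2) * (L1 + L2 + e) <= (q + 2 * e) * (q + 3 * e) by apply: ler_pM; lra.
have : e * e <= e by rewrite ler_piMl // ltW.
move: ((L1 + L2) * _) => V; lra.
Qed.

Section ChartGeodesic.
Context {R : realType} {n : nat} {X : riemannianManifold R n}.
Hypothesis aX : arcwise X.
Variables (phi : @chart R n X) (p : 'rV[R]_n) (r lo hi C : R).
Hypothesis cb : coordinate_ball phi p r lo hi.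
Hypotheses (C0 : 0 < C) (gb : metric_bounds (metric phi) p r lo C).
Variables (y y' : R -> 'rV[R]_n) (sg : R).
Hypothesis y'_cont : continuous y'.
Hypothesis y_derive : forall s : R, is_derive s 1 y (y' s).
Hypothesis y_geod : forall s : R, -1 <= s <= 2 ->
  [/\ is_derive s 1 y' (geodesic_acceleration (metric phi) (y s) (y' s)),
     `|y s - p| <= r / 2 & `|y' s| <= sg].
Hypothesis sg0 : 0 <= sg.
Hypothesis sg_small :
  9 * (n%:R ^+ 2 * C) * sg ^+ 2 + 6 * (n%:R ^+ 2 * C) * sg <= lo ^+ 2 / 2.

Local Notation dist := (@riemannian_dist R n X).
Let E := geodesic_energy (metric phi) y y'.
Let gam := cinv phi \o y.

Hypothesis energy_small : 3 * Num.sqrt E < lo * (r / 2).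

Let r0 : 0 < r. Proof. by have [] := cb. Qed.
Let lo0 : 0 < lo. Proof. by have [] := cb. Qed.

Let half_le v : `|v - p| <= r / 2 -> `|v - p| <= r.
Proof. by move=> /le_trans; apply; rewrite ler_pdivrMr // ler_pMr // ler1n. Qed.

Let y_geod_r : forall s : R, -1 <= s <= 2 ->
  [/\ is_derive s 1 y' (geodesic_acceleration (metric phi) (y s) (y' s)),
     `|y s - p| <= r & `|y' s| <= sg].
Proof. by move=> s sI; have [? /half_le] := y_geod sI. Qed.

Let y_range s : -1 <= s <= 2 -> exists2 z, cdom phi z & phi z = y s.
Proof. by move=> sI; have [_ yr _] := y_geod_r sI; have [_ _ _ _ /(_ _ yr)[]] := cb. Qed.

Let gam_chart s : -1 <= s <= 2 -> cdom phi (gam s) /\ phi (gam s) = y s.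
Proof.
move=> sI; have [z dz pz] := y_range sI.
by rewrite /gam /= -pz chartK.
Qed.

Lemma chart_geodesic_comparison c u1 th dl s :
  arc c (gam u1) (gam (u1 + th)) -> -1 <= u1 -> 0 < th -> u1 + th <= 2 ->
  0 < dl -> curve_length c < lo * (r / 2) -> 0 <= s <= 1 ->
  cdom phi (c s) /\ th ^+ 2 * E + lo ^+ 2 / 2 *
    `|phi (c s) - y (u1 + th * ((arc_length c s + s * dl) /
        (curve_length c + dl)))| ^+ 2
    <= curve_length c * (curve_length c + dl).
Proof.
move=> ac u1_ge th0 u2_le dl0 short sI; have [phi_at _ _ _ _] := cb.
have I1 : -1 <= u1 <= 2 by apply/andP; split; lra.
have I2 : -1 <= u1 + th <= 2 by apply/andP; split; lra.
have [d1 e1] := gam_chart I1; have [d2 e2] := gam_chart I2.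
have [_ yr1 _] := y_geod I1.
have inb t : @in_ball R n X phi p r (c t).
  apply: (short_arc_in_ball cb ac (lexx r) d1 (rho' := r / 2)).
  - by rewrite e1.
  - by rewrite ltr_pdivrMr // ltr_pMr // ltr1n.
  - by move: (curve_length c) short => q; congr (_ < _ * _); field.
have [cd _ _] := ac.
pose z := phi \o c; pose z' := derive1 z.
have zs t : exists w, sder z t w by have [_ /(_ _ phi_at (inb t).1)] := cd t.
have dz (t : R) : is_derive t 1 z (z' t).
  have [w /sder_derive dw] := zs t.
  by rewrite /z' derive1E derive_val.
have z'c : continuous z'.
  have zs' (t : R) : \forall u \near t, exists w, sder z u w by near=> u; exact: zs.
  by move=> t; have [] := sder_near_C1 (zs' t).
split; first by case: (inb s).
rewrite (arc_lengthE ac).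
apply: (energy_comparison lo0 C0 gb y'_cont y_derive y_geod_r dz z'c
  (arc_speed_continuous ac) (speed_ge0 c) _ _ (fun t => arc_length_derive t ac)
  (arc_length0 ac)) => //.
- by move=> t; apply: ltW; case: (inb t).
- move=> t; have sd := curve_sder t z'c dz.
  have ct : {for t, continuous c} by exact: (arc_continuous ac).
  rewrite (speedE ct phi_at (inb t).1 sd) sqr_sqrtr //.
  have [_ low _] := gb; apply: le_trans (low _ _ _); first exact: sqr_ge0.
  by apply: ltW; case: (inb t).
- by rewrite /z /= (arc0 ac).
- by rewrite /z /= (arc1 ac).
Unshelve. all: by end_near. Qed.

Let E0 : 0 <= E.
Proof.
have [_ low _] := gb; apply: le_trans (low _ _ _); first exact: sqr_ge0.
by have [] := y_geod_r (s := 0) ltac:(lra).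
Qed.

Let sE0 : 0 <= Num.sqrt E. Proof. exact: sqrtr_ge0. Qed.

Lemma chart_geodesic_speed (s : R) : -1 <= s <= 2 ->
  (\forall u \near s, differentiable_curve gam u) /\ speed gam s = Num.sqrt E.
Proof.
move=> sI; have [phi_at _ _ _ chartb] := cb.
have [_ yr _] := y_geod sI.
split; last first.
  have [_ ->] := chart_curve phi_at (y_range sI) (curve_sder s y'_cont y_derive).
  by rewrite (energy_conserved lo0 C0 gb y'_cont y_derive y_geod_r sI).
have cy : {for s, continuous (fun u => `|y u - p|)}.
  apply: continuous_comp; last exact: norm_continuous.
  apply: (@cvgB _ _ _ (nbhs s) _ y (cst p)); last exact: cvg_cst.
  exact: (is_derive_continuous (y_derive s)).
have lt : `|y s - p| < r.
  by apply: le_lt_trans yr _; rewrite ltr_pdivrMr // ltr_pMr // ltr1n.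
near=> u; have yu : `|y u - p| <= r.
  by apply: ltW; near: u; exact: (cy _ (near_ltr lt)).
have [yx _] := chartb _ yu.
by have [] := chart_curve phi_at yx (curve_sder u y'_cont y_derive).
Unshelve. all: by end_near. Qed.

Let dist_ge u v : -1 <= u -> u < v -> v <= 2 ->
  (v - u) * Num.sqrt E <= dist (gam u) (gam v).
Proof.
move=> u1 uv v2; rewrite leNgt; apply/negP => /(dist_lt_length aX)[c ac short].
have uE : v = u + (v - u) by rewrite addrC subrK.
have th0 : 0 < v - u by rewrite subr_gt0.
have l0 : 0 <= curve_length c.
  by rewrite (arc_lengthE ac) -(arc_length0 ac); exact: (arc_length_le ac ler01).
have ac' : arc c (gam u) (gam (u + (v - u))) by rewrite -uE.
have cmp := chart_geodesic_comparison (s := 0) ac' u1 th0 _ _ _.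
have th3 : (v - u) * Num.sqrt E <= 3 * Num.sqrt E by apply: ler_wpM2r => //; lra.
have short3 : curve_length c < lo * (r / 2).
  by apply: lt_trans short _; apply: le_lt_trans th3 _.
have X2 : curve_length c ^+ 2 < ((v - u) * Num.sqrt E) ^+ 2.
  by rewrite ltrXn2r.
have := X2; rewrite exprMn sqr_sqrtr // => X3.
pose dl := ((v - u) ^+ 2 * E - curve_length c ^+ 2) / (curve_length c + 1) / 2.
have dl0 : 0 < dl by rewrite !divr_gt0 // ?subr_gt0 // ltr_wpDl.
have [_] := cmp dl ltac:(lra) dl0 short3 ltac:(lra).
have t0 : 0 <= lo ^+ 2 / 2 * `|phi (c 0) - y (u + (v - u) *
    ((arc_length c 0 + 0 * dl) / (curve_length c + dl)))| ^+ 2.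
  by rewrite mulr_ge0 // ?sqr_ge0 // divr_ge0 // sqr_ge0.
move: (lo ^+ 2 / 2 * _) t0 => T T0 le.
have : (v - u) ^+ 2 * E <= curve_length c * (curve_length c + dl).
  by apply: le_trans le; rewrite lerDl.
rewrite mulrDr -expr2 -lerBlDl => le2.
suff : curve_length c * dl < (v - u) ^+ 2 * E - curve_length c ^+ 2 by rewrite ltNge le2.
have -> : (v - u) ^+ 2 * E - curve_length c ^+ 2 = 2 * dl * (curve_length c + 1).
  by rewrite /dl; move: (curve_length c) l0 => l l0; field; rewrite gt_eqF // ltr_wpDl.
move: dl dl0 (curve_length c) l0 {T T0 le le2} => d d0 l l0.
have := mulr_ge0 (ltW d0) l0; nra.
Qed.

Let dist_le u v : -1 <= u -> u < v -> v <= 2 ->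
  dist (gam u) (gam v) <= (v - u) * Num.sqrt E.
Proof.
move=> u1 uv v2; apply: constant_speed_dist_le => // s /andP[us sv].
by apply: chart_geodesic_speed; apply/andP; split; lra.
Qed.

(** Competitors either stay in the coordinate ball, where the energy comparison
    applies, or are too long because of the smallness of the energy. *)
Lemma chart_geodesic_dist u v : -1 <= u <= 2 -> -1 <= v <= 2 ->
  dist (gam u) (gam v) = `|v - u| * Num.sqrt E.
Proof.
move=> /andP[u1 u2] /andP[v1 v2]; have [uv|vu|->] := ltgtP u v.
- rewrite ger0_norm ?subr_ge0 1?ltW //.
  by apply/le_anti; rewrite dist_le // dist_ge.
- rewrite dist_sym // distrC ger0_norm ?subr_ge0 1?ltW //.
  by apply/le_anti; rewrite dist_le // dist_ge.
- by rewrite subrr normr0 mul0r dist_xx.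
Qed.

(** A nearly minimal arc through [w] has to follow the geodesic, since the
    comparison inequality controls how far it strays. *)
Lemma chart_geodesic_unique w t : 0 <= t <= 1 ->
  dist (gam 0) w = t * Num.sqrt E -> dist w (gam 1) = (1 - t) * Num.sqrt E ->
  w = gam t.
Proof.
have [phi_at _ _ _ _] := cb; move=> tI d1 d2.
have tJ : -1 <= t <= 2 by move/andP: tI => [? ?]; apply/andP; split; lra.
have I0 : -1 <= (0 : R) <= 2 by apply/andP; split; lra.
have half01 : 0 <= (2^-1 : R) <= 1 by apply/andP; split; lra.
move: energy_small d1 d2 sE0; have := sqr_sqrtr E0.
have [q0|] := eqVneq (Num.sqrt E) 0.
  rewrite q0 => _ _; rewrite mulr0 => /(dist_eq0 aX) <- _ _.
  by apply: (dist_eq0 aX); rewrite chart_geodesic_dist // q0 mulr0.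
move: (Num.sqrt E) => q q_neq qE qs d1 d2 q_ge; have q0 : 0 < q by rewrite lt_def q_neq.
pose K := (5 * q + 6) * (2 / lo ^+ 2).
have K0 : 0 < K by rewrite mulr_gt0 ?divr_gt0 ?exprn_gt0 // addr_gt0 // mulr_gt0.
have approx e : 0 < e -> e <= 1 -> e <= q -> cdom phi w /\
    exists2 u, `|u - t| <= 3 * e / q & `|phi w - y u| ^+ 2 <= K * e.
  move=> e0 e1 eq.
  have [c1 a1 l1] : exists2 c, arc c (gam 0) w & curve_length c < t * q + e.
    by apply: (dist_lt_length aX); rewrite d1 ltrDl.
  have [c2 a2 l2] : exists2 c, arc c w (gam 1) & curve_length c < (1 - t) * q + e.
    by apply: (dist_lt_length aX); rewrite d2 ltrDl.
  have := dist_le_length a1; have := dist_le_length a2; rewrite d1 d2.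
  have [c ac [lc [cw lw]]] := arc_concat a1 a2.
  have cmp := @chart_geodesic_comparison c 0 1 e 2^-1.
  rewrite add0r lw lc cw in cmp; move: cmp l1 l2; rewrite -/gam.
  move: (curve_length c1) (curve_length c2) => L1 L2 cmp l1 l2 m2 m1.
  have [short near_t excess] := split_ratio q0 e0 e1 eq tI m1 m2 l1 l2.
  have [dw bound] := cmp ac (lerN10 _) ltr01 (ler1n _ 2) e0 (lt_trans short qs) half01.
  split=> //; exists (0 + 1 * ((L1 + 2^-1 * e) / (L1 + L2 + e))) => //.
  rewrite /K mulrAC -ler_pdivrMr ?divr_gt0 ?exprn_gt0 // invf_div mulrC.
  apply: le_trans excess; rewrite lerBrDl; apply: le_trans bound.
  by rewrite expr1n [1 * E]mul1r -qE.
have dw : cdom phi w by have [] := approx (Num.min 1 q); rewrite ?lt_min ?ltr01 ?q0 // ge_min lexx ?orbT.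
rewrite -(chartK dw) /gam /=; congr (cinv phi _).
apply/eqP/negPn/negP; rewrite -subr_eq0 -normr_gt0.
move kE : `|phi w - y t| => k k0.
have k2 : 0 < k / 2 by rewrite divr_gt0.
have := is_derive_continuous (y_derive t) => /cvgr_distC_lt/(_ _ k2)/nbhs_ballP[d /= d0 Hd].
pose e := Num.min (Num.min 1 q) (Num.min (q * d / 6) (k ^+ 2 / (8 * K))).
have e0 : 0 < e.
  rewrite !lt_min ltr01 q0 /=; apply/andP; split; apply: divr_gt0.
  - exact: mulr_gt0.
  - by rewrite ltr0n.
  - exact: exprn_gt0.
  - by apply: mulr_gt0 => //; rewrite ltr0n.
have [e1 e2 e3 e4] : [/\ e <= 1, e <= q, e <= q * d / 6 & e <= k ^+ 2 / (8 * K)].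
  by split; rewrite /e !ge_min lexx ?orbT.
have [_ [u ut wu]] := approx e e0 e1 e2.
have ut' : `|u - t| < d.
  apply: le_lt_trans ut _; rewrite ltr_pdivrMr // [d * q]mulrC; move: (q * d) e3 (mulr_gt0 q0 d0) => qd.
  by move: (e) => ee ? ?; lra.
have ytu : `|y u - y t| < k / 2 by apply: Hd; rewrite -ball_normE /= distrC.
have : `|phi w - y u| ^+ 2 < (k / 2) ^+ 2.
  apply: le_lt_trans wu _.
  have : K * e <= K * (k ^+ 2 / (8 * K)) by rewrite ler_pM2l.
  have -> : K * (k ^+ 2 / (8 * K)) = k ^+ 2 / 8 by field; rewrite gt_eqF.
  have := exprn_gt0 2 k0; rewrite expr_div_n; move: (k ^+ 2) (K * e) => ? ?; lra.
have k2' := ltW k2; rewrite ltr_pXn2r ?nnegrE // => wu'.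
have := ler_normD (phi w - y u) (y u - y t); rewrite addrA subrK kE.
by move: wu' ytu; lra.
Qed.

End ChartGeodesic.

Lemma lt2W {R : realFieldType} (a b x : R) : a < x < b -> a <= x <= b.
Proof. by move=> /andP[/ltW -> /ltW ->]. Qed.

Section LocalGeodesics.
Context {R : realType} {n : nat} {X : riemannianManifold R n}.
Hypothesis aX : arcwise X.
Local Notation dist := (@riemannian_dist R n X).

(** The solution [y] extends past both end points of the segment it describes,
    which is what makes minimal segments smooth and extendable. *)
Record minimal_geodesic (phi : @chart R n X) (y y' : R -> 'rV[R]_n) (d : R) : Prop := {
  geodesic_derive' : continuous y';
  geodesic_derive : forall s : R, is_derive s 1 y (y' s);
  geodesic_equation : forall s : R, -1 <= s <= 2 ->
    is_derive s 1 y' (geodesic_acceleration (metric phi) (y s) (y' s));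
  geodesic_range : forall s : R, -1 <= s <= 2 -> exists2 z, cdom phi z & phi z = y s;
  geodesic_speed : forall s : R, -1 <= s <= 2 ->
    (\forall u \near s, differentiable_curve (cinv phi \o y) u) /\
    speed (cinv phi \o y) s = d;
  geodesic_dist : forall u v : R, -1 <= u <= 2 -> -1 <= v <= 2 ->
    dist (cinv phi (y u)) (cinv phi (y v)) = `|v - u| * d;
  geodesic_unique : forall w t, 0 <= t <= 1 ->
    dist (cinv phi (y 0)) w = t * d -> dist w (cinv phi (y 1)) = (1 - t) * d ->
    w = cinv phi (y t) }.

(** The solution of the boundary value problem between the coordinates of two
    points near x satisfies all smallness conditions of the energy comparison. *)
Lemma local_geodesics phi (x : X) : atlas phi -> cdom phi x ->
  exists2 rho : R, 0 < rho & forall a b, dist x a < rho -> dist x b < rho ->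
    exists y y', [/\ cinv phi (y 0) = a, cinv phi (y 1) = b &
      minimal_geodesic phi y y' (dist a b)].
Proof.
move=> phi_at phix.
have I0 : -1 <= (0 : R) <= 2 by apply/andP; split; lra.
have I1 : -1 <= (1 : R) <= 2 by apply/andP; split; lra.
have [r [lo [hi [C [cb C0 gb]]]]] := ex_metric_bounds phi_at phix.
have [_ r0 lo0 hi0 bounds] := cb.
have [L L0 [Q_le Q_lip]] := acceleration_bounds lo0 C0 gb.
pose k := n%:R ^+ 2 * C; have k0 : 0 <= k by rewrite mulr_ge0 ?sqr_ge0 // ltW.
have k1 : 0 < k + 1 by rewrite ltr_wpDl.
(* Points of coordinates within d of phi x have coordinate distance at most 2 d.
   The terms of the minimum ensure, in this order: distance at most 1, the contraction
   condition, solutions inside the ball, smallness of sg <= 14 d, and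
   smallness of the energy. *)
pose dl := Num.min (Num.min 2^-1 (2688^-1 / L)) (Num.min (r / 58)
  (Num.min (lo ^+ 2 / (3696 * (k + 1))) (lo * r / (85 * hi)))).
have dl0 : 0 < dl.
  by rewrite !lt_min invr_gt0 ltr0n !divr_gt0 ?mulr_gt0 ?exprn_gt0 ?invr_gt0 ?ltr0n.
have [d1 d2 d3] : [/\ dl <= 2^-1, dl <= 2688^-1 / L & dl <= r / 58].
  by split; rewrite /dl !ge_min lexx ?orbT.
have [d4 d5] : dl <= lo ^+ 2 / (3696 * (k + 1)) /\ dl <= lo * r / (85 * hi).
  by split; rewrite /dl !ge_min lexx ?orbT.
move: (dl) dl0 d1 d2 d3 d4 d5 => {dl} d d0 d1 d2 d3 d4 d5.
move: d2 d4 d5; rewrite !ler_pdivlMr ?mulr_gt0 ?ltr0n // => d2 d4 d5.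
have nb : \forall a \near x, cdom phi a /\ `|phi a - phi x| < d.
  near=> a; split; first by near: a; exact: chart_near.
  by near: a; have /cvgr_distC_lt := chart_continuous phix; exact.
have [rho rho0 near_rho] := nbhs_dist aX nb.
exists rho => // a b /near_rho[da pa] /near_rho[db pb].
have ab : `|phi b - phi a| < 2 * d.
  have := ler_normB (phi b - phi x) (phi a - phi x); rewrite opprB addrA subrK.
  by clear -pa pb; lra.
have r2 v : `|v - phi x| <= r / 2 -> `|v - phi x| <= r.
  by move/le_trans; apply; rewrite ler_pdivrMr // ler_pMr // ler1n.
have [|||||y [y' [y0 y1 cy' dy geod]]] := @boundary_value R n
    (geodesic_acceleration (metric phi)) (phi x) (r / 2) L L0 _ _ (phi a) (phi b).
- by move=> v w /r2; exact: Q_le.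
- by move=> v w u u' /r2 vr /r2 wr; exact: Q_lip.
- by clear -ab d1; lra.
- have : L * `|phi b - phi a| <= L * (2 * d) by rewrite ler_pM2l // ltW.
  by clear -d2; move: (L * `|_|) => T; lra.
- by clear -pa ab d3; lra.
have g0 : cinv phi (y 0) = a by rewrite y0 chartK.
have g1 : cinv phi (y 1) = b by rewrite y1 chartK.
pose sg := 7 * `|phi b - phi a|; have sg0 : 0 <= sg by rewrite mulr_ge0.
have sgd : sg <= 14 * d by rewrite /sg; clear -ab; lra.
have sg_small : 9 * k * sg ^+ 2 + 6 * k * sg <= lo ^+ 2 / 2.
  have sg1 : sg ^+ 2 <= 14 * sg by rewrite expr2 ler_wpM2r //; clear -sgd d1; lra.
  have h1 : k * sg ^+ 2 <= k * (14 * sg) by rewrite ler_wpM2l.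
  have h2 : k * sg <= k * (14 * d) by rewrite ler_wpM2l.
  by move: (sg) h1 h2 => q; clear -d4 d0; move: (q ^+ 2) => q2 h1 h2; lra.
have [_ yr0 ysg0] := geod 0 I0.
have energy_small : 3 * Num.sqrt (geodesic_energy (metric phi) y y') < lo * (r / 2).
  have [_ /(_ (y' 0))/andP[_ up]] := bounds _ (r2 _ yr0).
  have : Num.sqrt (geodesic_energy (metric phi) y y') <= hi * (14 * d).
    apply: le_trans (ler_wsqrtr up) _; rewrite sqrtr_sqr ger0_norm.
      by rewrite ler_pM2l //; exact: le_trans ysg0 sgd.
    by rewrite mulr_ge0 // ltW.
  move: (Num.sqrt _) => q; have := mulr_gt0 lo0 r0; clear -d5; lra.
have gd := chart_geodesic_dist aX cb C0 gb cy' dy geod sg0 sg_small energy_small.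
have dE : dist a b = Num.sqrt (geodesic_energy (metric phi) y y').
  by rewrite -g0 -g1 (gd _ _ I0 I1) subr0 normr1 mul1r.
exists y, y'; split=> //; rewrite dE; split=> //.
- by move=> s sI; have [] := geod s sI.
- by move=> s sI; have [_ /r2 yr _] := geod s sI; have [] := bounds _ yr.
- exact: (chart_geodesic_speed cb C0 gb cy' dy geod).
- exact: (chart_geodesic_unique aX cb C0 gb cy' dy geod sg0 sg_small energy_small).
Unshelve. all: by end_near. Qed.

Lemma nbhs_dist_lt (s e : R) : 0 < e -> \forall u \near s, `|u - s| < e.
Proof.
by move=> e0; apply/nbhs_ballP; exists e => // u; rewrite -ball_normE /= distrC.
Qed.

(** In any chart, a curve proportional to distance coincides near [s] with a
    reparametrized solution of the geodesic equation, by uniqueness of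
    intermediate points. *)
Lemma metric_geodesic_regular (c : R -> X) (s sp e : R) : 0 < e -> 0 <= sp ->
  (forall u v, `|u - s| < e -> `|v - s| < e -> dist (c u) (c v) = sp * `|v - u|) ->
  [/\ geodesic_at c s, differentiable_curve c s & speed c s = sp].
Proof.
move=> e0 sp0 cdist.
have cs : {for s, continuous c}.
  move=> U /(nbhs_dist aX)[r r0 rU].
  suff : \forall u \near s, U (c u) by [].
  near=> u; apply: rU.
  have us : `|u - s| < e by near: u; apply: nbhs_dist_lt.
  rewrite cdist ?subrr ?normr0 //.
  have : `|u - s| < r / (sp + 1) by near: u; apply: nbhs_dist_lt; rewrite divr_gt0 // ltr_wpDl.
  rewrite ltr_pdivlMr ?ltr_wpDl // mulrDr mulr1 mulrC; move: (normr_ge0 (u - s)).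
  by move: (sp * _) => T; lra.
suff H phi : atlas phi -> cdom phi (c s) -> exists a b y y',
    [/\ minimal_geodesic phi y y' (sp / b), 0 < b, -1 < a + s * b < 2 & \forall u \near s, c u = cinv phi (y (a + u * b))].
  have d_aff (a b u : R) : is_derive u 1 (fun u => a + u * b) b.
    exact: sder_derive (sder_affine a b u).
  have [phi [y [y' [a [b [phi_at geod b0 /lt2W aI ceq]]]]]] : exists phi y y' a b,
      [/\ atlas phi, minimal_geodesic phi y y' (sp / b), 0 < b,
       -1 < a + s * b < 2 & \forall u \near s, c u = cinv phi (y (a + u * b))].
    have [phi phi_at cphi] := atlas_cover (c s).
    by have [a [b [y [y' [g b0 I E]]]]] := H _ phi_at cphi; exists phi, y, y', a, b.
  have [g1 g2] := geodesic_speed geod aI.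
  have [/nbhs_singleton dc spc] := affine_reparam g1.
  have ceq' : \forall u \near s, (cinv phi \o y) (a + u * b) = c u.
    by near=> u; apply/esym; near: u; exact: ceq.
  have [dcs spcs] := differentiable_curve_near_eq ceq' dc.
  split; [|exact: dcs|]; last first.
    apply: etrans spcs _.
    apply: etrans spc _.
    rewrite g2 (gtr0_norm b0) mulrC.
    rewrite divfK //.
    by rewrite (gt_eqF b0).
  split; first exact: cs.
  clear phi y y' a b phi_at geod b0 aI ceq g1 g2 dc spc ceq' dcs spcs.
  move=> phi phi_at cphi x.
  have [a [b [y [y' [geod b0 aI0 ceq]]]]] := H _ phi_at cphi.
  have aI := lt2W aI0; have /andP[a1 a2] := aI0; pose xi (u : R) := a + u * b.
  have xc : {for s, continuous xi} by exact: sder_continuous (sder_affine a b s).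
  have xeq : \forall u \near s, y (xi u) = x u.
    near=> u; rewrite /x /=.
    have -> : c u = cinv phi (y (xi u)) by near: u; exact: ceq.
    have uI : -1 <= xi u <= 2.
      apply/andP; split; apply: ltW; near: u; first exact: (xc _ (near_gtr a1)).
      exact: (xc _ (near_ltr a2)).
    by have [z dz <-] := geodesic_range geod uI; rewrite chartK.
  have dY (u : R) : is_derive u 1 (y \o xi) (b *: y' (xi u)).
    exact: (is_derive_mx_comp (geodesic_derive geod _) (d_aff a b u)).
  have dx : \forall u \near s, is_derive (u : R) (1 : R) x (b *: y' (xi u)).
    have := near_join xeq; apply: filterS => u xequ.
    exact: near_eq_is_derive xequ (dY u).
  have dx1 : \forall u \near s, b *: y' (xi u) = derive1 x u.
    by apply: filterS dx => u [_ <-]; rewrite derive1E.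
  have dd : is_derive s 1 (derive1 x) (b *: (b *: geodesic_acceleration (metric phi)
      (y (xi s)) (y' (xi s)))).
    apply: near_eq_is_derive dx1 _; apply: is_deriveZ.
    have := @is_derive_mx_comp _ _ _ y' xi s _ _ (geodesic_equation geod aI) (d_aff a b s).
    by apply.
  split.
  - by apply: filterS dx => u [].
  - by case: dd.
  move=> k; rewrite -(nbhs_singleton dx1) -(nbhs_singleton xeq).
  have [_ ] := dd; rewrite derive1E => ->.
  have vr : (phi @` cdom phi) (y (xi s)).
    by have [z dz <-] := geodesic_range geod aI; exists z.
  have := @christoffel_acceleration _ _ (metric phi) (y (xi s)) (y' (xi s)) k
    (fun i => smooth_on_derivable (metric_smooth phi_at) vr).
  move: (geodesic_acceleration _ _ _) => A E.
  have -> : (b *: (b *: A)) 0 k = b * (b * A 0 k) by rewrite !mxE.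
  rewrite -[A 0 k]opprK -E.
  rewrite mulrN mulrN mulrA addrC; apply/eqP; rewrite subr_eq0 mulr_sumr; apply/eqP.
  apply: eq_bigr => i _; rewrite mulr_sumr; apply: eq_bigr => j _.
  by rewrite !mxE; ring.
move=> phi_at cphi; have [rho rho0 local] := local_geodesics phi_at cphi.
pose h := Num.min (e / 2) (rho / (2 * (sp + 1))).
have sp1 : 0 < sp + 1 by rewrite ltr_wpDl.
have h0 : 0 < h by rewrite lt_min !divr_gt0 // mulr_gt0.
have [h1 h2] : h <= e / 2 /\ h <= rho / (2 * (sp + 1)).
  by split; rewrite /h !ge_min lexx ?orbT.
move: (h) h0 h1 h2 => {}h h0 h1; rewrite ler_pdivlMr ?mulr_gt0 // => h2.
have spr : sp * h < rho by have := mulr_ge0 sp0 (ltW h0); lra.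
have nh : `|s - h - s| = h by rewrite addrAC subrr add0r normrN gtr0_norm.
have ph : `|s + h - s| = h by rewrite addrAC subrr add0r gtr0_norm.
have ss : `|s - s| < e by rewrite subrr normr0.
have he : h < e by lra.
have [||y [y' [y0 y1 geod]]] := local (c (s - h)) (c (s + h)).
- by rewrite cdist ?nh.
- by rewrite cdist ?ph.
have dE : dist (c (s - h)) (c (s + h)) = sp / (2 * h)^-1.
  rewrite cdist ?nh ?ph // invrK; congr (_ * _).
  by rewrite ger0_norm; lra.
rewrite dE in geod.
have mid : (h - s) / (2 * h) + s * (2 * h)^-1 = 2^-1 by field; rewrite gt_eqF.
exists ((h - s) / (2 * h)), (2 * h)^-1, y, y'; rewrite mid; split=> //.
- by rewrite invr_gt0 mulr_gt0.
- by apply/andP; split; lra.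
near=> u; have us : `|u - s| < h by near: u; exact: nbhs_dist_lt.
have := us; rewrite ltr_norml => /andP[us1 us2].
have tE : (h - s) / (2 * h) + u * (2 * h)^-1 = (u - s + h) / (2 * h).
  by field; rewrite gt_eqF.
apply: (geodesic_unique geod).
- by rewrite tE ler_pdivlMr ?ler_pdivrMr ?mulr_gt0 //; apply/andP; split; lra.
- have ue := lt_trans us he; rewrite y0 (cdist _ _ _ ue) ?nh //.
  rewrite ger0_norm; last lra.
  by rewrite tE invrK; field; rewrite gt_eqF.
- have ue := lt_trans us he; rewrite y1 (cdist _ _ ue) ?ph //.
  rewrite ger0_norm; last lra.
  by rewrite tE invrK; field; rewrite gt_eqF.
Unshelve. all: by end_near. Qed.

End LocalGeodesics.

(** * Points of a complete manifold are joined by minimal geodesics *)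

Section HopfRinow.
Context {R : realType} {n : nat} {X : riemannianManifold R n}.
Hypothesis aX : arcwise X.
Local Notation dist := (@riemannian_dist R n X).

Definition segment_on (c : R -> X) (a b : R) : Prop := forall u v : R,
  a <= u <= b -> a <= v <= b -> dist (c u) (c v) = `|v - u|.

Definition joined (x y : X) : Prop :=
  exists c : R -> X, [/\ c 0 = x, c (dist x y) = y & segment_on c 0 (dist x y)].

Lemma uniformly_joined (z : X) : exists2 rho : R, 0 < rho &
  forall a b, dist z a < rho -> dist z b < rho ->
  exists c : R -> X, [/\ c 0 = a, c 1 = b,
    forall u v : R, -1 <= u <= 2 -> -1 <= v <= 2 -> dist (c u) (c v) = `|v - u| * dist a b &
    forall w (t : R), 0 <= t <= 1 -> dist a w = t * dist a b -> dist w b = (1 - t) * dist a b ->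
      w = c t].
Proof.
have [phi phi_at phiz] := atlas_cover z.
have [rho rho0 H] := local_geodesics aX phi_at phiz.
exists rho => // a b za zb; have [y [y' [y0 y1 g]]] := H a b za zb.
exists (cinv phi \o y); split=> //; first by move=> u v uI vI; exact: (geodesic_dist g uI vI).
by move=> w t tI; rewrite -{1}y0 -{2}y1; exact: (geodesic_unique g).
Qed.

Lemma joined_refl x : joined x x.
Proof.
exists (fun=> x); split=> // u v; rewrite dist_xx // => /andP[u0 u1] /andP[v0 v1].
have -> : u = 0 by apply/le_anti; rewrite u0 u1.
have -> : v = 0 by apply/le_anti; rewrite v0 v1.
by rewrite subrr normr0.
Qed.

Lemma joined_of_affine (c : R -> X) a b : c 0 = a -> c 1 = b ->
  (forall u v : R, -1 <= u <= 2 -> -1 <= v <= 2 -> dist (c u) (c v) = `|v - u| * dist a b) ->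
  joined a b.
Proof.
move=> c0 c1 H; have [/(dist_eq0 aX) <-|d_neq] := eqVneq (dist a b) 0; first exact: joined_refl.
have d0 : 0 < dist a b by rewrite lt_def d_neq dist_ge0.
exists (fun u => c (u / dist a b)); rewrite mul0r divff //; split=> // u v uI vI.
have I w : 0 <= w <= dist a b -> -1 <= w / dist a b <= 2.
  move=> /andP[w0 w1].
  have h0 : 0 <= w / dist a b by rewrite divr_ge0 // ltW.
  have h1 : w / dist a b <= 1 by rewrite ler_pdivrMr // mul1r.
  by clear -h0 h1; move: (w / dist a b) h0 h1 => q h0 h1; apply/andP; split; lra.
rewrite H ?I // -mulrBl normrM [`|_^-1|]gtr0_norm ?invr_gt0 //.
by rewrite mulfVK.
Qed.

(** Equality in the triangle inequality rules out any shortcut at y. *)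
Lemma joined_concat x y z : joined x y -> joined y z ->
  dist x z = dist x y + dist y z -> joined x z.
Proof.
move=> [c [c0 c1 cs]] [e [e0 e1 es]] xz.
have xy0 := dist_ge0 aX x y; have yz0 := dist_ge0 aX y z.
pose f u := if u <= dist x y then c u else e (u - dist x y).
have fx u : 0 <= u <= dist x y -> dist x (f u) = u.
  move=> /andP[u0 u1]; rewrite /f u1 -{1}c0 cs ?lexx ?xy0 ?u0 //.
  by rewrite subr0 ger0_norm.
have fy u : dist x y <= u <= dist x z -> f u = e (u - dist x y).
  move=> /andP[u0 u1]; rewrite /f; case: leP => // u0'.
  have -> : u = dist x y by apply/le_anti/andP.
  by rewrite subrr c1 e0.
have eI u : dist x y <= u <= dist x z -> 0 <= u - dist x y <= dist y z.
  by rewrite xz => /andP[u0 u1]; rewrite subr_ge0 u0 lerBlDl.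
have I0 : 0 <= (0 : R) <= dist y z by rewrite lexx.
have I1 : 0 <= dist y z <= dist y z by rewrite lexx andbT.
have J0 : 0 <= (0 : R) <= dist x y by rewrite lexx.
have J1 : 0 <= dist x y <= dist x y by rewrite lexx andbT.
have mixed u v : 0 <= u <= dist x y -> dist x y <= v <= dist x z ->
    dist (f u) (f v) = v - u.
  move=> uI vI; have fu : f u = c u by move/andP: uI => [_ u1]; rewrite /f u1.
  have d1 : dist x (f u) = u by rewrite fu -{1}c0 cs // subr0 ger0_norm //; case/andP: uI.
  have d2 : dist (f u) y = dist x y - u.
    by rewrite fu -{1}c1 cs // ger0_norm // subr_ge0; case/andP: uI.
  have d3 : dist y (f v) = v - dist x y.
    rewrite fy // -{1}e0 es // ?eI // subr0 ger0_norm //.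
    by have /andP[] := eI _ vI.
  have d4 : dist (f v) z = dist x z - v.
    rewrite fy // -{1}e1 es // ?eI // xz ger0_norm; last first.
      by rewrite subr_ge0; have /andP[] := eI _ vI.
    by rewrite opprB addrA [dist y z + _]addrC.
  have t1 := dist_triangle aX y (f u) (f v).
  have t2 := dist_triangle aX (f u) x z; have t3 := dist_triangle aX (f v) (f u) z.
  rewrite d1 in t2; rewrite d2 d3 in t1; rewrite d4 in t3.
  by clear -t1 t2 t3; move: (dist _ _) (dist x z) (dist (f u) z) (dist x y) t1 t2 t3 => a1 a2 a3 a4 *; lra.
exists f; split.
- by rewrite /f xy0.
- by rewrite fy ?xz ?lexx ?andbT ?lerDl // addrAC subrr add0r.
move=> u v /andP[u0 u1] /andP[v0 v1].
have [uy|/ltW uy] := leP u (dist x y); have [vy|/ltW vy] := leP v (dist x y).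
- by rewrite /f uy vy cs ?u0 ?v0.
- by rewrite mixed ?u0 ?uy ?vy ?v1 // ger0_norm // subr_ge0 (le_trans uy).
- rewrite dist_sym // mixed ?u1 ?uy ?vy ?v0 // distrC ger0_norm // subr_ge0.
  exact: le_trans uy.
- rewrite !fy ?uy ?vy ?u1 ?v1 // es ?eI ?uy ?vy ?u1 ?v1 //.
  by rewrite opprB addrA subrK.
Qed.

(** A minimizer of the distance to [y] on a small sphere about [z] lies between
    [z] and [y], because every arc from [z] to [y] crosses the sphere. *)
Lemma sphere_step z y rho : 0 < rho -> rho <= dist z y ->
  compact [set w | dist z w = rho] ->
  exists2 w, dist z w = rho & dist z y = rho + dist w y.
Proof.
move=> rho0 rhoy cS.
have J0 : 0 <= (0 : R) <= 1 by rewrite lexx ler01.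
have J1 : 0 <= (1 : R) <= 1 by rewrite lexx ler01.
have cz : continuous (dist z : X -> R) by exact: (dist_continuous aX).
have cross c : arc c z y -> exists2 s, 0 <= s <= 1 & dist z (c s) = rho.
  move=> ac; have cc : {within `[0, 1], continuous (dist z \o c)}.
    apply: continuous_subspaceT => s.
    by apply: continuous_comp; [exact: (arc_continuous ac) | exact: cz].
  have [|s sI E] := IVT (v := rho) ler01 cc.
    rewrite /= (arc0 ac) (arc1 ac) dist_xx // ge_min le_max ltW //=.
    by rewrite rhoy orbT.
  by exists s => //; rewrite in_itv /= in sI.
have [w [wz wy]] : exists w, dist z w = rho /\
    forall w', dist z w' = rho -> dist w y <= dist w' y.
  have [c ac] := aX z y; have [s _ sz] := cross c ac.
  have [||w /set_mem wz wmin] := compact_EVT_min (f := dist^~ y) _ cS.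
  - by exists (c s).
  - apply: continuous_subspaceT; have -> : dist^~ y = dist y by apply/funext => w; exact: dist_sym.
    exact: (dist_continuous aX).
  by exists w; split=> // w' w'z; apply: wmin; exact: mem_set.
exists w => //; apply/le_anti/andP; split; first by rewrite -wz; exact: dist_triangle.
rewrite leNgt; apply/negP => /(dist_lt_length aX)[c ac short].
have [s sI sz] := cross c ac; have /andP[s0 s1] := sI.
have [c1 a1 l1] := arc_piece ac (s0 := 0) (s1 := s) J0 sI.
have [c2 a2 l2] := arc_piece ac (s0 := s) (s1 := 1) sI J1.
rewrite (arc0 ac) in a1; rewrite (arc1 ac) in a2.
have := dist_le_length a1; have := dist_le_length a2.
rewrite l1 l2 sz (arc_length0 ac) subr0 -(arc_lengthE ac) ger0_norm; last first.
  by rewrite subr_ge0 (arc_lengthE ac); exact: (arc_length_le ac s1).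
rewrite ger0_norm; last by rewrite -(arc_length0 ac); exact: (arc_length_le ac s0).
have := wy _ sz; move: short; clear.
move: (curve_length c) (arc_length c s) (dist w y) (dist (c s) y) => a b d e *; lra.
Qed.

Definition step_towards (y z w : X) : Prop := joined z w /\ dist z y = dist z w + dist w y.

Lemma step_refl y z : step_towards y z z.
Proof. by split; [exact: joined_refl | rewrite dist_xx // add0r]. Qed.

(** The step length rho is the same for all points near p. *)
Lemma local_step (p y : X) : exists2 rho : R, 0 < rho & forall z, dist p z < rho ->
  joined z y \/ exists2 w, dist z w = rho & step_towards y z w.
Proof.
have [r1 r1_gt0 J] := uniformly_joined p.
have [r2 r2_gt0 cB] := locally_compact_dist aX p.
pose rho := Num.min r1 r2 / 3.
have m0 : 0 < Num.min r1 r2 by rewrite lt_min r1_gt0.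
have rho0 : 0 < rho by rewrite divr_gt0.
have [rho1 rho2] : 2 * rho < r1 /\ 2 * rho <= r2.
  have h1 : Num.min r1 r2 <= r1 by rewrite ge_min lexx.
  have h2 : Num.min r1 r2 <= r2 by rewrite ge_min lexx orbT.
  rewrite /rho; clear -m0 h1 h2; move: (Num.min r1 r2) m0 h1 h2 => m *; split; lra.
have J' z w : dist p z < rho -> dist z w <= rho -> joined z w.
  move=> pz zw; have pw := dist_triangle aX z p w.
  have [||c [c0 c1 H _]] := J z w; last exact: joined_of_affine H.
  - by apply: lt_trans pz _; clear -rho0 rho1; lra.
  - by clear -pz zw pw rho1; move: (dist p w) (dist p z) (dist z w) pw pz zw => *; lra.
exists rho => // z pz; have [zy|/ltW yz] := leP (dist z y) rho; [left; exact: J'|right].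
have cS : compact [set w | dist z w = rho].
  apply: subclosed_compact cB _; last first.
    move=> w /= zw; have := dist_triangle aX z p w; rewrite zw.
    by clear -pz rho2; move: (dist p w) (dist p z) pz => *; lra.
  have -> : [set w | dist z w = rho] = dist z @^-1` [set rho] by [].
  apply: closed_comp; last exact: closed_eq.
  by move=> w _; exact: dist_continuous.
have [w zw E] := sphere_step rho0 yz cS.
by exists w => //; split; [apply: J'; rewrite ?zw | rewrite E zw].
Qed.

(** A point towards [y] whose step is at least half as long as possible. *)
Lemma ex_long_step y z : exists w, step_towards y z w /\
  forall w', step_towards y z w' -> dist z w' <= 2 * dist z w.
Proof.
pose S := [set dist z w | w in step_towards y z].
have S0 : S 0 by exists z; [exact: step_refl | exact: dist_xx].
have hS : has_sup S.
  split; first by exists 0.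
  by exists (dist z y) => _ [w [_ ->] <-]; rewrite lerDl dist_ge0.
have [s0|s_gt0] := leP (sup S) 0.
  exists z; split; first exact: step_refl.
  move=> w' sw; rewrite dist_xx // mulr0; apply: le_trans s0.
  by apply: sup_upper_bound => //; exists w'.
have [|_ [w sw <-] lt] := @sup_adherent R S (sup S / 2) _ hS; first by rewrite divr_gt0.
exists w; split=> // w' sw'.
have : dist z w' <= sup S by apply: sup_upper_bound => //; exists w'.
clear -lt; move: (sup S) (dist z w) (dist z w') lt => *; lra.
Qed.

Hypothesis complete : riemannian_complete X.

(** Starting from x, take long steps towards y. The distance to y decreases by the length
    of each step, so the points form a Cauchy sequence; near its limit the steps
    become short, although steps of a fixed length are possible there unless y is reached. *)
Theorem complete_joined x y : joined x y.
Proof.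
pose f z := projT1 (cid (ex_long_step y z)).
have fP z : step_towards y z (f z) /\
    forall w', step_towards y z w' -> dist z w' <= 2 * dist z (f z).
  by rewrite /f; case: cid.
pose z k := iter k f x.
have zS k : dist (z k) y = dist (z k) (z k.+1) + dist (z k.+1) y.
  by have [[_ ->]] := fP (z k).
have zD i j : dist (z (i + j)%N) y <= dist (z i) y /\
    dist (z i) (z (i + j)%N) <= dist (z i) y - dist (z (i + j)%N) y.
  elim: j => [|j [IH1 IH2]]; first by rewrite addn0 dist_xx // subrr.
  rewrite addnS; have := zS (i + j)%N; have := dist_triangle aX (z (i + j)%N) (z i) (z (i + j).+1).
  have := dist_ge0 aX (z (i + j)%N) (z (i + j).+1).
  move: IH1 IH2; move: (dist (z i) y) (dist (z (i + j)%N) y) (dist (z (i + j).+1) y)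
    (dist (z i) (z (i + j)%N)) (dist (z i) (z (i + j).+1)) (dist (z (i + j)%N) (z (i + j).+1)).
  by clear; move=> *; split; lra.
have zx k : joined x (z k) /\ dist x y = dist x (z k) + dist (z k) y.
  elim: k => [|k [J E]]; first by split; [exact: joined_refl | rewrite dist_xx // add0r].
  have [[J' E'] _] := fP (z k); have E1 : dist x (z k.+1) = dist x (z k) + dist (z k) (z k.+1).
    have := dist_triangle aX (z k) x (z k.+1); have := dist_triangle aX (z k.+1) x y.
    move: E E'; rewrite -/(z k.+1); clear.
    move: (dist x y) (dist x (z k)) (dist (z k) y) (dist x (z k.+1)) (dist (z k) (z k.+1))
      (dist (z k.+1) y) => *; lra.
  split; first exact: joined_concat J J' E1.
  by rewrite E1 E E' addrA.
have cau (e : R) : 0 < e -> exists N, forall i j, (N <= i)%N -> (N <= j)%N ->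
    dist (z i) (z j) < e.
  move=> e0; pose S := range (fun k => dist (z k) y).
  have hS : has_inf S.
    by split; [exists (dist (z 0%N) y); exists 0%N | exists 0 => _ [k _ <-]; exact: dist_ge0].
  have e2 : 0 < e / 2 by rewrite divr_gt0.
  have [_ [N _ <-] lt] := inf_adherent e2 hS.
  have near i : (N <= i)%N -> dist (z N) (z i) < e / 2.
    move=> Ni; have [_] := zD N (i - N)%N; rewrite subnKC //.
    have : inf S <= dist (z i) y by apply: ge_inf; [case: hS | exists i].
    move: lt; clear; move: (inf S) (dist _ _) (dist (z N) y) (dist (z i) y) => *; lra.
  exists N => i j /near ni /near nj; have := dist_triangle aX (z N) (z i) (z j).
  rewrite (dist_sym aX (z i) (z N)); move: ni nj; clear.
  move: (dist (z N) (z i)) (dist (z N) (z j)) (dist (z i) (z j)) => *; lra.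
have [p zp] := complete cau.
have [rho rho0 H] := local_step p y.
have [N HN] : exists N, forall k, (N <= k)%N -> dist p (z k) < rho.
  have [N _ HN] := cvgr_lt _ zp _ rho0; exists N => k Nk.
  by rewrite dist_sym //; exact: HN.
have [N' HN'] := cau (rho / 2) ltac:(by rewrite divr_gt0).
pose k := maxn N N'.
have [Jy|[w zw sw]] := H (z k) (HN k (leq_maxl _ _)).
  have [J E] := zx k; exact: joined_concat J Jy E.
have := HN' k k.+1 (leq_maxr _ _) (leqW (leq_maxr _ _)).
have [_ /(_ _ sw)] := fP (z k); rewrite zw -/(z k.+1).
move: (dist (z k) (z k.+1)) rho0; clear => *; lra.
Qed.

(** The local geodesic from c (D - eta) to c D continues beyond c D, and by
    uniqueness of intermediate points it agrees with c before. *)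
Lemma extend_end (c : R -> X) D : 0 < D -> segment_on c 0 D ->
  exists2 eta : R, 0 < eta & exists2 h : R -> X, segment_on h (D - eta) (D + eta) &
    forall u, 0 <= u <= D -> h u = c u.
Proof.
move=> D0 cs; have [rho rho0 H] := uniformly_joined (c D).
pose eta := Num.min D (rho / 2).
have eta0 : 0 < eta by rewrite lt_min D0 divr_gt0.
have etaD : eta <= D by rewrite ge_min lexx.
have etar : eta < rho.
  have : eta <= rho / 2 by rewrite ge_min lexx orbT.
  by move: rho0; clear; move: eta => *; lra.
move: eta eta0 etaD etar => eta eta0 etaD etar.
have ID : 0 <= D <= D by rewrite lexx ltW.
have Ia : 0 <= D - eta <= D by rewrite subr_ge0 etaD gerBl ltW.
have dab : dist (c (D - eta)) (c D) = eta by rewrite cs // subKr gtr0_norm.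
have dba : dist (c D) (c (D - eta)) = eta by rewrite dist_sym.
have [||g [g0 g1 gd gu]] := H (c (D - eta)) (c D); first by rewrite dba.
  by rewrite dist_xx.
rewrite dab in gd gu.
pose h u := if u <= D then c u else g ((u - (D - eta)) / eta).
have hE u : D - eta <= u <= D + eta -> h u = g ((u - (D - eta)) / eta).
  move=> /andP[u0 u1]; rewrite /h; case: leP => // uD.
  have uI : 0 <= u <= D by rewrite uD andbT; apply: le_trans u0; case/andP: Ia.
  apply: gu.
  - rewrite divr_ge0 ?subr_ge0 ?(ltW eta0) //= ler_pdivrMr // mul1r.
    by move: uD; clear; lra.
  - by rewrite divfK ?gt_eqF // cs // ger0_norm // subr_ge0.
  - rewrite cs // ger0_norm ?subr_ge0 // mulrBl mul1r divfK ?gt_eqF //.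
    by clear; ring.
exists eta => //; exists h; last by move=> u /andP[_ uD]; rewrite /h uD.
have I u : D - eta <= u <= D + eta -> -1 <= (u - (D - eta)) / eta <= 2.
  move=> /andP[u0 u1]; rewrite ler_pdivlMr // ler_pdivrMr //.
  by move: u0 u1 eta0; clear; move=> *; apply/andP; split; lra.
move=> u v uI vI; rewrite !hE // gd ?I // -mulrBl normrM [`|_^-1|]gtr0_norm ?invr_gt0 //.
rewrite divfK ?gt_eqF //; congr `|_|.
by ring.
Qed.

(** Extending the segment beyond both ends makes it locally proportional to
    distance also at the times 0 and 1, as a geodesic arc has to be smooth there. *)
Theorem complete_minimal_geodesic x y : exists2 e : R, 0 < e &
  exists c : R -> X, [/\ c 0 = x, c 1 = y & forall s : R, - e < s < 1 + e ->
    exists2 d, 0 < d & forall u v, `|u - s| < d -> `|v - s| < d ->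
      dist (c u) (c v) = dist x y * `|v - u|].
Proof.
have [/(dist_eq0 aX) <-|d_neq] := eqVneq (dist x y) 0.
  exists 1 => //; exists (fun=> x); split=> // s _.
  by exists 1 => // u v _ _; rewrite dist_xx // mul0r.
have D0 : 0 < dist x y by rewrite lt_def d_neq dist_ge0.
have [c [c0 c1 cs]] := complete_joined x y.
move: (dist x y) D0 c1 cs => D D0 c1 cs.
have [e1 e1_gt0 [h1 h1s h1c]] := extend_end D0 cs.
have rs : segment_on (fun u => c (D - u)) 0 D.
  move=> u v /andP[u0 u1] /andP[v0 v1].
  rewrite cs ?subr_ge0 ?gerBl ?u0 ?u1 ?v0 ?v1 //.
  by rewrite distrC; congr `|_|; ring.
have [e2 e2_gt0 [h2 h2s h2c]] := extend_end D0 rs.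
pose m := Num.min (Num.min e1 e2) (D / 2).
have m0 : 0 < m by rewrite !lt_min e1_gt0 e2_gt0 divr_gt0.
have [m1 m2 m3] : [/\ m <= e1, m <= e2 & m <= D / 2].
  by split; rewrite /m !ge_min lexx ?orbT.
move: m m0 m1 m2 m3 => m m0 m1 m2 m3.
pose cc u := if u <= D / 2 then h2 (D - u) else h1 u.
have local u0 : - m < u0 < D + m -> exists2 d, 0 < d &
    forall u v, `|u - u0| < d -> `|v - u0| < d -> dist (cc u) (cc v) = `|v - u|.
  move=> /andP[um uM]; have [u0_le0|u0_gt0] := leP u0 0; last have [D_le|D_gt] := leP D u0.
  - exists (m + u0); first by rewrite -ltrBlDl sub0r.
    have I u : `|u - u0| < m + u0 -> cc u = h2 (D - u) /\ D - e2 <= D - u <= D + e2.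
      rewrite ltr_norml => /andP[a b]; rewrite /cc.
      have -> : u <= D / 2 by move: b m3 u0_le0; clear; lra.
      by split=> //; move: a b m2 u0_le0; clear => *; apply/andP; split; lra.
    move=> u v /I[-> uI] /I[-> vI]; rewrite h2s // distrC; congr (`|_|).
    by ring.
  - exists (D + m - u0); first by rewrite subr_gt0.
    have I u : `|u - u0| < D + m - u0 -> cc u = h1 u /\ D - e1 <= u <= D + e1.
      rewrite ltr_norml => /andP[a b]; rewrite /cc.
      have h : D / 2 < u by move: a m3 D_le; clear; lra.
      rewrite leNgt h; split=> //.
      by move: a b m1 D_le; clear => *; apply/andP; split; lra.
    by move=> u v /I[-> uI] /I[-> vI]; rewrite h1s.
  - exists (Num.min u0 (D - u0)); first by rewrite lt_min u0_gt0 subr_gt0.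
    have I u : `|u - u0| < Num.min u0 (D - u0) -> cc u = c u /\ 0 <= u <= D.
      rewrite lt_min !ltr_norml => /andP[/andP[a _] /andP[_ b]].
      have uI : 0 <= u <= D by move: a b; clear => *; apply/andP; split; lra.
      split=> //; rewrite /cc; case: ifP => _; last exact: h1c.
      rewrite h2c ?subKr //; move: uI; clear => /andP[? ?]; apply/andP; split; lra.
    by move=> u v /I[-> uI] /I[-> vI]; rewrite cs.
exists (m / D); first by rewrite divr_gt0.
exists (fun s => cc (D * s)); split.
- by rewrite mulr0 /cc divr_ge0 ?(ltW D0) // subr0 h2c ?lexx ?(ltW D0) // subrr.
- have h : D / 2 < D by rewrite ltr_pdivrMr // ltr_pMr // ltr1n.
  by rewrite mulr1 /cc leNgt h h1c ?lexx ?(ltW D0).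
move=> s /andP[s0 s1].
have [|d d0 H] := local (D * s).
  rewrite -mulNr ltr_pdivrMr // in s0; rewrite -ltrBlDl ltr_pdivlMr // in s1.
  by move: s0 s1; clear; rewrite mulrBl mul1r mulrC => *; apply/andP; split; lra.
exists (d / D); first by rewrite divr_gt0.
have I u : `|u - s| < d / D -> `|D * u - D * s| < d.
  by rewrite ltr_pdivlMr // -mulrBr normrM gtr0_norm // mulrC.
by move=> u v /I us /I vs; rewrite H // -mulrBr normrM gtr0_norm.
Qed.

End HopfRinow.

(** * Lifting paths and homotopies to a covering *)

Section UnitInterval.
Context {R : realType}.

(** The compactness of the unit interval in the form in which the arguments of
    covering theory use it: a property that is locally constant spreads. *)
Lemma unit_interval_induction (P : R -> Prop) : P 0 ->
  (forall a : R, 0 <= a <= 1 -> exists2 e : R, 0 < e & forall s t,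
    0 <= s <= 1 -> 0 <= t <= 1 -> `|s - a| < e -> `|t - a| < e -> P s -> P t) ->
  forall s, 0 <= s <= 1 -> P s.
Proof.
move=> P0 loc; pose A := [set a : R | 0 <= a <= 1 /\ forall u, 0 <= u <= a -> P u].
have A0 : A 0.
  by split=> [|u /le_anti <-]; [rewrite lexx ler01 | ].
have hA : has_sup A by split; [exists 0 | exists 1 => a [/andP[]]].
have ubA a : A a -> a <= sup A by move=> Aa; apply: sup_upper_bound.
have I : 0 <= sup A <= 1.
  by rewrite ubA //=; apply: ge_sup; [exists 0 | move=> a [/andP[]]].
have [e e0 H] := loc _ I.
have [a [/andP[a0 a1] Pa] lt] := sup_adherent e0 hA.
have aA : a <= sup A by apply: ubA; split; rewrite ?a0.
have new u : 0 <= u <= 1 -> u < sup A + e -> P u.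
  move=> /andP[u0 u1] ue; have [ua|/ltW au] := leP u a; first by apply: Pa; rewrite u0.
  apply: (H a u); rewrite ?a0 ?u0 ?ltr_norml //; last by apply: Pa; rewrite a0 lexx.
    by apply/andP; split; move: lt aA e0; clear; move: (sup A) => *; lra.
  by apply/andP; split; move: lt au ue e0; clear; move: (sup A) => *; lra.
pose b := Num.min 1 (sup A + e / 2).
have [b1 b2] : b <= 1 /\ b <= sup A + e / 2 by rewrite /b !ge_min !lexx orbT.
have b0 : 0 <= b.
  by rewrite le_min ler01 /= addr_ge0 ?divr_ge0 // ?(ltW e0) //; case/andP: I.
have Ab : A b.
  split=> [|u /andP[u0 ub]]; first by rewrite b0.
  apply: new; first by rewrite u0 (le_trans ub).
  by move: ub b2 e0; clear; move: (sup A) => *; lra.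
have b1' : b = 1.
  have := ubA _ Ab; rewrite /b minEle; case: ifP => // _.
  by move: e0; clear; move: (sup A) => *; lra.
by move=> s /andP[s0 s1]; have [_] := Ab; apply; rewrite b1' s0.
Qed.

Lemma continuous_glue {S : topologicalType} (f g : R -> S) (t : R) :
  continuous f -> continuous g -> f t = g t ->
  continuous (fun s => if s <= t then f s else g s).
Proof.
move=> cf cg fg s W; have [st|ts|->] := ltgtP s t => nW.
- have : \forall u \near s, W (if u <= t then f u else g u).
    near=> u; have -> : u <= t by apply: ltW; near: u; exact: near_ltr.
    by near: u; exact: cf.
  by [].
- have : \forall u \near s, W (if u <= t then f u else g u).
    near=> u; have tu : t < u by near: u; exact: near_gtr.
    by rewrite leNgt tu /=; near: u; exact: cg.
  by [].
- have : \forall u \near t, W (if u <= t then f u else g u).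
    near=> u; case: ifP => _; near: u; first exact: cf.
    by apply: cg; rewrite -fg.
  by [].
Unshelve. all: by end_near. Qed.

Lemma affine_continuous (a b : R) : continuous (fun s : R => a + s * b).
Proof. by move=> s; exact: sder_continuous (sder_affine a b s). Qed.

End UnitInterval.

Section Lifting.
Context {R : realType} {S T : topologicalType}.
Variable p : S -> T.
Hypothesis cov : covering_map p.

Definition evenly_covered (U : set T) (sheets : set (set S)) : Prop :=
  [/\ open U, p @^-1` U = \bigcup_(V in sheets) V, trivIset sheets id &
    forall V, sheets V -> [/\ open V, set_bij V U p &
      forall W, open W -> W `<=` V -> open (p @` W)]].

Lemma ex_evenly_covered q : exists U sheets, U q /\ evenly_covered U sheets.
Proof. by have [_ _ /(_ q)[U [sheets [[oU Uq] H1 H2 H3]]]] := cov; exists U, sheets. Qed.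

Lemma covering_continuous : continuous p. Proof. by have [] := cov. Qed.

Section Sheet.
Variables (U : set T) (sheets : set (set S)).
Hypothesis ev : evenly_covered U sheets.

Lemma ex_sheet x : U (p x) -> exists2 V, sheets V & V x.
Proof. by have [_ E _ _] := ev; move=> Ux; have : (p @^-1` U) x by []; rewrite E. Qed.

Lemma sheet_unique V W x : sheets V -> sheets W -> V x -> W x -> V = W.
Proof. by have [_ _ tr _] := ev; move=> sV sW Vx Wx; apply: tr => //; exists x. Qed.

Lemma sheet_inj V x y : sheets V -> V x -> V y -> p x = p y -> x = y.
Proof.
have [_ _ _ H] := ev; move=> /H[_ [_ inj _] _] Vx Vy; apply: inj; exact: mem_set.
Qed.

Lemma sheet_image V x : sheets V -> V x -> U (p x).
Proof. by have [_ _ _ H] := ev; move=> /H[_ [fn _ _] _] /fn. Qed.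

Lemma sheet_open V : sheets V -> open V.
Proof. by have [_ _ _ H] := ev; move=> /H[]. Qed.

Lemma ex_section V (x : S) : sheets V -> exists sg : T -> S,
  (forall q, U q -> [/\ V (sg q), p (sg q) = q & {for q, continuous sg}]) /\
  (forall w, V w -> sg (p w) = w).
Proof.
move=> sV; have [_ _ _ /(_ V sV)[oV [_ _ surj] op]] := ev.
pose sg q := xget x [set w | V w /\ p w = q].
have sgP q : U q -> V (sg q) /\ p (sg q) = q.
  by move=> /surj[w Vw pw]; rewrite /sg; case: xgetP => // /(_ w)[]; split.
have sgK w : V w -> sg (p w) = w.
  move=> Vw; have Uw := sheet_image sV Vw; have [V1 p1] := sgP _ Uw.
  exact: sheet_inj sV V1 Vw p1.
exists sg; split=> // q Uq; have [V1 p1] := sgP q Uq; split=> // W nW.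
have : nbhs q (p @` (W^° `&` V)).
  apply: open_nbhs_nbhs; split; last by exists (sg q).
  by apply: op; [apply: openI => //; exact: open_interior | move=> w []].
suff : p @` (W^° `&` V) `<=` sg @^-1` W by move=> /filterS; apply.
by move=> _ [w [/interior_subset Ww Vw] <-]; rewrite /= sgK.
Qed.

End Sheet.

Lemma lift_unique (f g : R -> S) : continuous f -> continuous g ->
  (forall s, 0 <= s <= 1 -> p (f s) = p (g s)) -> f 0 = g 0 ->
  forall s, 0 <= s <= 1 -> f s = g s.
Proof.
move=> cf cg fg fg0; apply: unit_interval_induction => // a aI.
have [U [sheets [Ua ev]]] := ex_evenly_covered (p (f a)).
have [V sV Va] := ex_sheet ev Ua.
have [W sW Wa] : exists2 W, sheets W & W (g a) by apply: (ex_sheet ev); rewrite -fg.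
have nf : \forall s \near a, V (f s).
  by apply: cf; apply: open_nbhs_nbhs; split=> //; exact: sheet_open ev V sV.
have ng : \forall s \near a, W (g s).
  by apply: cg; apply: open_nbhs_nbhs; split=> //; exact: sheet_open ev W sW.
have /nbhs_ballP[e /= e0 H] : \forall s \near (a : R), V (f s) /\ W (g s) by exact: filterI.
have {}H s : `|s - a| < e -> V (f s) /\ W (g s).
  by move=> se; apply: H; rewrite -ball_normE /= distrC.
exists e => // s t sI tI /H[Vs Ws] /H[Vt Wt] E.
rewrite -E in Ws; have EV := sheet_unique ev sV sW Vs Ws.
by rewrite -EV in Wt; exact: (sheet_inj ev sV Vt Wt (fg t tI)).
Qed.

Lemma stay_in_sheet U sheets V (d : R -> S) : evenly_covered U sheets -> sheets V ->
  continuous d -> (forall s, 0 <= s <= 1 -> U (p (d s))) -> V (d 0) ->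
  forall s, 0 <= s <= 1 -> V (d s).
Proof.
move=> ev sV cd Ud V0 s sI; have [sg [sgP sgK]] := ex_section ev (d 0) sV.
have Uc s' : U (p (d (clamp s'))) by apply: Ud; exact: clamp_itv.
suff -> : d s = sg (p (d (clamp s))) by have [] := sgP _ (Uc s).
move: s sI; apply: lift_unique => //.
- move=> s; have [_ _ cs] := sgP _ (Uc s).
  apply: (@continuous_comp _ _ _ (p \o d \o clamp) sg) => //.
  apply: (@continuous_comp _ _ _ (d \o clamp) p); last exact: covering_continuous.
  by apply: continuous_comp; [exact: clamp_continuous | exact: cd].
- by move=> s sI; have [_ -> _] := sgP _ (Uc s); rewrite clamp_id.
- by rewrite clamp_id ?lexx ?ler01 // sgK.
Qed.

Lemma path_lift (c : R -> T) (x : S) : continuous c -> p x = c 0 ->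
  exists f : R -> S, [/\ continuous f, f 0 = x & forall s, 0 <= s <= 1 -> p (f s) = c s].
Proof.
move=> cc pxc; pose P (t : R) := exists f : R -> S, [/\ continuous f, f 0 = x &
  forall s, 0 <= s <= t -> p (f s) = c s].
apply: (unit_interval_induction (P := P)); last by rewrite ler01 lexx.
  exists (fun=> x); split=> // [s|s /le_anti <-//]; exact: cvg_cst.
move=> a aI; have [U [sheets [Ua ev]]] := ex_evenly_covered (c a).
have : \forall s \near a, U (c s).
  by apply: cc; apply: open_nbhs_nbhs; split=> //; case: ev.
move/nbhs_ballP => [e /= e0 H]; exists e => // s t sI tI sa ta [f [cf f0 fc]].
have [ts|st] := leP t s.
  by exists f; split=> // u /andP[u0 ut]; apply: fc; rewrite u0 (le_trans ut).
have Us : U (p (f s)).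
  by rewrite fc ?lexx ?andbT; [apply: H; rewrite -ball_normE /= distrC | case/andP: sI].
have [V sV Vs] := ex_sheet ev Us; have [sg [sgP sgK]] := ex_section ev x sV.
pose m (u : R) := Num.max s (Num.min t u).
have mI u : s <= m u <= t by rewrite /m le_max lexx ge_max (ltW st) ge_min lexx.
have mc : continuous m.
  move=> u; apply: (@continuous_max _ _ (fun=> s) (fun u => Num.min t u)); first exact: cvg_cst.
  by apply: (@continuous_min _ _ (fun=> t) id); [exact: cvg_cst | exact: cvg_id].
have Um u : U (c (m u)).
  apply: H; rewrite -ball_normE /= distrC; have /andP[m1 m2] := mI u.
  move: sa ta m1 m2; rewrite !ltr_norml; clear; move: (m u) => v /andP[? ?] /andP[? ?] *.
  by apply/andP; split; lra.
have ms : m s = s by rewrite /m (min_r (ltW st)) maxxx.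
exists (fun u => if u <= s then f u else sg (c (m u))); split.
- apply: continuous_glue => //.
    move=> u; have [_ _ cu] := sgP _ (Um u).
    apply: (@continuous_comp _ _ _ (c \o m) sg) => //.
    by apply: continuous_comp; [exact: mc | exact: cc].
  rewrite ms -[f s](sgK _ Vs); congr sg; rewrite fc // lexx andbT.
  by case/andP: sI.
- by case/andP: sI => ->.
- move=> u /andP[u0 ut]; case: leP => su; first by apply: fc; rewrite u0.
  have [_ -> _] := sgP _ (Um u); congr c; rewrite /m (min_r ut) max_r //; exact: ltW.
Qed.

(** The lift of s -> F (s, u) depends continuously on u: it stays in the same
    sheets as the lift at a nearby u0, as one sees by following it along [0, 1].
    Its end point therefore stays in one sheet over q, and is locally constant in u. *)
Theorem homotopy_lift (F : R * R -> T) (f f' : R -> S) q : continuous F ->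
  (forall u, 0 <= u <= 1 -> F (0, u) = F (0, 0)) ->
  (forall u, 0 <= u <= 1 -> F (1, u) = q) ->
  continuous f -> continuous f' -> f 0 = f' 0 ->
  (forall s, 0 <= s <= 1 -> p (f s) = F (s, 0)) ->
  (forall s, 0 <= s <= 1 -> p (f' s) = F (s, 1)) -> f 1 = f' 1.
Proof.
move=> cF F0 F1 cf cf' ff' fF f'F.
have I0 : 0 <= (0 : R) <= 1 by rewrite lexx ler01.
have I1 : 0 <= (1 : R) <= 1 by rewrite lexx ler01.
pose lift u (d : R -> S) := [/\ continuous d, d 0 = f 0 &
  forall s, 0 <= s <= 1 -> p (d s) = F (s, u)].
have Fc1 u : continuous (fun s => F (s, u)).
  move=> s; apply: (@continuous_comp _ _ _ (fun s : R => (s, u)) F); last exact: cF.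
  by apply: (@cvg_pair _ _ _ (nbhs s) (nbhs s) (nbhs u) _ _ _ id (fun=> u)); [exact: cvg_id | exact: cvg_cst].
have Fc2 s : continuous (fun u => F (s, u)).
  move=> u; apply: (@continuous_comp _ _ _ (fun u : R => (s, u)) F); last exact: cF.
  by apply: (@cvg_pair _ _ _ (nbhs u) (nbhs s) (nbhs u) _ _ _ (fun=> s) id); [exact: cvg_cst | exact: cvg_id].
have ex_lift u : 0 <= u <= 1 -> exists d, lift u d.
  move=> uI; have [|d [cd d0 dc]] := path_lift (c := fun s => F (s, u)) (x := f 0) (Fc1 u).
    by rewrite F0 // fF.
  by exists d.
suff H u : 0 <= u <= 1 -> forall d, lift u d -> d 1 = f 1.
  by apply/esym/(H 1); rewrite ?lexx ?ler01.
move: u; apply: unit_interval_induction.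
  move=> d [cd d0 dF]; apply: (lift_unique cd cf) => // s sI.
  by rewrite dF // fF.
move=> u0 u0I; have [c [cc c0 cF0]] := ex_lift u0 u0I.
have tube : forall s, 0 <= s <= 1 -> forall W, nbhs (c s) W ->
    \forall u \near u0, 0 <= u <= 1 -> forall d, lift u d -> W (d s).
  apply: unit_interval_induction.
    move=> W /nbhs_singleton Wc; near=> u => _ d [_ d0 _].
    by rewrite d0 -c0.
  move=> a aI; have [U [sheets [Ua ev]]] := ex_evenly_covered (p (c a)).
  have [V sV Va] := ex_sheet ev Ua; have [sg [sgP sgK]] := ex_section ev (f 0) sV.
  have oV := sheet_open ev sV; have oU : open U by case: ev.
  have : nbhs (a, u0) (F @^-1` U).
    by apply: cF; rewrite -cF0 //; apply: open_nbhs_nbhs.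
  move=> [[A B] /= [nA nB] AB].
  have nV : \forall s \near a, V (c s) by apply: cc; apply: open_nbhs_nbhs.
  have /nbhs_ballP[e /= e0 He] : \forall s \near (a : R), A s /\ V (c s) by exact: filterI.
  have {}He s : `|s - a| < e -> A s /\ V (c s).
    by move=> sa; apply: He; rewrite -ball_normE /= distrC.
  exists e => // s t sI tI sa ta Qs W nW.
  have [At Vt] := He t ta; have [As Vs] := He s sa.
  have Ut : U (F (t, u0)) by apply: (AB (t, u0)); split=> //; exact: nbhs_singleton.
  have near_sg : \forall u \near u0, W (sg (F (t, u))).
    have [_ _ csg] := sgP _ Ut.
    have := @continuous_comp _ _ _ (fun u => F (t, u)) sg u0 (Fc2 t u0) csg.
    by apply; rewrite /= -cF0 // sgK.
  have nVs : \forall u \near u0, 0 <= u <= 1 -> forall d, lift u d -> V (d s).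
    by apply: Qs; apply: open_nbhs_nbhs.
  near=> u => uI d ld; have [cd d0 dF] := ld.
  have Bu : B u by near: u.
  have Wu : W (sg (F (t, u))) by near: u.
  suff Vd : V (d t) by rewrite -(sgK _ Vd) dF.
  have Vds : V (d s) by have := uI; move: d ld {cd d0 dF}; near: u; apply: filterS nVs => u Hu *; exact: Hu.
  pose d' (tau : R) := d (s + tau * (t - s)).
  have dI tau : 0 <= tau <= 1 -> 0 <= s + tau * (t - s) <= 1 /\ `|s + tau * (t - s) - a| < e.
    move=> /andP[h0 h1]; have h2 : 0 <= 1 - tau by rewrite subr_ge0.
    have -> : s + tau * (t - s) = (1 - tau) * s + tau * t by ring.
    move/andP: sI => [s0 s1]; move/andP: tI => [t0 t1]; split.
      rewrite addr_ge0 ?mulr_ge0 //=; have := ler_wpM2l h2 s1; have := ler_wpM2l h0 t1.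
      by clear; move=> *; lra.
    have -> : (1 - tau) * s + tau * t - a = (1 - tau) * (s - a) + tau * (t - a) by ring.
    apply: le_lt_trans (ler_normD _ _) _; rewrite !normrM (ger0_norm h0) (ger0_norm h2).
    have [t_eq|/negbTE t_neq] := eqVneq tau 0.
      by rewrite t_eq subr0 mul1r mul0r addr0.
    have tp : 0 < tau by rewrite lt_def t_neq h0.
    have a1 := ler_wpM2l h2 (ltW sa); have : tau * `|t - a| < tau * e by rewrite ltr_pM2l.
    by move: a1; clear; move: (_ * `|s - a|) (_ * `|t - a|) => *; lra.
  have -> : d t = d' 1 by rewrite /d' mul1r addrC subrK.
  apply: (stay_in_sheet ev sV (d := d')) => //.
  - by move=> tau; apply: continuous_comp; [exact: affine_continuous | exact: cd].
  - move=> tau /dI[tI' ta']; rewrite /d' dF //; apply: (AB (_, u)); split=> //=.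
    by have [] := He _ ta'.
  - by rewrite /d' mul0r addr0.
have oV : exists V sheets U, [/\ evenly_covered U sheets, sheets V & V (c 1)].
  have [U [sheets [U1 ev]]] := ex_evenly_covered (p (c 1)).
  by have [V sV V1] := ex_sheet ev U1; exists V, sheets, U.
have [V [sheets [U [ev sV V1]]]] := oV.
have : \forall u \near u0, 0 <= u <= 1 -> forall d, lift u d -> V (d 1).
  by apply: tube => //; apply: open_nbhs_nbhs; split=> //; exact: sheet_open ev V sV.
move=> /nbhs_ballP[e /= e0 He]; exists e => // s t sI tI sa ta Ps d ld.
have end_eq u d' : `|u - u0| < e -> 0 <= u <= 1 -> lift u d' -> d' 1 = c 1.
  move=> ue uI ld'; have V' : V (d' 1) by apply: (He u) => //; rewrite -ball_normE /= distrC.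
  apply: (sheet_inj ev sV V' V1); have [_ _ -> //] := ld'.
  by rewrite cF0 // !F1.
have [d' ld'] := ex_lift s sI.
by rewrite (end_eq t d) // -(end_eq s d') // Ps.
Unshelve. all: by end_near. Qed.

End Lifting.

(** * Riemannian coverings *)

Section RiemannianCovering.
Context {R : realType} {n : nat} {K M : riemannianManifold R n}.
Variable p : K -> M.
Hypotheses (cov : covering_map p) (pull : metric_pullback p).
Hypotheses (aK : arcwise K) (aM : arcwise M).

Local Notation dK := (@riemannian_dist R n K).
Local Notation dM := (@riemannian_dist R n M).

Lemma metric_unit {X : riemannianManifold R n} (phi : @chart R n X) x (J G : 'M[R]_n) :
  atlas phi -> cdom phi x -> metric phi (phi x) = J *m G *m J^T -> J \in unitmx.
Proof.
move=> phi_at phix E; rewrite unitmxE unitfE; apply/negP => /det0P[v v0 vJ].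
by have := metric_pos phi_at phix v0; rewrite E inner_congr vJ /inner !mul0mx mxE ltxx.
Qed.

Lemma covering_isometric x : isometric_at p x.
Proof.
split; first exact: (covering_continuous cov).
move=> phi psi phi_at psi_at phix psix.
have [sm /(_ x (conj phix psix)) E] := pull phi_at psi_at.
have Dx : (cdom phi `&` p @^-1` cdom psi) x by [].
have oD : open (phi @` (cdom phi `&` p @^-1` cdom psi)).
  apply: chart_image_open.
  apply: open_comp; last exact: cdom_open.
  by move=> z _; exact: (covering_continuous cov).
have Ux : (phi @` (cdom phi `&` p @^-1` cdom psi)) (phi x) by exists x.
have [_ sd] := smooth_on_sdiff oD Ux sm.
by exists ('J (psi \o p \o cinv phi) (phi x)).
Qed.

Section Sheet.
Variables (U : set M) (sheets : set (set K)).
Hypothesis ev : evenly_covered p U sheets.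

Lemma section_isometric V (sg : M -> K) m : sheets V -> U m ->
  (forall q, U q -> [/\ V (sg q), p (sg q) = q & {for q, continuous sg}]) ->
  isometric_at sg m.
Proof.
move=> sV Um sgP; have [_ pm csg] := sgP m Um; split=> // psi phi psi_at phi_at psim phis.
have [_ iso] := covering_isometric (sg m).
have [J [sd E]] := iso phi psi phi_at psi_at phis ltac:(by rewrite pm).
rewrite pm in E.
have Ju := metric_unit phi_at phis E.
have psiK := chartK psim.
have oU : open U by case: ev.
exists (invmx J); split.
  apply: (@sdiff_inverse R n (psi \o p \o cinv phi) (phi \o sg \o cinv psi) (psi m) J _ Ju).
  - by rewrite /= psiK.
  - apply: (@continuous_comp _ _ _ (sg \o cinv psi) phi); last first.
      by rewrite /= psiK; exact: chart_continuous.
    apply: (@continuous_comp _ _ _ (cinv psi) sg); last by rewrite psiK.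
    by apply: cinv_continuous; apply: mem_set; exists m.
  - pose O := [set q | U q /\ cdom phi (sg q)].
    have nO : nbhs m O.
      near=> q; split; near: q; first by apply: open_nbhs_nbhs; split=> //; case: ev.
      by apply: csg; apply: open_nbhs_nbhs; split=> //; exact: cdom_open.
    have Hz := chart_near_range (@open_interior _ O) nO psim.
    near=> y; have [q [dq /interior_subset[Uq sq]] <-] : exists2 z, cdom psi z /\ O^° z & psi z = y.
      by near: y.
    have [_ pq _] := sgP q Uq.
    by rewrite /= (chartK dq) (chartK sq) pq.
rewrite E trmx_inv !mulmxA mulVmx // mul1mx -mulmxA mulmxV ?mulmx1 //.
by rewrite unitmx_tr.
Unshelve. all: by end_near. Qed.

End Sheet.

Lemma projected_arc c x y : arc c x y ->
  arc (p \o c) (p x) (p y) /\ curve_length (p \o c) = curve_length c.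
Proof.
move=> [dc c0 c1]; split.
  split=> s.
  - exact: (push_differentiable (covering_isometric _) (dc s)).
  - by move=> s0; rewrite /= c0.
  - by move=> s1; rewrite /= c1.
rewrite /curve_length; congr Rintegral; apply/funext => s.
exact: (push_speed (covering_isometric _) (dc s)).
Qed.

Lemma covering_dist_le x y : dM (p x) (p y) <= dK x y.
Proof.
rewrite leNgt; apply/negP => /(dist_lt_length aK)[c /projected_arc[pc <-]].
by rewrite ltNge dist_le_length.
Qed.

(** A continuous lift of a differentiable curve is its image under a local
    isometric section, so it inherits differentiability and speed. *)
Lemma lift_differentiable (c : R -> M) (f : R -> K) s : {for s, continuous f} ->
  (\forall u \near s, p (f u) = c u) -> differentiable_curve c s ->
  differentiable_curve f s /\ speed f s = speed c s.
Proof.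
move=> cf fc dc; have [U [sheets [Us ev]]] := ex_evenly_covered cov (p (f s)).
have [V sV Vs] := ex_sheet ev Us; have [sg [sgP sgK]] := ex_section ev (f s) sV.
have pfs := nbhs_singleton fc.
have E : \forall u \near s, (sg \o c) u = f u.
  have nV : \forall u \near s, V (f u).
    by apply: cf; apply: open_nbhs_nbhs; split=> //; exact: sheet_open ev V sV.
  near=> u; have pu : p (f u) = c u by near: u.
  by rewrite /= -pu sgK //; near: u.
have Uc : U (c s) by rewrite -pfs.
have iso := section_isometric ev sV Uc sgP.
have [d1 s1] := differentiable_curve_near_eq E (push_differentiable iso dc).
split; first exact: d1.
by rewrite s1; exact: (push_speed iso dc).
Unshelve. all: by end_near. Qed.

Lemma lift_arc c x m : arc c (p x) m ->
  exists2 f, arc f x (f 1) & [/\ forall s, p (f s) = c s & curve_length f = curve_length c].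
Proof.
move=> ac; have [g [cg g0 gc]] := path_lift cov (arc_continuous ac) (esym (arc0 ac)).
pose f := g \o clamp.
have cf : continuous f.
  by move=> s; apply: continuous_comp; [exact: clamp_continuous | exact: cg].
have clamp0 (s : R) : s <= 0 -> clamp s = 0.
  by move=> s0; rewrite /clamp -lock min_r ?(le_trans s0) // max_l.
have clamp1 (s : R) : 1 <= s -> clamp s = 1.
  by move=> s1; rewrite /clamp -lock min_l // max_r.
have pf s : p (f s) = c s.
  rewrite /f /= gc ?clamp_itv //; have [_ a0 a1] := ac.
  have [s0|s0] := leP s 0; first by rewrite clamp0 // !a0.
  have [s1|s1] := leP 1 s; first by rewrite clamp1 // !a1.
  by rewrite clamp_id // !ltW.
have [dc _ _] := ac.
have df (s : R) : differentiable_curve f s /\ speed f s = speed c s.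
  by apply: lift_differentiable => //; [exact: cf | near=> u].
exists f.
  split.
  - by move=> s; have [] := df s.
  - by move=> s s0; rewrite /f /= clamp0.
  - by move=> s s1; rewrite /f /= clamp1 // clamp_id // ler01 lexx.
split=> //; rewrite /curve_length; congr Rintegral.
by apply/funext => s; have [] := df s.
Unshelve. all: by end_near. Qed.

Lemma arc_dist_lt {X : riemannianManifold R n} (c : R -> X) x y r s : arcwise X ->
  arc c x y -> curve_length c < r -> riemannian_dist x (c s) < r.
Proof.
move=> aX ac; apply: le_lt_trans.
have [_ a0 a1] := ac.
have len0 : 0 <= curve_length c.
  by rewrite (arc_lengthE ac) -(arc_length0 ac); exact: (arc_length_le ac ler01).
have [s0|/ltW s0] := leP s 0; first by rewrite a0 // dist_xx.
have [s1|/ltW s1] := leP 1 s; first by rewrite a1 //; exact: dist_le_length.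
have sI : 0 <= s <= 1 by rewrite s0.
have [c' ac' l'] := arc_piece ac unit0 sI.
rewrite (arc0 ac) in ac'; apply: le_trans (dist_le_length ac') _.
rewrite l' (arc_length0 ac) subr0 (arc_lengthE ac) ger0_norm; last first.
  by rewrite -(arc_length0 ac); exact: (arc_length_le ac s0).
exact: (arc_length_le ac s1).
Qed.

(** Near a point of [M], [p] is an isometry for the distances on each sheet:
    short arcs lift without leaving the sheet. *)
Lemma sheet_isometry m : exists U sheets (r : R), [/\ evenly_covered p U sheets, 0 < r,
  forall q, dM m q < r -> U q &
  forall V x y, sheets V -> V x -> dM m (p x) < r ->
    (dK x y < r -> V y) /\ (V y -> dM m (p y) < r -> dK x y = dM (p x) (p y))].
Proof.
have [U [sheets [Um ev]]] := ex_evenly_covered cov m.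
have nU : nbhs m U by apply: open_nbhs_nbhs; split=> //; case: ev.
have [e e0 He] := nbhs_dist aM nU.
have r0 : 0 < e / 3 by rewrite divr_gt0.
exists U, sheets, (e / 3); split=> //.
  move=> q mq; apply: He; apply: lt_trans mq _.
  by rewrite ltr_pdivrMr // ltr_pMr // ltr1n.
move=> V x y sV Vx mx.
have inU c b s : arc c (p x) b -> curve_length c < 2 * (e / 3) -> U (c s).
  move=> ac short; apply: He; apply: le_lt_trans (dist_triangle aM (p x) _ _) _.
  have := arc_dist_lt s aM ac short; move: mx {short}; move: (dM _ _) (dM _ _) => u v *.
  by lra.
split.
  move=> /(dist_lt_length aK)[c ac short].
  have [pc lc] := projected_arc ac.
  rewrite -(arc1 ac); apply: (stay_in_sheet cov ev sV (d := c)).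
  - exact: (arc_continuous ac).
  - move=> s _; apply: (inU _ _ s pc); rewrite lc; apply: lt_trans short _.
    by rewrite ltr_pMl // ltr1n.
  - by rewrite (arc0 ac).
  - exact: unit1.
move=> Vy my; apply/le_anti/andP; split; last exact: covering_dist_le.
have short0 : dM (p x) (p y) < 2 * (e / 3).
  apply: le_lt_trans (dist_triangle aM m _ _) _; rewrite (dist_sym aM (p x)).
  by move: mx my; clear; move: (dM m _) (dM m _) => *; lra.
rewrite leNgt; apply/negP => lt.
have [|c ac short] := @dist_lt_length _ _ _ aM (p x) (p y) (Num.min (dK x y) (2 * (e / 3))).
  by rewrite lt_min lt.
move: short; rewrite lt_min => /andP[short1 short2].
have [f af [pf lf]] := lift_arc ac.
suff fy : f 1 = y by move: short1; rewrite -lf ltNge -fy dist_le_length.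
apply: (sheet_inj ev sV) => //; last by rewrite pf (arc1 ac).
apply: (stay_in_sheet cov ev sV (d := f)).
- exact: (arc_continuous af).
- by move=> s _; rewrite pf; exact: (inU _ _ s ac).
- by rewrite (arc0 af).
- exact: unit1.
Qed.

Lemma covering_local_isometry x : exists2 r : R, 0 < r & forall a b,
  dK x a < r -> dK x b < r -> dM (p a) (p b) = dK a b.
Proof.
have [U [sheets [r [ev r0 rU H]]]] := sheet_isometry (p x).
have [V sV Vx] := ex_sheet ev (rU (p x) ltac:(by rewrite dist_xx)).
have xx : dM (p x) (p x) < r by rewrite dist_xx.
exists r => // a b xa xb.
have Va := (H V x a sV Vx xx).1 xa; have Vb := (H V x b sV Vx xx).1 xb.
have ma := le_lt_trans (covering_dist_le x a) xa.
have mb := le_lt_trans (covering_dist_le x b) xb.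
by rewrite ((H V a b sV Va ma).2 Vb mb).
Qed.

(** A Cauchy sequence projects to a convergent one, and is eventually contained in one
    sheet, on which the projection is isometric near the limit. *)
Lemma covering_complete : riemannian_complete M -> riemannian_complete K.
Proof.
move=> cM u cu; have [m um] : exists m, dM (p (u i)) m @[i --> \oo] --> (0 : R).
  apply: cM => e e0; have [N HN] := cu e e0; exists N => i j Ni Nj.
  by apply: le_lt_trans (covering_dist_le _ _) _; exact: HN.
have [U [sheets [r [ev r0 rU H]]]] := sheet_isometry m.
have [N1 HN1] := cu r r0; have [N2 _ HN2] := cvgr_lt _ um _ r0.
pose N := maxn N1 N2.
have mu i : (N <= i)%N -> dM m (p (u i)) < r.
  by move=> Ni; rewrite dist_sym //; apply: HN2; apply: leq_trans Ni; exact: leq_maxr.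
have [V sV VN] := ex_sheet ev (rU _ (mu N (leqnn N))).
have [sg [sgP sgK]] := ex_section ev (u N) sV.
have mm : dM m m < r by rewrite dist_xx.
have [Vz pz _] := sgP m (rU m mm).
have Vu i : (N <= i)%N -> V (u i).
  move=> Ni; apply: (H V (u N) (u i) sV VN (mu N (leqnn N))).1.
  by apply: HN1; rewrite ?leq_maxl // (leq_trans _ Ni) // leq_maxl.
exists (sg m); apply: cvg_trans um; apply: near_eq_cvg.
exists N => // i Ni; rewrite ((H V (u i) (sg m) sV (Vu i Ni) (mu i Ni)).2 Vz) ?pz //.
Qed.

(** A lift of a curve of [M] has the length of the curve, whence the distance of
    its end points is bounded by that length. *)
Lemma lift_length (c : R -> M) (e : R) (x : K) : 0 < e -> p x = c 0 ->
  (forall s, - e < s < 1 + e -> differentiable_curve c s) ->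
  exists f : R -> K, [/\ continuous f, f 0 = x, forall s, 0 <= s <= 1 -> p (f s) = c s &
    dK x (f 1) <= curve_length c].
Proof.
move=> e0 px dc; pose kap (s : R) := Num.max (- (e / 2)) (Num.min (1 + e / 2) s).
(* The curve is lifted over an interval larger than [0, 1], so that the lift is
   differentiable at 0 and 1 as well. *)
have e2 : 0 < e / 2 by rewrite divr_gt0.
have l0 : 0 < 1 + e / 2 by rewrite addr_gt0.
have unit_in (s : R) : 0 <= s <= 1 -> - (e / 2) < s < 1 + e / 2.
  by move=> /andP[s0 s1]; apply/andP; split; lra.
have kapI s : - e < kap s < 1 + e.
  have : - (e / 2) <= kap s by rewrite le_max lexx.
  have : kap s <= 1 + e / 2.
    by rewrite ge_max ge_min lexx andbT -subr_ge0 opprK addr_ge0 // ltW ?addr_gt0.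
  by move: (kap s) => k *; apply/andP; split; lra.
have kap_id s : - (e / 2) <= s <= 1 + e / 2 -> kap s = s.
  by move=> /andP[s0 s1]; rewrite /kap min_r // max_r.
have kc : continuous kap.
  move=> s; apply: (@continuous_max _ _ (fun=> - (e / 2)) (fun u => Num.min (1 + e / 2) u)).
    exact: cvg_cst.
  by apply: (@continuous_min _ _ (fun=> 1 + e / 2) id); [exact: cvg_cst | exact: cvg_id].
have cc : continuous (c \o kap).
  by move=> s; apply: continuous_comp; [exact: kc | case: (dc _ (kapI s))].
have scaled (k : R) : exists g : R -> K, [/\ continuous g, g 0 = x &
    forall s, 0 <= s <= 1 -> p (g s) = c (kap (0 + s * k))].
  apply: (path_lift cov (c := fun s : R => c (kap (0 + s * k)))).
    move=> s; apply: (@continuous_comp _ _ _ (fun s : R => 0 + s * k) (c \o kap)).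
      exact: affine_continuous.
    exact: cc.
  by rewrite mul0r addr0 kap_id // oppr_le0 !ltW.
have [g1 [cg1 g10 g1c]] := scaled (1 + e / 2).
have [g2 [cg2 g20 g2c]] := scaled (- (e / 2)).
pose f s := if s <= 0 then g2 (0 + s * (- (e / 2))^-1) else g1 (0 + s * (1 + e / 2)^-1).
have cf : continuous f.
  apply: continuous_glue; last by rewrite !mul0r !addr0 g10 g20.
    by move=> s; apply: continuous_comp; [exact: affine_continuous | exact: cg2].
  by move=> s; apply: continuous_comp; [exact: affine_continuous | exact: cg1].
have pf s : - (e / 2) <= s <= 1 + e / 2 -> p (f s) = c s.
  move=> sI; have /andP[s0 s1] := sI; rewrite /f; case: leP => s_sign.
    rewrite g2c !add0r.
      by rewrite divfK ?oppr_eq0 ?gt_eqF // kap_id.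
    rewrite invrN mulrN -mulNr divr_ge0 ?oppr_ge0 ?(ltW e2) //= ler_pdivrMr // mul1r.
    by rewrite lerNl.
  rewrite g1c !add0r.
    by rewrite divfK ?gt_eqF // kap_id.
  by rewrite divr_ge0 ?(ltW l0) ?(ltW s_sign) //= ler_pdivrMr // mul1r.
have df (s : R) : - (e / 2) < s < 1 + e / 2 ->
    differentiable_curve f s /\ speed f s = speed c s.
  move=> /andP[u0 u1]; apply: lift_differentiable; first exact: cf.
    near=> v; apply: pf; apply/andP; split; apply: ltW; near: v.
      exact: near_gtr.
    exact: near_ltr.
  by apply: dc; move: u0 u1; move=> *; apply/andP; split; lra.
have fx : f 0 = x by rewrite /f lexx mul0r addr0.
have C1f : C1_arc f.
  exists (e / 2) => // s; rewrite in_itv /= => /andP[s0 s1].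
  apply: differentiable_curve_C1; near=> u; apply: (df _ _).1.
  by apply/andP; split; near: u; [exact: near_gtr | exact: near_ltr].
have [a aa la] := arc_of_C1_arc C1f.
exists f; split; [exact: cf | exact: fx | |].
  by move=> s /unit_in/lt2W; exact: pf.
rewrite -{1}fx; apply: le_trans (dist_le_length aa) _; rewrite la.
rewrite le_eqVlt; apply/orP; left; apply/eqP; apply: eq_Rintegral => s.
by rewrite inE /= in_itv /= => /unit_in/df[].
Unshelve. all: by end_near. Qed.

End RiemannianCovering.

(** * Volumes of parallelepipeds *)

Section Parallelepipeds.
Context {R : realType}.

Import HBNNSimple.

(** The integral of a nonnegative function, measurable or not, is a supremum
    over the simple functions below it. *)
Lemma ge0_integral_mono d (T : measurableType d) (mu : {measure set T -> \bar R})
    (f g : T -> \bar R) : (forall x, 0 <= f x)%E -> (forall x, f x <= g x)%E ->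
  (\int[mu]_(x in [set: T]) f x <= \int[mu]_(x in [set: T]) g x)%E.
Proof.
move=> f0 fg; have g0 x : (0 <= g x)%E := le_trans (f0 x) (fg x).
rewrite !ge0_integralE //; apply: le_ereal_sup => _ [h hf <-]; exists h => // x.
by apply: le_trans (hf x) _; rewrite !patch_setT.
Qed.

Lemma rV_integral_ge0 n (f : 'rV[R]_n -> \bar R) : (forall v, 0 <= f v)%E ->
  (0 <= rV_integral f)%E.
Proof.
by elim: n f => [|m IH] f f0 //=; apply: integral_ge0 => x _; apply: IH => v.
Qed.

Lemma rV_integral_mono n (f g : 'rV[R]_n -> \bar R) : (forall v, 0 <= f v)%E ->
  (forall v, f v <= g v)%E -> (rV_integral f <= rV_integral g)%E.
Proof.
elim: n f g => [|m IH] f g f0 fg //=.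
by apply: ge0_integral_mono => x; [exact: rV_integral_ge0 | exact: IH].
Qed.

Definition parallelepiped n (a : 'rV[R]_n) (s : R) (B : 'M[R]_n) : set 'rV[R]_n :=
  [set a + u *m B | u in [set u : 'rV[R]_n | forall i, 0 <= u 0 i < s]].

(** Matrices for which the successive integrations see parallelepipeds again:
    the first coordinate of [u *m B] depends on one coordinate of [u] only, and
    so on recursively. *)
Fixpoint flag_mx n : 'M[R]_n -> Prop :=
  match n return 'M[R]_n -> Prop with
  | 0%N => fun=> True
  | m.+1 => fun B => exists i, [/\ B i 0 != 0, forall j, j != i -> B j 0 = 0 &
      flag_mx (row' i (col' 0 B) : 'M[R]_m)]
  end.

Lemma parallelepiped_slice m (B : 'M[R]_m.+1) i (a : 'rV[R]_m.+1) s (x : R) (v : 'rV[R]_m) :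
  B i 0 != 0 -> (forall j, j != i -> B j 0 = 0) ->
  let w := (x - a 0 0) / B i 0 in
  parallelepiped a s B (row_mx (x%:M : 'rV[R]_1) v : 'rV[R]_(1 + m)) <->
  0 <= w < s /\ parallelepiped (\row_j (a 0 (lift 0 j) + w * B i (lift 0 j))) s
    (row' i (col' 0 B)) v.
Proof.
move=> b0 bj w.
have e0 : (0 : 'I_m.+1) = lshift m (0 : 'I_1) by apply: val_inj.
have el (j : 'I_m) : lift 0 j = rshift 1 j by apply: val_inj.
have row0 : (row_mx (x%:M : 'rV[R]_1) v : 'rV[R]_(1 + m)) 0 0 = x.
  by rewrite [X in _ 0 X]e0 row_mxEl mxE eqxx.
have rowl j : (row_mx (x%:M : 'rV[R]_1) v : 'rV[R]_(1 + m)) 0 (lift 0 j) = v 0 j.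
  by rewrite [X in _ 0 X]el row_mxEr.
have mul0 (u : 'rV[R]_m.+1) : (u *m B) 0 0 = u 0 i * B i 0.
  by rewrite mxE (bigD1 i) //= big1 ?addr0 // => j ji; rewrite bj // mulr0.
split.
  move=> [u uI uE].
  have wE : u 0 i = w.
    by have := congr1 (fun v : 'rV[R]_m.+1 => v 0 0) uE; rewrite mxE mul0 row0 /w => <-;
      rewrite addrAC subrr add0r mulfK.
  split; first by rewrite -wE.
  exists (\row_k u 0 (lift i k)); first by move=> k; rewrite mxE.
  apply/rowP => j; have := congr1 (fun v : 'rV[R]_m.+1 => v 0 (lift 0 j)) uE.
  rewrite rowl => <-; rewrite !mxE (bigD1_ord i) //= wE -addrA; congr (_ + (_ + _)).
  by apply: eq_bigr => k _; rewrite !mxE.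
move=> [wI [u' u'I vE]].
exists (\row_j if unlift i j is Some k then u' 0 k else w).
  by move=> j; rewrite mxE; case: unliftP => [k _|_].
apply/rowP => j; case: (unliftP 0 j) => [k ->|->].
  rewrite rowl -vE !mxE (bigD1_ord i) //= mxE unlift_none -addrA; congr (_ + (_ + _)).
  by apply: eq_bigr => l _; rewrite !mxE liftK.
by rewrite row0 mxE mul0 mxE unlift_none /w divfK // addrC subrK.
Qed.

Lemma det_flag_step m (B : 'M[R]_m.+1) i : (forall j, j != i -> B j 0 = 0) ->
  `|\det B| = `|B i 0| * `|\det (row' i (col' 0 B))|.
Proof.
move=> bj; rewrite (expand_det_col B 0) (bigD1 i) //= big1 ?addr0 => [|j ji].
  by rewrite normrM /cofactor normrM normrX normrN normr1 expr1n mul1r.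
by rewrite bj // mul0r.
Qed.

Lemma scaled_interval_measure (b a s : R) : b != 0 -> 0 < s ->
  measurable [set x : R | 0 <= (x - a) / b < s] /\
  lebesgue_measure [set x : R | 0 <= (x - a) / b < s] = (`|b| * s)%:E.
Proof.
move=> b0 s0; have [bneg|bpos|/eqP] := ltgtP b 0; last by rewrite (negbTE b0).
  have -> : [set x : R | 0 <= (x - a) / b < s] = [set` `]a + b * s, a]].
    apply/seteqP; split=> x /=; rewrite in_itv /= ler_ndivlMr // ltr_ndivrMr // mul0r.
      by move=> /andP[h1 h2]; apply/andP; split; lra.
    by move=> /andP[h1 h2]; apply/andP; split; lra.
  split; first exact: measurable_itv.
  have bs : b * s < 0 by rewrite nmulr_rlt0.
  rewrite lebesgue_measure_itv /= lte_fin gtrDl bs -EFinB ltr0_norm //.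
  by congr EFin; ring.
have -> : [set x : R | 0 <= (x - a) / b < s] = [set` `[a, a + b * s[].
  apply/seteqP; split=> x /=; rewrite in_itv /= ler_pdivlMr // ltr_pdivrMr // mul0r.
    by move=> /andP[h1 h2]; apply/andP; split; lra.
  by move=> /andP[h1 h2]; apply/andP; split; lra.
split; first exact: measurable_itv.
have bs : 0 < b * s by rewrite mulr_gt0.
rewrite lebesgue_measure_itv /= lte_fin ltrDl bs -EFinB gtr0_norm //.
by congr EFin; ring.
Qed.

(** Integrating one coordinate after the other: the slice of a parallelepiped by
    its first coordinate is empty or again a parallelepiped, translated. *)
Lemma flag_volume n (B : 'M[R]_n) (a : 'rV[R]_n) (s k : R) : flag_mx B -> 0 < s -> 0 <= k ->
  rV_integral (fun v => (k * \1_(parallelepiped a s B) v)%:E) = (k * s ^+ n * `|\det B|)%:E.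
Proof.
elim: n B a k => [|m IH] B a k fB s0 k0.
  rewrite /= det_mx00 normr1 expr0 indicE mem_set ?mulr1 //.
  by exists 0 => [[]//|]; apply/rowP => -[].
have [i [b0 bj fB']] := fB.
have [mI lI] := scaled_interval_measure (a 0 0) b0 s0.
pose B' := row' i (col' 0 B) : 'M[R]_m.
rewrite /=; under eq_integral => x _.
  rewrite (_ : (fun v => _) = fun v => ((k * \1_[set x : R | 0 <= (x - a 0 0) / B i 0 < s] x) *
    \1_(parallelepiped (\row_j (a 0 (lift 0 j) + (x - a 0 0) / B i 0 * B i (lift 0 j))) s B') v)%:E).
    rewrite (IH B') //; last by rewrite mulr_ge0.
    over.
  apply/funext => v; rewrite -mulrA; congr (k * _)%:E.
  have P := parallelepiped_slice a s x v b0 bj; rewrite /= in P.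
  rewrite !indicE.
  have [Sx|Sx] := boolP ((row_mx (x%:M : 'rV[R]_1) v : 'rV[R]_(1 + m)) \in parallelepiped a s B).
    have [wI Pv] := P.1 (set_mem Sx).
    by rewrite (mem_set (A := [set x | 0 <= _ < s])) // mem_set // mulr1.
  case: (boolP (x \in _)) => [/set_mem xI|_]; last by rewrite mul0r.
  case: (boolP (v \in _)) => [/set_mem Pv|_]; last by rewrite mulr0.
  by move: Sx; rewrite mem_set //; apply/P.
set I := [set x : R | _]; under eq_integral => x _.
  rewrite (_ : _ * _ = k * s ^+ m * `|\det B'| * \1_I x); last by rewrite /I; ring.
  rewrite EFinM; over.
rewrite ge0_integralZl_EFin //; last first.
  - by rewrite !mulr_ge0 // exprn_ge0 // ltW.
  - by apply/measurable_EFinP; exact: measurable_indic.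
rewrite integral_indic // setIT [X in (_ * X)%E]lI -EFinM (det_flag_step bj) exprS.
by congr EFin; rewrite /B'; ring.
Qed.

Definition upper_mx n (T : 'M[R]_n) : Prop :=
  (forall i j : 'I_n, (j < i)%N -> T i j = 0) /\ forall i, T i i != 0.

Lemma upper_flag n (T : 'M[R]_n) : upper_mx T -> flag_mx T.
Proof.
elim: n T => [|m IH] T [T0 Td] //=; exists 0; split=> //.
  by move=> j j0; apply: T0; rewrite lt0n.
by apply: IH; split=> [i j ji|i]; rewrite !mxE //; apply: T0.
Qed.

Lemma upper_unit n (T : 'M[R]_n) : upper_mx T -> T \in unitmx.
Proof.
move=> [T0 Td]; rewrite unitmxE unitfE -det_tr det_trig.
  by apply/prodf_neq0 => i _; rewrite mxE.
by apply/is_trig_mxP => i j ij; rewrite mxE; apply: T0.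
Qed.

Lemma upper_mul n (S T : 'M[R]_n) : upper_mx S -> upper_mx T -> upper_mx (S *m T).
Proof.
move=> [S0 Sd] [T0 Td]; split=> [i j ji|i]; rewrite mxE.
  apply: big1 => k _; have [ki|ik] := ltnP k i; first by rewrite S0 ?mul0r.
  by rewrite T0 ?mulr0 // (leq_trans ji).
rewrite (bigD1 i) //= big1 ?addr0 ?mulf_neq0 // => k ki.
have [lt|ge] := ltnP k i; first by rewrite S0 ?mul0r.
by rewrite T0 ?mulr0 // ltn_neqAle ge andbT eq_sym.
Qed.

(** Bruhat decomposition: Gaussian elimination by upper row operations, taking
    as pivot the last nonzero entry of the first column. Parallelepipeds directed
    by T and their images under L then both have a computable volume. *)
Lemma bruhat n (L : 'M[R]_n) : L \in unitmx ->
  exists2 T, upper_mx T & flag_mx (T *m L).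
Proof.
elim: n L => [|m IH] L uL; first by exists 1%:M => //; split=> -[].
have [i0 Li0] : exists i, L i 0 != 0.
  case: (pickP (fun i => L i 0 != 0)) => [i Li|L0]; first by exists i.
  move: uL; rewrite unitmxE unitfE (expand_det_col L 0) big1 ?eqxx // => i _.
  by move/negbFE/eqP: (L0 i) => ->; rewrite mul0r.
case: (@arg_maxnP _ i0 (fun i => L i 0 != 0) (fun i => i : nat) Li0) => i Li imax.
have below (j : 'I_m.+1) : (i < j)%N -> L j 0 = 0.
  by move=> ij; apply/eqP/negPn/negP => /imax; rewrite /geq /= leqNgt ij.
pose E := \matrix_(j, k) ((j == k)%:R - ((k == i) && (j != i))%:R * (L j 0 / L i 0)).
have Eu : upper_mx E.
  split=> [j k kj|j]; rewrite mxE.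
    rewrite [j == k]gt_eqF //; case: eqP => [ki|_] /=; last by rewrite mul0r subrr.
    by rewrite below ?mul0r ?mulr0 ?subrr // -ki.
  by rewrite eqxx andbN mul0r subr0 oner_neq0.
have EL j l : (E *m L) j l = L j l - (j != i)%:R * (L j 0 / L i 0) * L i l.
  rewrite mxE; under eq_bigr => k _ do rewrite mxE mulrBl.
  rewrite sumrB (bigD1 j) //= eqxx mul1r big1 ?addr0 => [|k /negbTE kj]; last first.
    by rewrite eq_sym kj mul0r.
  rewrite (bigD1 i) //= eqxx big1 ?addr0 // => k /negbTE ->.
  by rewrite !mul0r.
have EL0 j : j != i -> (E *m L) j 0 = 0.
  by move=> ji; rewrite EL ji mul1r divfK // subrr.
have ELi l : (E *m L) i l = L i l by rewrite EL eqxx /= !mul0r subr0.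
pose L' := row' i (col' 0 (E *m L)) : 'M[R]_m.
have uL' : L' \in unitmx.
  have : E *m L \in unitmx by rewrite unitmx_mul upper_unit.
  rewrite !unitmxE !unitfE -normr_eq0 (det_flag_step EL0) mulf_eq0 negb_or.
  by rewrite !normr_eq0 => /andP[].
have [T' [T'0 T'd] fT'] := IH L' uL'.
pose S := \matrix_(j, k) (match unlift i j, unlift i k with
  | Some a, Some b => T' a b | None, None => 1 | _, _ => 0 end).
have Su : upper_mx S.
  split=> [j k|j]; rewrite mxE.
    case: unliftP => [a ->|->]; case: unliftP => [b ->|->] //.
      by move=> ba; apply: T'0; move: ba; rewrite /= ltnNge leq_bump2 -ltnNge.
    by rewrite ltnn.
  by case: unliftP => [a _|_]; [exact: T'd | exact: oner_neq0].
exists (S *m E); first exact: upper_mul.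
rewrite -mulmxA; exists i; split.
- rewrite mxE (bigD1_ord i) //= big1 ?addr0 => [|k _].
    by rewrite mxE unlift_none mul1r ELi.
  by rewrite mxE unlift_none liftK mul0r.
- move=> j; rewrite eq_sym => /unlift_some[a -> ja]; rewrite mxE (bigD1_ord i) //=.
  rewrite mxE ja unlift_none mul0r add0r big1 // => k _.
  by rewrite EL0 ?mulr0 // eq_sym neq_lift.
- suff -> : row' i (col' 0 (S *m (E *m L))) = T' *m L' by [].
  apply/matrixP => a b; rewrite !mxE (bigD1_ord i) //= mxE liftK unlift_none mul0r add0r.
  by apply: eq_bigr => c _; rewrite !mxE !liftK.
Qed.

End Parallelepipeds.

(** * Isometric maps do not increase volume infinitesimally *)

Section Density.
Context {R : realType}.

Lemma det_cvg n (T : Type) (F : set_system T) {FF : Filter F} (G : T -> 'M[R]_n)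
    (g : 'M[R]_n) : (forall i j, G t i j @[t --> F] --> g i j) ->
  \det (G t) @[t --> F] --> \det g.
Proof.
move=> cG; rewrite /determinant.
apply: cvg_big => [|s _]; first exact: add_continuous.
apply: cvgM; first exact: cvg_cst.
by apply: cvg_big => [|i _]; [exact: mul_continuous | exact: cG].
Qed.

(** The determinant cannot vanish on the segment from the identity to a
    positive definite matrix. *)
Lemma det_positive n (G : 'M[R]_n) : (forall v, v != 0 -> 0 < inner G v v) -> 0 < \det G.
Proof.
move=> pos; pose f (t : R) := \det ((1 - t) *: 1%:M + t *: G).
have fc : {within `[0, 1], continuous f}.
  apply: continuous_subspaceT => t; apply: det_cvg => i j.
  have -> : (fun t : R => ((1 - t) *: 1%:M + t *: G) i j) =
      (fun t => (1 - t) * (1%:M : 'M[R]_n) i j + t * G i j).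
    by apply/funext => s; rewrite !mxE.
  rewrite !mxE; apply: cvgD; apply: cvgM; try exact: cvg_cst; last exact: cvg_id.
  by apply: cvgB; [exact: cvg_cst | exact: cvg_id].
have f0 : f 0 = 1 by rewrite /f subr0 scale1r scale0r addr0 det1.
have f1 : f 1 = \det G by rewrite /f subrr scale1r scale0r add0r.
rewrite ltNge; apply/negP => G0.
have [|t tI ft] := IVT (v := 0) ler01 fc.
  by rewrite f0 f1 ge_min le_max G0 ler01 orbT.
rewrite in_itv /= in tI; have /andP[t0 t1] := tI.
move/eqP/det0P : ft => [v v0 vG].
have : inner ((1 - t) *: 1%:M + t *: G) v v = 0 by rewrite /inner vG mul0mx mxE.
have -> : inner ((1 - t) *: 1%:M + t *: G) v v = (1 - t) * (v *m v^T) 0 0 + t * inner G v v.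
  by rewrite inner_mxD /inner -!scalemxAr -!scalemxAl mulmx1 !mxE.
have vv : 0 < (v *m v^T) 0 0.
  rewrite mxE; apply: lt_le_trans (_ : 0 < \sum_j v 0 j ^+ 2) _; last first.
    by apply: ler_sum => j _; rewrite mxE expr2.
  have [j vj] : exists j, v 0 j != 0.
    case: (pickP (fun j => v 0 j != 0)) => [j ?|z]; first by exists j.
    by case/negP: v0; apply/eqP/rowP => j; rewrite mxE; apply/eqP/negbFE/z.
  rewrite (bigD1 j) //= ltr_wpDr ?exprn_even_gt0 //.
  by apply: sumr_ge0 => k _; exact: sqr_ge0.
move/eqP; apply/negP; rewrite gt_eqF //.
have [->|t_neq] := eqVneq t 0; first by rewrite subr0 mul1r mul0r addr0.
have tp : 0 < t by rewrite lt_def t_neq.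
by rewrite ltr_wpDl ?mulr_ge0 ?subr_ge0 ?mulr_gt0 ?pos // ltW.
Qed.

Context {n : nat} {X : riemannianManifold R n}.

Definition density (phi : @chart R n X) (v : 'rV[R]_n) : R :=
  Num.sqrt (\det (metric phi v)).

Lemma density_gt0 phi x : atlas phi -> cdom phi x -> 0 < density phi (phi x).
Proof.
by move=> phi_at phix; rewrite sqrtr_gt0; apply: det_positive => v; exact: metric_pos.
Qed.

Lemma density_continuous phi x : atlas phi -> cdom phi x ->
  {for phi x, continuous (density phi)}.
Proof.
move=> phi_at phix.
apply: (@continuous_comp _ _ _ (fun v => \det (metric phi v)) Num.sqrt); last first.
  exact: sqrt_continuous.
suff : \det (metric phi v) @[v --> phi x] --> \det (metric phi (phi x)) by [].
apply: (det_cvg (FF := nbhs_filter (phi x))) => i j.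
exact: (cvg_comp _ (fun M : 'M[R]_n => M i j) (metric_cvg phi_at phix)
  (@coord_continuous _ _ _ i j _)).
Qed.

End Density.

Section Cells.
Context {R : realType} {n : nat}.
Variable T : 'M[R]_n.

(** Index of the parallelepiped of size [2 ^- k], of the tiling directed by the
    rows of [T], that contains [v]. *)
Definition cell (k : nat) (v : 'rV[R]_n) : 'rV[int]_n :=
  \row_i Num.floor (2 ^+ k * (v *m invmx T) 0 i).

Let floor_half (y y' : R) : Num.floor (2 * y) = Num.floor (2 * y') -> Num.floor y = Num.floor y'.
Proof.
move=> E; apply/esym/floor_def.
have /andP[l u] := floor_itv y.
have h1 : Num.floor y * 2 <= Num.floor (2 * y').
  by rewrite -E floor_ge_int intrM mulrC ler_pM2l.
have h2 : Num.floor (2 * y') < (Num.floor y + 1) * 2.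
  by rewrite -E floor_lt_int intrM mulrC ltr_pM2r.
move: h1 h2; rewrite floor_ge_int floor_lt_int !intrM mulrC ler_pM2l // => ->.
by rewrite mulrC ltr_pM2r.
Qed.

Lemma cell_coarser j k v v' : (j <= k)%N -> cell k v = cell k v' -> cell j v = cell j v'.
Proof.
move=> /subnK <-; elim: (k - j)%N => [//|m IH] E; apply: IH.
apply/rowP => i; have := congr1 (fun r : 'rV_n => r 0 i) E; rewrite !mxE addSn exprS.
by rewrite -!mulrA => /floor_half.
Qed.

Hypothesis uT : T \in unitmx.

Lemma cell_parallelepiped k (z : 'rV[int]_n) :
  [set v | cell k v = z] =
  parallelepiped ((2 ^- k *: \row_i (z 0 i)%:~R) *m T) (2 ^- k) T.
Proof.
have p0 : 0 < 2 ^+ k :> R by exact: exprn_gt0.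
have p1 : 2 ^+ k != 0 :> R by rewrite gt_eqF.
apply/seteqP; split=> v /=.
  move=> E; exists (v *m invmx T - 2 ^- k *: \row_i (z 0 i)%:~R); last first.
    by rewrite mulmxBl mulmxKV // addrC subrK.
  move=> i; have := congr1 (fun r : 'rV_n => r 0 i) E; rewrite !mxE => zi.
  have /andP[l u] := floor_itv (2 ^+ k * \sum_j v 0 j * invmx T j i).
  rewrite zi in l u; move: l u; move: (\sum_j _) => y l u.
  rewrite subr_ge0 ltrBlDr -[y](mulKf p1); apply/andP; split.
    by rewrite ler_pM2l ?invr_gt0.
  move: u; rewrite intrD => u.
  by rewrite -[X in _ < X + _]mulr1 -mulrDr ltr_pM2l ?invr_gt0 // addrC.
move=> [u uI <-]; apply/rowP => i; rewrite mxE; apply: floor_def.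
have /andP[u0 u1] := uI i.
rewrite mulmxDl !mulmxK // mxE mxE mxE mulrDr mulVKf // intrD.
rewrite lerDl mulr_ge0 ?(ltW p0) //= ltrD2l -[ltRHS](divff p1).
by rewrite ltr_pM2l.
Qed.

End Cells.

Section CellCover.
Context {R : realType} {n : nat} {X : riemannianManifold R n}.
Variables (phi : @chart R n X) (T : 'M[R]_n).
Hypothesis uT : T \in unitmx.

Lemma borel_open (A : set X) : open A -> measurable (A : set (borel X)).
Proof. by move=> oA; apply: sub_sigma_algebra; exact: oA. Qed.

Lemma cell_measurable (O : set X) k z : open O -> O `<=` cdom phi ->
  measurable ([set q | O q /\ cell T k (phi q) = z] : set (borel X)).
Proof.
move=> oO Ophi; pose f i (q : X) := 2 ^+ k * (phi q *m invmx T) 0 i.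
have below i (b : R) : measurable ([set q | O q /\ f i q < b] : set (borel X)).
  apply: borel_open; rewrite openE => q [Oq fq].
  have cf : {for q, continuous (f i)}.
    apply: cvgM; first exact: cvg_cst.
    apply: (@continuous_comp _ _ _ phi (fun v => (v *m invmx T) 0 i)).
      exact: chart_continuous (Ophi q Oq).
    have -> : (fun v : 'rV[R]_n => (v *m invmx T) 0 i) = (fun v => \sum_j v 0 j * invmx T j i).
      by apply/funext => v; rewrite mxE.
    suff : \sum_j v 0 j * invmx T j i @[v --> phi q] --> \sum_j phi q 0 j * invmx T j i by [].
    apply: cvg_big => [|j _]; first exact: add_continuous.
    by apply: cvgM; [exact: coord_continuous | exact: cvg_cst].
  have nO : nbhs q O by apply: open_nbhs_nbhs.
  apply: (filterS (P := O `&` [set q | f i q < b])); first by [].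
  by apply: filterI nO _; exact: (cvgr_lt _ cf _ fq).
have -> : [set q | O q /\ cell T k (phi q) = z] = O `&` \bigcap_(i in [set: 'I_n])
    ([set q | O q /\ f i q < (z 0 i + 1)%:~R] `\` [set q | O q /\ f i q < (z 0 i)%:~R]).
  apply/seteqP; split=> q /=.
    move=> [Oq E]; split=> // i _; have := congr1 (fun r : 'rV_n => r 0 i) E.
    rewrite mxE -/(f i q) => <-; have /andP[l u] := floor_itv (f i q).
    by split=> // -[_]; rewrite ltNge l.
  move=> [Oq H]; split=> //; apply/rowP => i; rewrite mxE; apply: floor_def.
  by have [[_ u] l] := H i I; rewrite u andbT leNgt; apply/negP => l'; apply: l.
apply: measurableI; first exact: borel_open.
by apply: fin_bigcap_measurable => // i _; apply: measurableD.
Qed.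

Lemma small_cell (O : set X) q : open O -> O `<=` cdom phi -> O q ->
  exists k, forall v, cell T k v = cell T k (phi q) -> exists2 q', O q' & phi q' = v.
Proof.
move=> oO Ophi Oq.
have /nbhs_ballP[r /= r0 H] := chart_near_range oO Oq (Ophi q Oq).
have [k kr] : exists k, opnorm T * 2 ^- k < r.
  have [k kr] : exists k : nat, (opnorm T + 1) / r < k%:R.
    by exists (Num.truncn ((opnorm T + 1) / r)).+1; exact: truncnS_gt.
  exists k; rewrite ltr_pdivrMr ?exprn_gt0 //.
  move: kr; rewrite ltr_pdivrMr // => kr.
  have : k%:R <= 2 ^+ k :> R by rewrite -natrX ler_nat ltnW // ltn_expl.
  by move=> /(ler_wpM2l (ltW r0)); move: kr; rewrite mulrC; move: (opnorm T) => *; lra.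
exists k => v E; have [q' [_ Oq'] <-] : exists2 z, cdom phi z /\ O z & phi z = v; last by exists q'.
apply: H; rewrite -ball_normE /=; apply: le_lt_trans kr.
have -> : phi q - v = (phi q - v) *m invmx T *m T by rewrite mulmxKV.
apply: le_trans (mulmx_norm_le _ _) _; apply: ler_wpM2l; first exact: opnorm_ge0.
have p0 : 0 < 2 ^+ k :> R by rewrite exprn_gt0.
apply: norm_rV_le => [|i]; first by rewrite invr_ge0 ltW.
have := congr1 (fun r : 'rV_n => r 0 i) E; rewrite mxE [RHS]mxE.
have -> : ((phi q - v) *m invmx T) 0 i = (phi q *m invmx T) 0 i - (v *m invmx T) 0 i.
  by rewrite mulmxBl !mxE.
move: ((v *m _) 0 i) ((phi q *m _) 0 i) => b a ab.
have /andP[l u] := floor_itv (2 ^+ k * a); have /andP[l' u'] := floor_itv (2 ^+ k * b).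
rewrite -ab in l u.
suff : `|2 ^+ k * a - 2 ^+ k * b| <= 1.
  by rewrite -mulrBr normrM (gtr0_norm p0) mulrC -ler_pdivlMr // div1r.
move: l u l' u'; rewrite !intrD mulr1z => *.
by rewrite ler_norml; apply/andP; split; lra.
Qed.

(** The maximal cells contained in an open set are disjoint, because cells are
    nested or disjoint, and cover it, because cells become arbitrarily small. *)
Lemma ex_cell_cover (O : set X) : open O -> O `<=` cdom phi ->
  exists E : nat -> set (borel X), [/\ forall m, measurable (E m), \bigcup_m E m = O,
    trivIset setT E & forall m, E m = set0 \/
      exists k z, phi @` E m = [set v | cell T k v = z]].
Proof.
move=> oO Ophi.
pose good k z := forall v, cell T k v = z -> exists2 q, O q & phi q = v.
pose D (i : nat * 'rV[int]_n) : set X := [set q | [/\ O q, cell T i.1 (phi q) = i.2, good i.1 i.2 &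
  forall j, (j < i.1)%N -> ~ good j (cell T j (phi q))]].
have D_full i : D i !=set0 -> D i = [set q | O q /\ cell T i.1 (phi q) = i.2] /\ good i.1 i.2.
  move=> [q0 [_ c0 g0 min0]]; split=> //; apply/seteqP; split=> q; first by case.
  move=> [Oq cq]; split=> // j ji; rewrite (cell_coarser (ltnW ji) (etrans cq (esym c0))).
  exact: min0.
pose E m : set (borel X) := if pickle_inv m is Some i then D i else set0.
exists E; split.
- move=> m; rewrite /E; case: pickle_inv => [i|]; last exact: measurable0.
  have [->|/set0P/D_full[-> _]] := eqVneq (D i) set0; first exact: measurable0.
  exact: cell_measurable.
- apply/seteqP; split=> q.
    by move=> [m _]; rewrite /E; case: pickle_inv => [i []|[]].
  move=> Oq; have ex_good : exists k, `[< good k (cell T k (phi q)) >].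
    have [k H] := small_cell oO Ophi Oq; exists k; apply/asboolP => v vE; exact: H.
  case: (ex_minnP ex_good) => k /asboolP gk kmin.
  exists (pickle (k, cell T k (phi q))) => //; rewrite /E pickleK_inv; split=> // j jk gj.
  by have := kmin j (asboolT gj); rewrite leqNgt jk.
- move=> m m' _ _ [q []]; rewrite /E.
  have := @pickle_invK (nat * 'rV[int]_n)%type m.
  have := @pickle_invK (nat * 'rV[int]_n)%type m'.
  case: (pickle_inv m) => [i|//]; case: (pickle_inv m') => [i'|//] /= mi' mi.
  move=> [Oq cq gq minq] [_ cq' gq' minq'].
  have ii' : i = i'.
    move: i i' cq gq minq cq' gq' minq' {mi mi'} => [k z] [k' z'] /= cq gq minq cq' gq' minq'.
    have kk' : k = k'.
      case: (ltngtP k k') => [lt|lt|->]; last by [].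
        by case: (minq' _ lt); rewrite cq; exact: gq.
      by case: (minq _ lt); rewrite cq'; exact: gq'.
    by rewrite -cq -cq' kk'.
  by rewrite -mi -mi' ii'.
- move=> m; rewrite /E; case: pickle_inv => [i|]; last by left.
  have [->|/set0P/D_full[-> g]] := eqVneq (D i) set0; [by left | right].
  exists i.1, i.2; apply/seteqP; split=> v.
    by move=> [q [_ <-] <-].
  by move=> vE; have [q Oq qv] := g v vE; exists q => //; split=> //; rewrite qv; exact: vE.
Qed.

End CellCover.

Section LocalVolume.
Context {R : realType} {n : nat} {X Y : riemannianManifold R n}.
Variables (muX : {measure set (borel X) -> \bar R}) (muY : {measure set (borel Y) -> \bar R}).
Hypotheses (rX : riemannian_volume muX) (rY : riemannian_volume muY).
Variables (F : X -> Y) (phi : @chart R n X) (psi : @chart R n Y) (x : X).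
Hypotheses (phi_at : atlas phi) (psi_at : atlas psi).
Variables (J T : 'M[R]_n).
Hypotheses (uT : T \in unitmx) (uJ : J \in unitmx).
Hypotheses (fT : flag_mx T) (fTJ : flag_mx (T *m J)).

Let h := psi \o F \o cinv phi.

Section Cell.
Variables (eps eta delta wx wy : R).
Hypotheses (eps0 : 0 <= eps) (eta0 : 0 <= eta) (wx0 : 0 <= wx) (wy0 : 0 <= wy).
Hypothesis h_diff : forall v w, `|v - phi x| < delta -> `|w - phi x| < delta ->
  `|h v - h w - (v - w) *m J| <= eps * `|v - w|.
Hypothesis eps_small : eps * (opnorm T * opnorm (invmx (T *m J))) <= eta.
Variables (E : set (borel X)) (k : nat) (z : 'rV[int]_n).
Hypotheses (mE : measurable E) (mFE : measurable (F @` E : set (borel Y))).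
Hypothesis Ecell : phi @` E = [set v | cell T k v = z].
Hypothesis EP : forall q, E q -> [/\ cdom phi q, cdom psi (F q), `|phi q - phi x| < delta,
  wx <= density phi (phi q) & density psi (psi (F q)) <= wy].

Let s : R := 2 ^- k.
Let s0 : 0 < s. Proof. by rewrite invr_gt0 exprn_gt0. Qed.

Lemma cell_volume_ge : ((wx * s ^+ n * `|\det T|)%:E <= muX E)%E.
Proof.
rewrite (rX phi_at mE); last by move=> q /EP[].
pose a := (s *: \row_i (z 0 i)%:~R) *m T.
rewrite -(flag_volume a fT s0 wx0); apply: rV_integral_mono => v.
  by rewrite lee_fin mulr_ge0 // indicE ler0n.
rewrite lee_fin Ecell (cell_parallelepiped uT) -/s -/a mulrC.
rewrite !indicE; case: (boolP (v \in _)) => [/set_mem|_]; last by rewrite !mul0r.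
rewrite -(cell_parallelepiped uT) -Ecell => -[q Eq <-].
by rewrite !mul1r; have [] := EP Eq.
Qed.

(** The image of a cell lies in the parallelepiped directed by [T *m J], enlarged by
    the error of the differential relative to the size of the cell. *)
Lemma image_volume_le :
  (muY (F @` E : set (borel Y)) <= (wy * (s * (1 + 2 * eta)) ^+ n * `|\det (T *m J)|)%:E)%E.
Proof.
rewrite (rY psi_at mFE); last by move=> _ [q /EP[_ ? _ _ _] <-].
pose a := (s *: \row_i (z 0 i)%:~R) *m T.
have Ea : (phi @` E) a.
  by rewrite Ecell (cell_parallelepiped uT); exists 0 => [i|]; rewrite ?mxE ?lexx //;
    rewrite mul0mx addr0.
have [qa Eqa qaE] := Ea.
pose b := h a - (\row_i (eta * s)) *m (T *m J).
have sp : 0 < s * (1 + 2 * eta) by rewrite mulr_gt0 // ltr_wpDr // mulr_ge0.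
rewrite -(flag_volume b fTJ sp wy0); apply: rV_integral_mono => v.
  by rewrite lee_fin mulr_ge0 ?indicE ?ler0n // sqrtr_ge0.
rewrite lee_fin mulrC !indicE.
case: (boolP (v \in psi @` _)) => [/set_mem|_]; last by rewrite mulr0 mulr_ge0 ?ler0n.
move=> [_ [q Eq <-] <-]; have [qphi qpsi qd _ qw] := EP Eq.
have [aphi _ ad _ _] := EP Eqa; rewrite qaE in ad.
suff inP : parallelepiped b (s * (1 + 2 * eta)) (T *m J) (psi (F q)).
  by rewrite mem_set // !mulr1.
have : (phi @` E) (phi q) by exists q.
rewrite Ecell (cell_parallelepiped uT) -/s -/a => -[u uI uE].
have hq : h (phi q) = psi (F q) by rewrite /h /= chartK.
have diff : phi q - a = u *m T by rewrite -uE addrAC subrr add0r.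
have uTJ : T *m J \in unitmx by rewrite unitmx_mul uT.
have [e eTJ e_le] : exists2 e : 'rV[R]_n,
    e *m (T *m J) = h (phi q) - h a - (phi q - a) *m J & forall i, `|e 0 i| <= eta * s.
  exists ((h (phi q) - h a - (phi q - a) *m J) *m invmx (T *m J)); first by rewrite mulmxKV.
  move=> i; apply: le_trans (coord_norm_le _ _) _; apply: le_trans (mulmx_norm_le _ _) _.
  have us : `|u| <= s.
    apply: norm_rV_le (ltW s0) _ => j; have /andP[u0 /ltW u1] := uI j.
    by rewrite ger0_norm.
  have d1 : `|h (phi q) - h a - (phi q - a) *m J| <= eps * (opnorm T * s).
    apply: le_trans (h_diff qd ad) _; apply: ler_wpM2l => //; rewrite diff.
    by apply: le_trans (mulmx_norm_le _ _) _; apply: ler_wpM2l => //; exact: opnorm_ge0.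
  apply: le_trans (ler_wpM2l (opnorm_ge0 _) d1) _.
  have := ler_wpM2r (ltW s0) eps_small.
  by move: (opnorm T) (opnorm _) => o1 o2; lra.
exists (u + e + \row_i (eta * s)).
  move=> i; rewrite !mxE; have /andP[u0 u1] := uI i; have := e_le i.
  rewrite ler_norml => /andP[e0 e1]; move: u0 u1 e0 e1; move: (u 0 i) (e 0 i) => ui ei *.
  by apply/andP; split; lra.
rewrite /b !mulmxDl -hq eTJ diff -mulmxA.
by apply/rowP => i; rewrite !mxE; ring.
Qed.

End Cell.

End LocalVolume.

(** Near [x] the map is its differential up to a small relative error, which is
    absorbed by enlarging the image cells slightly; the differential itself scales
    the Lebesgue measure by the quotient of the densities. Cutting an open set into
    cells, on which the densities are almost constant, reduces the claim to cells. *)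
Theorem local_volume_le {R : realType} {n : nat} {X Y : riemannianManifold R n}
    (muX : {measure set (borel X) -> \bar R}) (muY : {measure set (borel Y) -> \bar R})
    (F : X -> Y) (x : X) (U : set X) (c : R) :
  riemannian_volume muX -> riemannian_volume muY -> isometric_at F x -> nbhs x U ->
  (forall D : set (borel X), measurable D -> D `<=` U -> measurable (F @` D : set (borel Y))) ->
  1 < c -> exists2 N, nbhs x N & forall O : set X, open O -> O `<=` N ->
    (muY (F @` O : set (borel Y)) <= c%:E * muX (O : set (borel X)))%E.
Proof.
move=> rX rY [cF iso] nU mF c1.
have [phi phi_at phix] := atlas_cover x; have [psi psi_at psix] := atlas_cover (F x).
have [J [sd gE]] := iso phi psi phi_at psi_at phix psix.
have uJ := metric_unit phi_at phix gE.
have [T upT fTJ] := bruhat uJ; have uT := upper_unit upT; have fT := upper_flag upT.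
set wX := density phi (phi x); set wY := density psi (psi (F x)).
have wX0 : 0 < wX by exact: density_gt0.
have wY0 : 0 < wY by exact: density_gt0.
have wE : wX = wY * `|\det J|.
  rewrite /wX /wY /density gE !det_mulmx det_tr mulrAC mulrC -expr2 sqrtrM.
    by rewrite sqrtr_sqr.
  by apply/ltW/det_positive => v; exact: metric_pos.
have [eta [eta0 etaX etac]] : exists eta, [/\ 0 < eta, eta < wX &
    (wY + eta) * (1 + 2 * eta) ^+ n * `|\det J| < c * (wX - eta)].
  pose f (e : R) := c * (wX - e) - (wY + e) * (1 + 2 * e) ^+ n * `|\det J|.
  have fc : {for 0, continuous f}.
    apply: cvgB.
      by apply: cvgM; [exact: cvg_cst | apply: cvgB; [exact: cvg_cst | exact: cvg_id]].
    apply: cvgM; last exact: cvg_cst.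
    apply: cvgM; first by apply: cvgD; [exact: cvg_cst | exact: cvg_id].
    apply: (@continuous_comp _ _ _ (fun e : R => 1 + 2 * e) (fun y => y ^+ n)).
      apply: cvgD; first exact: cvg_cst.
      by apply: cvgM; [exact: cvg_cst | exact: cvg_id].
    exact: exprn_continuous.
  have f0 : 0 < f 0.
    by rewrite /f subr0 addr0 mulr0 addr0 expr1n mulr1 -wE subr_gt0 ltr_pMl.
  have /nbhs_ballP[d /= d0 H] : \forall e \near (0 : R), 0 < f e by exact: cvgr_gt _ fc _ f0.
  exists (Num.min (d / 2) (wX / 2)).
  have e0 : 0 < Num.min (d / 2) (wX / 2) by rewrite lt_min !divr_gt0.
  have e1 : Num.min (d / 2) (wX / 2) <= d / 2 by rewrite ge_min lexx.
  have e2 : Num.min (d / 2) (wX / 2) <= wX / 2 by rewrite ge_min lexx orbT.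
  move: (Num.min _ _) e0 e1 e2 => e e0 e1 e2; split=> //; first by lra.
  rewrite -subr_gt0; apply: H; rewrite -ball_normE /= sub0r normrN gtr0_norm //.
  by lra.
pose eps := eta / (opnorm T * opnorm (invmx (T *m J)) + 1).
have op0 : 0 <= opnorm T * opnorm (invmx (T *m J)) by rewrite mulr_ge0 ?opnorm_ge0.
have eps0 : 0 < eps by rewrite divr_gt0 // ltr_wpDl.
have eps_small : eps * (opnorm T * opnorm (invmx (T *m J))) <= eta.
  by rewrite /eps mulrAC ler_pdivrMr ?ltr_wpDl // ler_pM2l // lerDl.
have [delta delta0 h_diff] := sd eps eps0.
pose N := [set q | [/\ U q /\ cdom phi q, cdom psi (F q), `|phi q - phi x| < delta,
  wX - eta <= density phi (phi q) & density psi (psi (F q)) <= wY + eta]].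
have nN : nbhs x N.
  have cphi := chart_continuous phix.
  have cpsi : {for x, continuous (psi \o F)}.
    by apply: continuous_comp; [exact: cF | exact: chart_continuous].
  near=> q; split.
  - by split; near: q => //; exact: chart_near.
  - by near: q; apply: cF; exact: chart_near.
  - by near: q; have /cvgr_distC_lt := cphi; exact.
  - apply: ltW; near: q.
    have cd : {for x, continuous (density phi \o phi)}.
      by apply: continuous_comp => //; exact: density_continuous.
    by apply: (cvgr_gt _ cd); rewrite gtrBl.
  - apply: ltW; near: q.
    have cd : {for x, continuous (density psi \o (psi \o F))}.
      by apply: continuous_comp => //; exact: density_continuous.
    by apply: (cvgr_lt _ cd); rewrite ltrDl.
exists N => // O oO ON.
have Ophi : O `<=` cdom phi by move=> q /ON[[]].
have [E [mE EO tE Ecell]] := ex_cell_cover uT oO Ophi.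
have EsubO m : E m `<=` O by rewrite -EO; exact: bigcup_sup.
have mFE m : measurable (F @` E m : set (borel Y)).
  by apply: mF => // q /EsubO/ON[[]].
have cell_le m : (muY (F @` E m : set (borel Y)) <= c%:E * muX (E m))%E.
  have [->|[k [z Ek]]] := Ecell m; first by rewrite image_set0 !measure0 mule0.
  have EP q : E m q -> [/\ cdom phi q, cdom psi (F q), `|phi q - phi x| < delta,
      wX - eta <= density phi (phi q) & density psi (psi (F q)) <= wY + eta].
    by move=> /EsubO/ON[[_ ?] ? ? ? ?].
  have wx0 : 0 <= wX - eta by rewrite subr_ge0 ltW.
  have wy0 : 0 <= wY + eta by rewrite addr_ge0 // ltW.
  have lo := cell_volume_ge rX phi_at uT fT wx0 (mE m) Ek EP.
  have up := image_volume_le rY psi_at uT uJ fTJ (ltW eps0) (ltW eta0) wy0 h_diff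
    eps_small (mFE m) Ek EP.
  apply: le_trans up _.
  have c0 : (0 <= c%:E)%E by rewrite lee_fin ltW // (lt_trans ltr01).
  apply: le_trans (lee_wpmul2l c0 lo).
  rewrite -EFinM lee_fin det_mulmx normrM exprMn.
  have p0 : 0 <= (2 ^- k) ^+ n * `|\det T| by rewrite mulr_ge0 // exprn_ge0 // invr_ge0 exprn_ge0.
  have := ler_wpM2r p0 (ltW etac).
  by move: ((2 ^- k) ^+ n) ((1 + 2 * eta) ^+ n) `|\det T| `|\det J| => *; lra.
have -> : muX O = (\sum_(0 <= m <oo) muX (E m))%E.
  by rewrite -EO measure_semi_bigcup // EO; exact: borel_open.
have mFO : measurable (F @` O : set (borel Y)).
  by rewrite -EO image_bigcup; apply: bigcup_measurable => m _; exact: mFE.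
apply: (@le_trans _ _ (\sum_(0 <= m <oo) muY (F @` E m))%E).
  apply: measure_sigma_subadditive => //.
  by rewrite -EO image_bigcup.
rewrite -nneseriesZl; last by move=> m _; exact: measure_ge0.
by apply: lee_nneseries => m *; [exact: measure_ge0 | exact: cell_le].
Unshelve. all: by end_near. Qed.

(** * Points of a ball over the same point produce geodesic loops *)

Section TruncatedCurves.
Context {R : realType} {n : nat} {X : riemannianManifold R n}.

Lemma truncated_length (c : R -> X) (e : R) q : 0 < e ->
  (forall s, - e < s < 1 + e -> differentiable_curve c s) ->
  curve_length (fun s => if s \in `[0, 1] then c s else q) = curve_length c.
Proof.
move=> e0 dc; set d := fun s => _.
have sc : continuous (speed c \o clamp).
  move=> s; apply: continuous_comp; first exact: clamp_continuous.
  apply: speed_continuous; have /andP[s0 s1] := clamp_itv s.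
  near=> u; apply: dc; apply/andP; split; near: u.
    by apply: near_gtr; rewrite (lt_le_trans _ s0) // oppr_lt0.
  by apply: near_ltr; rewrite (le_lt_trans s1) // ltrDl.
have inside (s : R) : 0 < s < 1 -> speed d s = speed c s.
  move=> /andP[s0 s1].
  apply: (differentiable_curve_near_eq (c := c) (c' := d) (s := s) _ _).2.
    near=> u; rewrite /d in_itv /=.
    have -> : 0 <= u by apply: ltW; near: u; exact: near_gtr.
    by have -> : u <= 1 by apply: ltW; near: u; exact: near_ltr.
  by apply: dc; apply/andP; split; lra.
have msc : measurable_fun [set: R] (speed c \o clamp).
  exact: continuous_measurable_fun.
have same (f : R -> R) : (forall s : R, 0 < s < 1 -> f s = speed c s) ->
    (\int[lebesgue_measure]_(s in `[0, 1]) f s)%R =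
    (\int[lebesgue_measure]_(s in `]0%R, 1%R[) (speed c \o clamp) s)%R.
  move=> fE; rewrite /Rintegral integral_itv_bndoo.
    congr fine; apply: eq_integral => s; rewrite inE /= in_itv /= => sI.
    by rewrite /= (fE s sI) (clamp_id (lt2W sI)).
  apply: (eq_measurable_fun (EFin \o (speed c \o clamp))).
    move=> s; rewrite inE /= in_itv /= => sI.
    by rewrite /= (fE s sI) (clamp_id (lt2W sI)).
  apply/measurable_EFinP; apply: measurable_funS msc => //.
have E1 := same (speed d) inside.
have E2 := same (speed c) (fun s _ => erefl).
rewrite -E2 in E1.
exact E1.
Unshelve. all: by end_near. Qed.

Lemma geodesic_differentiable (c : R -> X) s : geodesic_at c s -> differentiable_curve c s.
Proof.
move=> [cc H]; split=> // phi phi_at phic; have [d1 d2 _] := H phi phi_at phic.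
have dc : {for s, continuous (derive1 (phi \o c))}.
  by apply: differentiable_continuous; apply/derivable1_diffP.
by exists (derive1 (phi \o c) s); exact: derivable_sder d1 dc.
Qed.

Lemma clamped_homotopy_continuous (H : R * R -> X) :
  {within `[0, 1] `*` `[0, 1], continuous H} ->
  continuous (fun su => H (clamp su.1, clamp su.2)).
Proof.
move=> /subspace_continuousP cH su W nW.
have I (v : R * R) : (`[0, 1] `*` `[0, 1])%classic (clamp v.1, clamp v.2).
  by split; rewrite /= in_itv /= clamp_itv.
have cl : (fun v : R * R => (clamp v.1, clamp v.2)) @ su --> (clamp su.1, clamp su.2).
  apply: (@cvg_pair _ _ _ (nbhs su) (nbhs (clamp su.1)) (nbhs (clamp su.2)) _ _ _
    (clamp \o fst) (clamp \o snd)).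
    by apply: continuous_comp; [exact: cvg_fst | exact: clamp_continuous].
  by apply: continuous_comp; [exact: cvg_snd | exact: clamp_continuous].
have H2 : \forall v \near su, (`[0, 1] `*` `[0, 1])%classic (clamp v.1, clamp v.2) ->
    W (H (clamp v.1, clamp v.2)) by exact: cl _ (cH _ (I su) _ nW).
suff : \forall v \near su, W (H (clamp v.1, clamp v.2)) by [].
by apply: filterS H2 => v; apply; exact: I.
Qed.

End TruncatedCurves.

Section LoopsOfFibers.
Context {R : realType} {n : nat} {K M : riemannianManifold R n}.
Variable p : K -> M.
Hypotheses (cov : covering_map p) (pull : metric_pullback p).
Hypotheses (aK : arcwise K) (aM : arcwise M) (cK : riemannian_complete K).

Local Notation dK := (@riemannian_dist R n K).
Local Notation dM := (@riemannian_dist R n M).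

Lemma projected_geodesic (c : R -> K) (s sp d : R) : 0 <= sp -> 0 < d ->
  (forall u v, `|u - s| < d -> `|v - s| < d -> dK (c u) (c v) = sp * `|v - u|) ->
  [/\ geodesic_at (p \o c) s, differentiable_curve (p \o c) s & speed (p \o c) s = sp].
Proof.
move=> sp0 d0 H; have [r r0 iso] := covering_local_isometry cov pull aK aM (c s).
have sp1 : 0 < sp + 1 by rewrite ltr_wpDl.
have e0 : 0 < Num.min d (r / (sp + 1)) by rewrite lt_min d0 divr_gt0.
apply: (metric_geodesic_regular aM (e := Num.min d (r / (sp + 1)))) => // u v.
have ss : `|s - s| < d by rewrite subrr normr0.
have near w : `|w - s| < Num.min d (r / (sp + 1)) -> `|w - s| < d /\ dK (c s) (c w) < r.
  rewrite lt_min => /andP[wd wr]; split=> //; rewrite H //.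
  move: wr; rewrite ltr_pdivlMr // mulrDr mulr1 mulrC; move: (normr_ge0 (w - s)).
  by move: (sp * _) => *; lra.
move=> /near[ud ur] /near[vd vr]; rewrite /= iso // H //.
Qed.

Definition loop_of (q : M) (c : R -> K) : R -> M :=
  fun s => if s \in `[0, 1] then p (c s) else q.

(** The projection of a minimal geodesic from x to y is a shortest loop of its class: a
    homotopic loop lifts to a path with the same end points. *)
Lemma minimal_loop x y : p x = p y -> exists c : R -> K,
  [/\ continuous (c \o clamp), c 0 = x, c 1 = y, geodesic_loop (p x) (loop_of (p x) c) &
    class_length (p x) (loop_of (p x) c) (dK x y)].
Proof.
move=> pxy; have [e e0 [c [c0 c1 cm]]] := complete_minimal_geodesic aK cK x y.
have geo s : - e < s < 1 + e -> [/\ geodesic_at (p \o c) s,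
    differentiable_curve (p \o c) s & speed (p \o c) s = dK x y].
  by move=> /cm[d d0 H]; apply: projected_geodesic d0 H; exact: dist_ge0.
have unit_in (s : R) : 0 <= s <= 1 -> - e < s < 1 + e.
  by move: e0 => e0 /andP[s0 s1]; apply/andP; split; lra.
have cc : continuous (c \o clamp).
  move=> s; apply: continuous_comp; first exact: clamp_continuous.
  have [d d0 H] := cm _ (unit_in _ (clamp_itv s)).
  by have [_ []] := metric_geodesic_regular aK d0 (dist_ge0 aK x y) H.
have dcont : continuous (p \o (c \o clamp)).
  move=> s; apply: (@continuous_comp _ _ _ (c \o clamp) p); first exact: cc.
  exact: (covering_continuous cov).
have loop : geodesic_loop (p x) (loop_of (p x) c).
  exists e, (p \o c); split=> //=; rewrite ?c0 ?c1 //.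
  by move=> s; rewrite in_itv /= => /geo[].
have len : curve_length (loop_of (p x) c) = dK x y.
  rewrite (truncated_length (c := p \o c) _ e0); last by move=> s /geo[].
  rewrite /curve_length -[RHS]mulr1.
  have E : {in `[0, 1], speed (p \o c) =1 cst (dK x y)}.
    by move=> s; rewrite in_itv /= => /unit_in/geo[].
  have -> : \int[lebesgue_measure]_(s in `[0, 1]) speed (p \o c) s =
      \int[lebesgue_measure]_(s in `[0, 1]) (cst (dK x y) s : R).
    by apply: eq_Rintegral => s; rewrite inE => /E.
  by rewrite Rintegral_cst //= lebesgue_measure_itv /= lte_fin ltr01 EFinN oppe0 adde0.
exists c; split=> //; exists (loop_of (p x) c); split=> //.
  exists (fun su => p (c (clamp su.1))); split.
  - apply: continuous_subspaceT => su.
    apply: (@continuous_comp _ _ _ fst (p \o (c \o clamp))); last exact: dcont.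
    exact: cvg_fst.
  - by move=> s; rewrite in_itv /= /loop_of in_itv /= => sI; rewrite clamp_id // sI.
  - by move=> u _; rewrite /loop_of !in_itv /= !lexx !ler01 !clamp_id // lexx ler01.
move=> d' [e' [g [e'0 gg g0 g1 ->]]] [H [cH H01 Hends]].
have dg s : - e' < s < 1 + e' -> differentiable_curve g s.
  by move=> sI; apply: geodesic_differentiable; apply: gg; rewrite in_itv.
rewrite (truncated_length _ e'0 dg).
have [f [cf f0 pf le]] := lift_length cov pull e'0 (esym g0) dg.
suff -> : y = f 1 by exact: le.
have <- : (c \o clamp) 1 = y by rewrite /= clamp_id // lexx ler01.
have I0 : (0 : R) \in `[0, 1] by rewrite in_itv /= lexx ler01.
have I1 : (1 : R) \in `[0, 1] by rewrite in_itv /= lexx ler01.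
have end0 u : 0 <= u <= 1 -> H (0, u) = p x.
  by move=> uI; have [] := Hends u; rewrite ?in_itv // => -> _; rewrite /loop_of I0 c0.
have end1 u : 0 <= u <= 1 -> H (1, u) = p x.
  by move=> uI; have [] := Hends u; rewrite ?in_itv // => _ ->; rewrite /loop_of I1 c1.
apply: (homotopy_lift cov (F := fun su => H (clamp su.1, clamp su.2)) (q := p x)).
- exact: clamped_homotopy_continuous.
- by move=> u uI; rewrite /= !(clamp_id unit0) !end0 // ?clamp_itv // unit0.
- by move=> u uI; rewrite /= !(clamp_id unit1) !end1 // ?clamp_itv.
- exact: cc.
- exact: cf.
- by rewrite /= clamp_id ?unit0 // c0 f0.
- move=> s sI /=; rewrite (clamp_id unit0) (clamp_id sI).
  by have [|-> _] := H01 s; rewrite ?in_itv // /loop_of in_itv /= sI.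
- move=> s sI /=; rewrite (clamp_id unit1) (clamp_id sI).
  by have [|_ ->] := H01 s; rewrite ?in_itv //= sI pf.
Qed.

(** An arc from [x] to one point [y i0] of the fibre, run backwards, lifts to an
    arc from each [y i] to a point over [p x]; a minimal geodesic from [x] to that
    point projects to a loop. *)
Theorem fiber_loops (x : K) (t : R) m (y : 'I_m -> K) : injective y ->
  (forall i, dK x (y i) < t / 2) -> (forall i j, p (y i) = p (y j)) ->
  (m%:R%:E <= loop_count (p x) t)%E.
Proof.
case: m y => [y _ _ _|m y yI yt yp].
  by rewrite /loop_count /counting; case: asboolP => _; rewrite ?leey // lee_fin ler_nat.
have [b ab lb] := dist_lt_length aK (yt ord0).
have [b' ab' lb'] := arc_rev ab; have [pb lpb] := projected_arc cov pull ab'.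
have lift i : exists f, [/\ arc f (y i) (f 1), forall s, p (f s) = p (b' s) &
    curve_length f < t / 2].
  have ab_i : arc (p \o b') (p (y i)) (p x) by rewrite (yp i ord0).
  have [f af [pf lf]] := lift_arc cov pull ab_i.
  exists f; split; [exact: af | exact: pf |].
  by rewrite lf lpb lb'; exact: lb.
have [f fP] := choice lift.
have px i : p x = p (f i 1).
  by have [_ -> _] := fP i; rewrite (arc1 ab').
have fI i j : f i 1 = f j 1 -> i = j.
  have [ai pi _] := fP i; have [aj pj _] := fP j => E.
  have rc k : arc (f k) (y k) (f k 1) -> continuous (fun s : R => f k (1 + s * -1)).
    move=> ak s; apply: continuous_comp; first exact: affine_continuous.
    exact: (arc_continuous ak).
  have := lift_unique cov (rc i ai) (rc j aj) _ _ unit1.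
  rewrite !mul0r !addr0 !mul1r subrr (arc0 ai) (arc0 aj) => H.
  have pij (s : R) : 0 <= s <= 1 -> p (f i (1 + s * -1)) = p (f j (1 + s * -1)).
    by move=> _; rewrite pi pj.
  exact: yI (H pij E).
have ft i : dK x (f i 1) <= t.
  have [ai _ li] := fP i; apply: le_trans (dist_triangle aK (y i) _ _) _.
  have := ltrD (yt i) (le_lt_trans (dist_le_length ai) li); rewrite -splitr.
  exact: ltW.
have [c cP] := choice (fun i => minimal_loop (px i)).
have dI : injective (fun i => loop_of (p x) (c i)).
  move=> i j E; apply: fI; have [ci ci0 <- _ _] := cP i; have [cj cj0 <- _ _] := cP j.
  have := lift_unique cov ci cj _ _ unit1.
  rewrite /= !(clamp_id unit1) !(clamp_id unit0) => H.
  apply: H; last by rewrite ci0 cj0.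
  move=> s sI; rewrite (clamp_id sI).
  by have := congr1 (@^~ s) E; rewrite /loop_of in_itv /= sI.
rewrite /loop_count /counting; case: asboolP => [fin|_]; last exact: leey.
rewrite lee_fin ler_nat -[m.+1]size_enum_ord -(size_map (fun i => loop_of (p x) (c i))).
apply: uniq_leq_size; first by rewrite map_inj_uniq ?enum_uniq.
move=> _ /mapP[i _ ->]; apply: etrans (in_fset_set fin _) _; apply: mem_set.
have [_ _ _ g l] := cP i; split; first exact: g.
by exists (dK x (f i 1)); [exact: l | exact: ft].
Qed.

End LoopsOfFibers.

(** * The volume of a ball of the covering is bounded by its multiplicity *)

Lemma lindelof {T : topologicalType} (N : T -> set T) (m0 : T) : @second_countable T ->
  (forall m, nbhs m (N m)) -> exists u : nat -> T, forall q, exists j, N (u j) q.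
Proof.
move=> [B /countable_injP[f finj] [_ Bbase]] nN.
exists (fun j => xget m0 [set m | exists b, [/\ B b, f b = j & b `<=` N m]]) => q.
have [b [Bb bq] bN] := Bbase q (N q) (nN q).
exists (f b); case: xgetP => [m _ [b' [Bb' E b'N]]|/(_ q)[]]; last by exists b.
by apply: b'N; rewrite (finj b' b) ?mem_set.
Qed.

Lemma ex_invn_lt {R : realType} (e : R) : 0 < e -> exists k : nat, k.+1%:R^-1 < e.
Proof.
move=> e0; exists (Num.truncn e^-1); rewrite -[e in _ < e]invrK ltf_pV2 ?posrE ?ltr0Sn ?invr_gt0 //.
exact: truncnS_gt.
Qed.

Lemma sum_cst {R : realType} k (a : \bar R) : (0 <= a)%E ->
  (\sum_(j < k) a = k%:R%:E * a)%E.
Proof.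
move=> a0; elim: k => [|k IH]; first by rewrite big_ord0 mul0e.
by rewrite big_ord_recr /= IH -natr1 EFinD ge0_muleDl ?mul1e // lee_fin.
Qed.

Section VolumeOfBalls.
Context {R : realType} {n : nat} {K M : riemannianManifold R n}.
Variable p : K -> M.
Variables (volM : {measure set (borel M) -> \bar R}) (volK : {measure set (borel K) -> \bar R}).
Hypotheses (rM : riemannian_volume volM) (rK : riemannian_volume volK).
Hypothesis finM : (volM [set: M] < +oo)%E.
Hypotheses (cov : covering_map p) (pull : metric_pullback p).
Hypotheses (aK : arcwise K) (aM : arcwise M).

Local Notation dK := (@riemannian_dist R n K).
Local Notation dM := (@riemannian_dist R n M).

Lemma preimage_measurable (A : set (borel M)) : measurable A ->
  measurable (p @^-1` A : set (borel K)).
Proof.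
pose C := [set A : set M | measurable (p @^-1` A : set (borel K))].
have CS : sigma_algebra [set: M] C.
  split=> [|A0 mA|F mF]; rewrite /C /=.
  - by rewrite preimage_set0; exact: measurable0.
  - by rewrite setTD preimage_setC; exact: measurableC.
  - by rewrite preimage_bigcup; apply: bigcup_measurable => k _; exact: mF.
have CO : @open M `<=` C.
  move=> U oU; apply: borel_open; apply: open_comp => // z _.
  exact: (covering_continuous cov).
exact: (smallest_sub CS CO).
Qed.

Variables (x : K) (t : R) (N : nat).
Hypothesis multiplicity : forall k (y : 'I_k -> K), injective y ->
  (forall i, dK x (y i) < t) -> (forall i j, p (y i) = p (y j)) -> (k <= N)%N.

Let ball_measurable r : measurable (riemannian_ball x r : set (borel K)).
Proof. by apply: borel_open; exact: ball_open. Qed.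

(** A maximal injective family exhausts the fibre in the ball. *)
Lemma fiber_enumeration m : exists k (y : 'I_k -> K), [/\ (k <= N)%N,
  forall i, p (y i) = m /\ dK x (y i) < t &
  forall z, p z = m -> dK x z < t -> exists i, z = y i].
Proof.
pose P k := `[< exists y : 'I_k -> K, injective y /\ forall i, p (y i) = m /\ dK x (y i) < t >].
have P0 : exists k, P k.
  by exists 0%N; apply/asboolP; exists (fun=> x); split=> [[]|[]].
have PN k : P k -> (k <= N)%N.
  move/asboolP => [y [yI yP]]; apply: (multiplicity yI) => [i|i j]; first by case: (yP i).
  by have [-> _] := yP i; have [-> _] := yP j.
have [k /asboolP[y [yI yP]] kmax] := ex_maxnP P0 PN.
exists k, y; split=> //; first by apply: PN; apply/asboolP; exists y.
move=> z pz zt; apply: contrapT => nz.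
suff /kmax : P k.+1 by rewrite ltnn.
apply/asboolP; exists (fun i => if unlift ord0 i is Some j then y j else z); split.
  move=> i j; case: unliftP => [i' ->|->]; case: unliftP => [j' ->|->] //.
  - by move/yI => ->.
  - by move=> E; case: nz; exists i'.
  - by move=> E; case: nz; exists j'.
by move=> i; case: unliftP => [j _|_].
Qed.

(** Over a small ball about [m], the sheets that meet the smaller ball of [K] are
    those through the points of the fibre of [m] in the larger one. *)
Lemma local_multiplicity r c m : r < t -> 1 < c -> exists2 d : R, 0 < d &
  forall O : set M, open O -> O `<=` riemannian_ball m d ->
    (volK (p @^-1` O `&` riemannian_ball x r : set (borel K))
       <= (N%:R * c)%:E * volM (O : set (borel M)))%E.
Proof.
move=> rt c1; have [k [y [kN yP yall]]] := fiber_enumeration m.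
have [U [sheets [r0 [ev r0_gt0 rU H]]]] := sheet_isometry cov pull aK aM m.
have mm : dM m m < r0 by rewrite dist_xx.
have Um := rU m mm.
have oU : open U by case: ev.
have sec i : exists sg : M -> K, exists V : set K, exists Ni : set M, [/\ sheets V, V (y i),
    (forall q, U q -> [/\ V (sg q), p (sg q) = q & {for q, continuous sg}]) /\
    (forall w, V w -> sg (p w) = w), nbhs m Ni &
    forall O : set M, open O -> O `<=` Ni ->
      (volK (sg @` O : set (borel K)) <= c%:E * volM (O : set (borel M)))%E].
  have [V sV Vy] : exists2 V, sheets V & V (y i).
    by apply: (ex_sheet ev); rewrite (yP i).1.
  have [sg [sgP sgK]] := ex_section ev (y i) sV.
  have nU : nbhs m U by apply: open_nbhs_nbhs.
  have mF (D : set (borel M)) : measurable D -> D `<=` U ->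
      measurable (sg @` D : set (borel K)).
    move=> mD DU; have -> : sg @` D = p @^-1` D `&` V.
      apply/seteqP; split=> z.
        by move=> [q Dq <-]; have [Vq pq _] := sgP q (DU q Dq); split=> //=; rewrite pq.
      by move=> [Dz Vz]; exists (p z) => //; exact: sgK.
    apply: measurableI; first exact: preimage_measurable.
    by apply: borel_open; exact: sheet_open ev V sV.
  have [Ni nNi HN] := local_volume_le rM rK (section_isometric cov pull ev sV Um sgP) nU mF c1.
  by exists sg, V, Ni.
have [sg {}sec] := choice sec; have [V {}sec] := choice sec; have [Ni {}sec] := choice sec.
have nall : \forall q \near m, forall i, Ni i q.
  by apply: (filter_forall (f := Ni)) => i; have [_ _ _ ? _] := sec i.
have [d1 d1_gt0 Hd1] := nbhs_dist aM nall.
pose d := Num.min d1 (Num.min r0 (t - r)).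
exists d; first by rewrite !lt_min d1_gt0 r0_gt0 subr_gt0.
move=> O oO Od.
have Od1 q : O q -> [/\ dM m q < d1, dM m q < r0 & dM m q < t - r].
  by move=> /Od; rewrite /riemannian_ball /= !lt_min => /andP[? /andP[? ?]].
pose F (j : nat) : set (borel K) := \bigcup_(i in [set i : 'I_k | i = j :> nat]) (sg i @` O).
have FE (i : 'I_k) : F i = sg i @` O.
  apply/seteqP; split=> z; first by move=> [j /= /val_inj ->].
  by move=> ?; exists i.
have mimg i : measurable (sg i @` O : set (borel K)).
  have [sV _ [sgP sgK] _ _] := sec i.
  have -> : sg i @` O = p @^-1` O `&` V i.
    apply/seteqP; split=> z.
      move=> [q Oq <-]; have [_ qr0 _] := Od1 q Oq.
      by have [Vq pq _] := sgP q (rU q qr0); split=> //=; rewrite pq.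
    by move=> [Oz Vz]; exists (p z) => //; exact: sgK.
  apply: borel_open; apply: openI; last exact: sheet_open ev _ sV.
  by apply: open_comp => // z _; exact: (covering_continuous cov).
have cover : p @^-1` O `&` riemannian_ball x r `<=` \big[setU/set0]_(j < k) F j.
  move=> z [Oz xz]; have [_ pr0 ptr] := Od1 _ Oz.
  have [W sW Wz] := ex_sheet ev (rU _ pr0).
  have [sW' [sWP sWK]] := ex_section ev z sW.
  have [Wm pm _] := sWP m Um.
  have zm : dK z (sW' m) = dM (p z) m.
    by have := (H W z (sW' m) sW Wz pr0).2 Wm; rewrite pm; apply.
  have xm : dK x (sW' m) < t.
    apply: le_lt_trans (dist_triangle aK z _ _) _; rewrite zm (dist_sym aM).
    have := ltrD xz ptr; rewrite [r + _]addrC subrK; exact.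
  have [i yi] := yall _ pm xm.
  have [sV Vy [sgP sgK] _ _] := sec i.
  have VW : V i = W by apply: (sheet_unique ev sV sW Vy); rewrite -yi.
  rewrite -bigcup_mkord; exists (i : nat) => /=; first exact: ltn_ord.
  rewrite FE; exists (p z) => //; apply: sgK; by rewrite VW.
have mlhs : measurable (p @^-1` O `&` riemannian_ball x r : set (borel K)).
  by apply: measurableI => //; apply: preimage_measurable; exact: borel_open.
apply: le_trans (@content_subadditive _ _ _ volK _ F k _ mlhs cover) _.
  by move=> j jk; have -> : j = Ordinal jk by []; rewrite FE.
apply: (@le_trans _ _ (\sum_(j < k) c%:E * volM (O : set (borel M)))%E).
  apply: lee_sum => i _; rewrite FE; have [_ _ _ _ HO] := sec i.
  by apply: HO => // q /Od1[/Hd1 ? _ _].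
rewrite sum_cst; last by rewrite mule_ge0 // lee_fin ltW // (lt_trans ltr01).
rewrite EFinM -muleA.
apply: lee_wpmul2r; last by rewrite lee_fin ler_nat.
by rewrite mule_ge0 // lee_fin ltW // (lt_trans ltr01).
Qed.

(** Countably many of the small balls cover the base; the bound is summed over the
    disjoint pieces cut out by them. *)
Lemma ball_volume_le r c : r < t -> 1 < c ->
  (volK (riemannian_ball x r : set (borel K)) <= (N%:R * c)%:E * volM [set: M])%E.
Proof.
move=> rt c1; have ex m : exists d : R, 0 < d /\ forall O : set M, open O -> O `<=` riemannian_ball m d ->
    (volK (p @^-1` O `&` riemannian_ball x r : set (borel K))
       <= (N%:R * c)%:E * volM (O : set (borel M)))%E.
  by have [d d0 H] := local_multiplicity m rt c1; exists d.
have [d dP] := choice ex.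
set C := N%:R * c; have C0 : 0 <= C by rewrite mulr_ge0 // ltW // (lt_trans ltr01).
have [u uP] : exists u : nat -> M, forall q, exists j, riemannian_ball (u j) (d (u j)) q.
  apply: (lindelof (N := fun m => riemannian_ball m (d m)) (p x)).
    exact: manifold_second_countable.
  move=> m; apply: open_nbhs_nbhs; split; first exact: ball_open.
  by rewrite /riemannian_ball /= dist_xx //; case: (dP m).
pose B j : set M := riemannian_ball (u j) (d (u j)).
pose E := seqDU B.
have oB j : open (B j) by exact: ball_open.
have mE j : measurable (E j : set (borel M)).
  apply: measurableD; first exact: borel_open.
  by apply: bigsetU_measurable => i _; exact: borel_open.
have EB : \bigcup_j E j = [set: M].
  by rewrite -seqDU_bigcup_eq; apply/seteqP; split=> // q _; have [j ?] := uP q; exists j.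
(* The bound is known for open subsets of [B j] only, and [E j] is the limit of
   a decreasing sequence of them; this is where the finite volume is used. *)
have piece j : (volK (p @^-1` E j `&` riemannian_ball x r : set (borel K)) <=
    C%:E * volM (E j : set (borel M)))%E.
  pose G k : set M := B j `&` [set q | forall i, (i < j)%N -> d (u i) - k.+1%:R^-1 < dM (u i) q].
  have oG k : open (G k).
    apply: openI => //; rewrite openE => q Hq.
    have nearq (i : 'I_j) : \forall q' \near q, d (u i) - k.+1%:R^-1 < dM (u i) q'.
      have cd : dM (u i) @ q --> dM (u i) q by exact: (dist_continuous aM).
      exact: (cvgr_gt _ cd _ (Hq i (ltn_ord i))).
    have allq : \forall q' \near q, forall i : 'I_j, d (u i) - k.+1%:R^-1 < dM (u i) q'.
      exact: (filter_forall (f := fun (i : 'I_j) q' => d (u i) - k.+1%:R^-1 < dM (u i) q')).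
    by apply: filterS allq => q' Hq' i ij; exact: (Hq' (Ordinal ij)).
  have GE : \bigcap_k G k = E j.
    apply/seteqP; split=> q.
      move=> Gq; split; first by case: (Gq 0%N I).
      rewrite -bigcup_mkord => -[i /= ij Bi].
      have [k ke] := ex_invn_lt (e := d (u i) - dM (u i) q) ltac:(by rewrite subr_gt0).
      have [_ /(_ i ij)] := Gq k I; rewrite ltrBlDr -ltrBlDl ltNge.
      by rewrite ltW.
    move=> [Bq nB] k _; split=> // i ij; rewrite ltNge; apply/negP => le.
    apply: nB; rewrite -bigcup_mkord; exists i => //=.
    apply: le_lt_trans le _; rewrite gtrBl invr_gt0; exact: ltr0Sn.
  have Gd : nonincreasing_seq G.
    move=> k k' kk'; apply/subsetPset => q [Bq Hq]; split=> // i ij.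
    apply: le_lt_trans (Hq i ij); rewrite lerD2l lerN2 lef_pV2 ?posrE ?ltr0Sn //.
    by rewrite ler_nat ltnS.
  have mG k : measurable (G k : set (borel M)) by exact: borel_open.
  have G0 : (volM (G 0%N : set (borel M)) < +oo)%E.
    by apply: le_lt_trans finM; apply: le_measure; rewrite ?inE //; exact: measurableT.
  have cG := nonincreasing_cvg_mu G0 mG (bigcapT_measurable mG) Gd.
  rewrite GE in cG.
  apply: (cvge_ge _ (cvgeZl (y := C%:E) _ cG)) => //.
  apply: nearW => k /=; apply: (@le_trans _ _
      (volK (p @^-1` G k `&` riemannian_ball x r : set (borel K)))).
    apply: le_measure; rewrite ?inE.
    - by apply: measurableI => //; exact: preimage_measurable.
    - by apply: measurableI => //; exact: preimage_measurable.
    - by apply: setSI; apply: preimage_subset; rewrite -GE; exact: bigcap_inf.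
  by have [_] := dP (u j); apply => // q [].
apply: (@le_trans _ _ (\sum_(0 <= j <oo) volK (p @^-1` E j `&` riemannian_ball x r : set (borel K)))%E).
  apply: measure_sigma_subadditive => //.
    by move=> j; apply: measurableI => //; exact: preimage_measurable.
  move=> z xz; have : (\bigcup_j E j) (p z) by rewrite EB.
  by move=> [j _ Ej]; exists j.
have -> : volM [set: M] = (\sum_(0 <= j <oo) volM (E j : set (borel M)))%E.
  rewrite -EB measure_semi_bigcup //; first exact: trivIset_seqDU.
  by rewrite EB; exact: measurableT.
rewrite -nneseriesZl; last by move=> j _; exact: measure_ge0.
by apply: lee_nneseries => j *; [exact: measure_ge0 | exact: piece].
Qed.

Theorem ball_volume_le_multiplicity :
  (volK (riemannian_ball x t : set (borel K)) <= N%:R%:E * volM [set: M])%E.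
Proof.
have le_r r : r < t -> (volK (riemannian_ball x r : set (borel K)) <= N%:R%:E * volM [set: M])%E.
  move=> rt; have vfin : volM [set: M] \is a fin_num by rewrite ge0_fin_numE.
  apply/lee_addgt0Pr => e e0.
  pose v := fine (volM [set: M]); have v0 : 0 <= v by rewrite fine_ge0.
  have Nv : 0 <= N%:R * v by rewrite mulr_ge0.
  pose c := 1 + e / (N%:R * v + 1).
  have c1 : 1 < c by rewrite ltrDl divr_gt0 // ltr_wpDl.
  apply: le_trans (ball_volume_le rt c1) _.
  rewrite -(fineK vfin) -!EFinM -EFinD lee_fin -/v /c.
  have : e / (N%:R * v + 1) * (N%:R * v) <= e.
    by rewrite mulrAC ler_pdivrMr ?ltr_wpDl // ler_pM2l // lerDl.
  by move: (e / _) => q; lra.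
pose F k : set (borel K) := riemannian_ball x (t - k.+1%:R^-1).
have FE : \bigcup_k F k = riemannian_ball x t.
  apply/seteqP; split=> z.
    by move=> [k _]; rewrite /F /riemannian_ball /= => /lt_trans; apply;
      rewrite gtrBl invr_gt0 ltr0Sn.
  move=> zt; have [k ke] := ex_invn_lt (e := t - dK x z) ltac:(by rewrite subr_gt0).
  by exists k => //; rewrite /F /riemannian_ball /= ltrBrDr addrC -ltrBrDr.
have Fnd : nondecreasing_seq F.
  move=> k k' kk'; apply/subsetPset => z; rewrite /F /riemannian_ball /= => /lt_le_trans; apply.
  by rewrite lerD2l lerN2 lef_pV2 ?posrE ?ltr0Sn // ler_nat ltnS.
have cF : volK \o F @ \oo --> volK (\bigcup_k F k).
  by apply: nondecreasing_cvg_mu => //; [move=> k; exact: ball_measurable | rewrite FE].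
rewrite FE in cF; apply: (cvge_le _ cF); apply: nearW => k /=.
by apply: le_r; rewrite gtrBl invr_gt0; exact: ltr0Sn.
Qed.

End VolumeOfBalls.

(** * Volumes of balls and geodesic loops *)

Lemma path_connected_connected {R : realType} (T : topologicalType) (x : T) :
  (forall y : T, exists c : R -> T,
      [/\ {within `[0, 1], continuous c}, c 0 = x & c 1 = y]) -> connected [set: T].
Proof.
move=> paths; have [c cP] := choice paths.
have -> : [set: T] = \bigcup_(y in [set: T]) (c y @` `[0, 1]).
  apply/seteqP; split=> // y _; exists y => //; exists 1; last by have [] := cP y.
  by rewrite /= in_itv /= ler01 lexx.
apply: bigcup_connected.
  exists x => y _; exists 0; last by have [] := cP y.
  by rewrite /= in_itv /= ler01 lexx.
move=> y _; apply: connected_continuous_connected; last by have [] := cP y.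
exact: segment_connected.
Qed.

Theorem corollary1p3 (R : realType) (n : nat)
    (M K : riemannianManifold R n) (p : K -> M)
    (volM : {measure set (borel M) -> \bar R})
    (volK : {measure set (borel K) -> \bar R})
    (M_connected : connected [set: M])
    (M_complete : riemannian_complete M)
    (M_nonpos : nonpositively_curved M)
    (volM_riem : riemannian_volume volM)
    (volK_riem : riemannian_volume volK)
    (volM_finite : (volM [set: M] < +oo)%E)
    (p_cover : riemannian_universal_covering p)
    (t : R) (t_gt0 : 0 < t) :
  exists (x : K) (q : M), q = p x /\
    (volK (riemannian_ball x (t / 2)) / volM [set: M] - 2%:E
       <= loop_count q t)%E.
Proof.
have [[paths _] cov pull] := p_cover.
have x : K := point.
have aK : arcwise K by apply/connected_arcwise/(path_connected_connected (paths x)).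
have aM : arcwise M by exact: connected_arcwise.
have cK := covering_complete cov pull aK aM M_complete.
exists x, (p x); split=> //.
have loops k (y : 'I_k -> K) : injective y -> (forall i, riemannian_dist x (y i) < t / 2) ->
    (forall i j, p (y i) = p (y j)) -> (k%:R%:E <= loop_count (p x) t)%E.
  exact: fiber_loops.
have : (exists N : nat, loop_count (p x) t = N%:R%:E) \/ loop_count (p x) t = +oo%E.
  rewrite /loop_count /counting; case: asboolP => _; last by right.
  by left; eexists; reflexivity.
case=> [[N NE]|->]; last by rewrite leey.
have vol_le : (volK (riemannian_ball x (t / 2)) <= N%:R%:E * volM [set: M])%E.
  apply: (ball_volume_le_multiplicity volM_riem volK_riem volM_finite cov pull aK aM).
  by move=> k y yI yt yp; have := loops k y yI yt yp; rewrite NE lee_fin ler_nat.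
rewrite NE.
have le2 : (volK (riemannian_ball x (t / 2)) / volM [set: M] <= N%:R%:E)%E.
  have [v vE] : exists v, volM [set: M] = v%:E.
    by exists (fine (volM [set: M])); rewrite fineK // ge0_fin_numE.
  have v0 : 0 <= v by rewrite -lee_fin -vE; exact: measure_ge0.
  have w0 : (0 <= volK (riemannian_ball x (t / 2)))%E by exact: measure_ge0.
  rewrite vE in vol_le *.
  move: (volK (riemannian_ball x (t / 2))) vol_le w0 => w wv w0.
  have [vz|v_neq] := eqVneq v 0.
    rewrite vz mule0 in wv; have -> : w = 0%E by apply/le_anti; rewrite wv.
    by rewrite mul0e lee_fin ler0n.
  by rewrite inver (negbTE v_neq) lee_pdivrMr // lt_def v_neq.
apply: le_trans le2; rewrite leeBlDr // leeDl // lee_fin ler0n.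
Qed.
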